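(* Let $\lambda\ge 5/2$ and let $K$ be a symmetric Markov operator, bounded in $L^2(\mu^{(\lambda)})$. Assume that $K$ commutes with $\mathrm{L}^{(\lambda)}$. Then, for any $(n,k)\in\mathbb{N}^2$, it satisfies $$\begin{pmatrix}K(P_{n,k})\\ K(Q_{n,k})\end{pmatrix}=\begin{pmatrix}a_{n,k}&b_{n,k}\\ b_{n,k}&c_{n,k}\end{pmatrix}\begin{pmatrix}P_{n,k}\\ Q_{n,k}\end{pmatrix}$$ for some real numbers $a_{n,k},b_{n,k},c_{n,k}$, and there exists a probability measure $\nu$ on the (closed) deltoid domain $\overline{\Omega}$ such that, for all $n,k$, $$a_{n,k}=\int\frac{P_{n,k}(z)}{P_{n,k}(1)}\,\nu(dz),\qquad b_{n,k}=\int\frac{Q_{n,k}(z)}{P_{n,k}(1)}\,\nu(dz).$$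
   Context: **Deltoid model.** Identify $\mathbb{R}^2\simeq\mathbb{C}$, $Z=x+iy$, $\bar Z=x-iy$. Let $\Omega$ be the bounded connected component containing $0$ of the complement of the deltoid curve $x(t)=\frac13(2\cos t+\cos 2t)$, $y(t)=\frac13(2\sin t-\sin 2t)$. For $\lambda>0$ let $\mathrm{L}^{(\lambda)}$ be the second order differential operator $$\mathrm{L}^{(\lambda)}f=\Gamma(Z,Z)\partial_Z^2f+2\Gamma(Z,\bar Z)\partial_Z\partial_{\bar Z}f+\Gamma(\bar Z,\bar Z)\partial_{\bar Z}^2f-\lambda Z\partial_Zf-\lambda\bar Z\partial_{\bar Z}f,$$ with $\Gamma(Z,Z)=\bar Z-Z^2$, $\Gamma(\bar Z,\bar Z)=Z-\bar Z^2$, $\Gamma(Z,\bar Z)=\frac12(1-Z\bar Z)$. It is symmetric with respect to the probability measure $\mu^{(\lambda)}$ on $\Omega$ with density $C_\alpha P(Z,\bar Z)^\alpha$ with respect to Lebesgue measure, where $P(Z,\bar Z)=\Gamma(Z,\bar Z)^2-\Gamma(Z,Z)\Gamma(\bar Z,\bar Z)$, $\lambda=\frac12(6\alpha+5)$ and $C_\alpha$ is the normalizing constant. It maps polynomials of total degree at most $m$ into themselves for each $m$, is extended to a self-adjoint operator on $L^2(\mu^{(\lambda)})$, and is diagonalized in a basis of orthogonal polynomials. **Polynomials.** Let $\lambda_{n,k}=(\lambda-1)(n+k)+n^2+k^2+nk$. For $n\neq k$, $P_{n,k}$ and $Q_{n,k}$ denote the real-valued polynomials in $(Z,\bar Z)$,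 of degree $n+k$ and norm $1$ in $L^2(\mu^{(\lambda)})$, unique up to sign, which satisfy $\mathrm{L}^{(\lambda)}P_{n,k}=-\lambda_{n,k}P_{n,k}$ and $\mathrm{L}^{(\lambda)}Q_{n,k}=-\lambda_{n,k}Q_{n,k}$, with $P_{n,k}$ symmetric and $Q_{n,k}$ antisymmetric under $(Z,\bar Z)\mapsto(\bar Z,Z)$. They are obtained by normalizing $\frac12(R_{n,k}+R_{k,n})$ and $\frac1{2i}(R_{n,k}-R_{k,n})$, where $R_{n,k}$ is the polynomial eigenvector with eigenvalue $-\lambda_{n,k}$, with real coefficients, whose only highest degree term is $Z^n\bar Z^k$; the eigenspace for $-\lambda_{n,k}$ is described as having dimension $2$, with orthonormal basis $(P_{n,k},Q_{n,k})$. For $n=k$ there is exactly one such eigenvector $P_{n,n}$ (up to sign), it is symmetric, and by convention $Q_{n,n}=0$. One writes $P_{n,k}(Z)$ for $P_{n,k}(Z,\bar Z)$, and similarly $Q_{n,k}(Z)$. **Markov operator.** $K$ is Markov if $K(\mathbf 1)=\mathbf 1$ and $K(f)\ge0$ whenever $f\ge0$.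
   Formalization: The claims on K, a, b, c and ν are made for those (n,k) whose eigenspace for −λ_{n,k} is spanned by P_{n,k}, Q_{n,k}, as the paper describes; this fails when eigenvalues coincide (λ=4: λ_{8,0}=λ_{5,4}=88), and the claim is then false. *)

(* Defs.v *)
From HB Require Import structures.
From mathcomp Require Import all_boot all_order all_algebra.
From mathcomp Require Import complex.
From mathcomp Require Import all_classical all_reals all_analysis.
Set Implicit Arguments.
Unset Strict Implicit.
Unset Printing Implicit Defensive.
Import Order.TTheory GRing.Theory Num.Theory.
Import numFieldNormedType.Exports.

Local Open Scope classical_set_scope.
Local Open Scope ring_scope.

Section Deltoid.
Context {R : realType}.
Implicit Types (z : R * R) (lambda : R) (f g : R * R -> R).

(* The plane is R * R, with its product topology and sigma-algebra; a point
   (x, y) is seen as the complex number x + iy through toC. *)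
Definition toC z : R[i] := Complex z.1 z.2.

(* Polynomials in (Z, Zbar): 'X stands for Z and 'Y = 'X%:P for Zbar, as in
   the bivariate evaluation p.[x, y] = p.[x%:P].[y] of polyXY. *)
Local Notation bipoly := {poly {poly R[i]}}.
Implicit Types p q : bipoly.

Definition realC (c : R) : bipoly := (Complex c 0)%:P%:P.
Definition vZ : bipoly := 'X.
Definition vZbar : bipoly := 'Y.

Definition dZ p : bipoly := p^`().
Definition dZbar p : bipoly := map_poly (@deriv R[i]) p.

Definition evalC p z : R[i] := p.[toC z, (toC z)^*%R].
Definition real_valued p := forall z, complex.Im (evalC p z) = 0.
Definition evalR p z : R := complex.Re (evalC p z).

Definition tdeg p : nat :=
  (\max_(i < size p | (p`_i)%R != 0%R) (i + (size (p`_i)%R).-1))%N.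

(* swapXY is the exchange (Z, Zbar) |-> (Zbar, Z). *)
Definition symmetricZ p := swapXY p = p.
Definition antisymmetricZ p := swapXY p = - p.

Definition deltoid_curve : set (R * R) :=
  range (fun t : R => (3^-1 * (2 * cos t + cos (2 * t)),
                       3^-1 * (2 * sin t - sin (2 * t)))).

Definition Omega : set (R * R) :=
  connected_component (~` deltoid_curve) (0, 0).

Definition GammaZZ : bipoly := vZbar - vZ ^+ 2.
Definition GammaZbarZbar : bipoly := vZ - vZbar ^+ 2.
Definition GammaZZbar : bipoly := realC 2^-1 * (1 - vZ * vZbar).

Definition Lop lambda p : bipoly :=
  GammaZZ * dZ (dZ p) + 2 * GammaZZbar * dZ (dZbar p)
  + GammaZbarZbar * dZbar (dZbar p)
  - realC lambda * vZ * dZ p - realC lambda * vZbar * dZbar p.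

Definition eigval lambda (n k : nat) : R :=
  (lambda - 1) * (n + k)%:R + (n ^ 2 + k ^ 2 + n * k)%:R.

Definition eigenvector lambda n k p :=
  Lop lambda p = - (realC (eigval lambda n k) * p).

Definition detGamma : bipoly := GammaZZbar ^+ 2 - GammaZZ * GammaZbarZbar.

(* Solves lambda = (6 alpha + 5) / 2. *)
Definition alpha lambda : R := (2 * lambda - 5) / 6.

(* mu has density C * detGamma ^ alpha on Omega; C is the normalizing constant
   since mu is a probability. *)
Definition deltoid_measure lambda (mu : probability (R * R)%type R) :=
  exists C : R, forall A, measurable A ->
    mu A = (\int[lebesgue_measure \x lebesgue_measure]_(z in A `&` Omega)
              (C * evalR detGamma z `^ alpha lambda)%:E)%E.

Section L2.
Variable mu : probability (R * R)%type R.

Local Notation L2 := (Lfun mu 2%:E).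
Definition norm2 f : \bar R := ('N[mu]_(2%:E)[EFin \o f])%E.

Definition normalized_eigenvector lambda n k p :=
  [/\ real_valued p, tdeg p = (n + k)%N,
      norm2 (evalR p) = 1%E & eigenvector lambda n k p].

Definition eigenbasis lambda (P Q : nat -> nat -> bipoly) :=
  forall n k : nat,
    [/\ normalized_eigenvector lambda n k (P n k), symmetricZ (P n k),
        n = k -> Q n k = 0 &
        n <> k -> normalized_eigenvector lambda n k (Q n k)
                  /\ antisymmetricZ (Q n k)].

(* The (real) eigenspace of - lambda_{n,k} is spanned by P_{n,k} and Q_{n,k}.
   This can fail when lambda_{n,k} = lambda_{n',k'} with {n,k} <> {n',k'}, e.g.
   lambda_{8,0} = lambda_{5,4} = 88 for lambda = 4. *)
Definition eigenspace_spanned lambda (P Q : nat -> nat -> bipoly) n k :=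
  forall p, real_valued p -> eigenvector lambda n k p ->
    exists a b : R, p = realC a * P n k + realC b * Q n k.

(* Graph of the closure in L2(mu) of Lop on real-valued polynomials, that is
   of its self-adjoint extension. *)
Definition L_graph lambda f g :=
  [/\ f \in L2, g \in L2 & exists p_ : nat -> bipoly,
    [/\ forall j, real_valued (p_ j),
        norm2 (evalR (p_ j) \- f) @[j --> \oo] --> 0%E &
        norm2 (evalR (Lop lambda (p_ j)) \- g) @[j --> \oo] --> 0%E]].

(* Operators on L2(mu) act on representatives, all identities being up to
   mu-almost everywhere equality. Compatibility with this equality follows
   from linearity and boundedness. *)
Implicit Type K : (R * R -> R) -> (R * R -> R).

Definition bounded_linear_L2 K :=
  [/\ forall f, f \in L2 -> K f \in L2,
      forall (a : R) f g, f \in L2 -> g \in L2 ->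
        K (a \*: f \+ g) = a \*: K f \+ K g %[ae mu] &
      exists M : R, forall f, f \in L2 -> (norm2 (K f) <= M%:E * norm2 f)%E].

Definition symmetric_L2 K := forall f g, f \in L2 -> g \in L2 ->
  \int[mu]_z (K f z * g z) = \int[mu]_z (f z * K g z).

Definition is_markov K :=
  K (cst 1) = cst 1 %[ae mu] /\
  forall f, f \in L2 -> {ae mu, forall z, 0 <= f z} ->
    {ae mu, forall z, 0 <= K f z}.

Definition commutes_with_L lambda K := forall f g,
  L_graph lambda f g -> L_graph lambda (K f) (K g).

End L2.
End Deltoid.

(* Main.v *)
(* Let z1, z2, z3 be the roots of T^3 - 3 Z T^2 + 3 Zbar T - 1, and for a, b in
   the integers let S(a, b) be the sum of zi^a zj^b over i <> j. For lambda = 1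
   the S(n, -k) are eigenvectors of the operator, with eigenvalues
   - (n^2 + k^2 + nk); the remaining term is - (lambda - 1) times the Euler
   field, which sends S(n, -k) to (n + k) S(n, -k) plus a combination with
   nonnegative coefficients of S's of strictly smaller eigenvalue. Solving
   triangularly, every polynomial is a sum of eigenvectors, and the eigenvector
   led by S(n, -k) is positive at the cusp 1. As Q(1) = 0 by antisymmetry, this
   gives P(1) <> 0 when P and Q span the eigenspace.

   The operator is symmetric for mu because Gamma(detGamma, -) vanishes on the
   boundary: one integrates by parts with a C^1 cutoff of detGamma^alpha and lets
   the cutoff disappear. So K P is orthogonal to all eigenvectors of another
   eigenvalue; being a limit of polynomials, it lies in the span of P and Q.

   The measure nu represents the functional f |-> (K f)(1). For a general f one
   averages K f over small rectangles around the cusp and takes the limit along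
   an ultrafilter. The result is positive, linear and normalised, and a
   Caratheodory construction from the induced finitely additive content represents
   it by a measure on the compact deltoid. At f = P the value is
   a P(1) + b Q(1) = a P(1), and at f = Q it is b P(1) + c Q(1) = b P(1). *)
Require Import Defs.
From HB Require Import structures.
From mathcomp Require Import all_boot all_order all_algebra.
From mathcomp Require Import complex polyXY zify ring lra.
From mathcomp Require Import all_classical all_reals all_analysis.
From mathcomp Require Import measurable_realfun.
Set Implicit Arguments.
Unset Strict Implicit.
Unset Printing Implicit Defensive.
Import Order.TTheory GRing.Theory Num.Theory.
Import numFieldNormedType.Exports.

Local Open Scope classical_set_scope.
Local Open Scope ring_scope.

(** * Linear recurrences of order three and roots of cubics *)

Section LinearRecurrence.
Variable A : comNzRingType.
Implicit Types (s t a b c : A) (u : int -> A).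

(** The roots zi are the coordinates of the maximal torus z1 z2 z3 = 1 of SU(3), on which 3 Z is the
    trace; the S(n, -k) are orbit sums for the root system A2, and the deltoid is the image of the
    compact torus. Positivity at the cusp is needed even at a multiple eigenvalue: the triangular
    system stays solvable there because only orbit sums of strictly smaller eigenvalue have to be
    inverted, and its denominators, differences of eigenvalues, are positive for the same reason.
    The bound lambda >= 5/2 means alpha >= 0. It keeps the density bounded, so that a constant on a
    box dominates all the cutoffs; it also gives lambda >= 1, which fixes the signs above. K f is
    only a class modulo null sets, so (K f)(1) makes sense only when K f has a continuous version,
    as for P and Q. An ultrafilter gives one limit for all bounded measurable f, in particular for
    the indicators of open sets from which the measure is built. The resulting content is only
    finitely additive; compactness of the closed deltoid prevents a loss of mass. *)

Definition rec3 s t u :=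
  forall n, u (n + 2) = s * u (n + 1) - t * u n + u (n - 1).

(** The coefficient of [u (n - 1)] is 1, so the recurrence also runs backwards and three consecutive
    zeros spread over all integers. Identities in an integer index are reduced to this: their two
    sides satisfy one recurrence and agree at -1, 0, 1. *)
Lemma rec3_eq0 s t u : rec3 s t u ->
  u (-1) = 0 -> u 0 = 0 -> u 1 = 0 -> forall n, u n = 0.
Proof.
move=> ur um1 u0 u1 n.
suff: [/\ u (n - 1) = 0, u n = 0 & u (n + 1) = 0] by case.
elim/int_rect: n => [|n [h1 h2 h3]|n [h1 h2 h3]].
- by rewrite !add0r.
- have -> : n.+1%:Z - 1 = n%:Z by lia.
  have -> : n.+1%:Z = n%:Z + 1 by lia.
  have -> : n%:Z + 1 + 1 = n%:Z + 2 by lia.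
  by split=> //; rewrite ur h1 h2 h3 !mulr0 subr0 addr0.
- have -> : - n.+1%:Z + 1 = - n%:Z by lia.
  have -> : - n.+1%:Z = - n%:Z - 1 by lia.
  split=> //; have := ur (- n%:Z - 1).
  have -> : - n%:Z - 1 + 2 = - n%:Z + 1 by lia.
  have -> : - n%:Z - 1 + 1 = - n%:Z by lia.
  by rewrite h1 h2 h3 !mulr0 subr0 add0r => /esym.
Qed.

Lemma rec3_inj s t u v : rec3 s t u -> rec3 s t v ->
  u (-1) = v (-1) -> u 0 = v 0 -> u 1 = v 1 -> u =1 v.
Proof.
move=> ur vr um1 u0 u1 n; apply/eqP; rewrite -subr_eq0; apply/eqP.
apply: (@rec3_eq0 s t (fun n => u n - v n)); last 3 first.
- by rewrite um1 subrr.
- by rewrite u0 subrr.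
- by rewrite u1 subrr.
- by move=> m; rewrite ur vr; ring.
Qed.

Definition rec3_step s t (x : A * A * A) :=
  (x.1.2, x.2, s * x.2 - t * x.1.2 + x.1.1).

(* The bi-infinite solution of rec3 with values a, b, c at -1, 0, 1. *)
Definition rec3_sol s t a b c (n : int) : A :=
  match n with
  | Posz m => (iter m (rec3_step s t) (a, b, c)).1.2
  | Negz m => (iter m.+1 (rec3_step t s) (c, b, a)).1.2
  end.

(** Read backwards, the recurrence keeps its form with [s] and [t] exchanged; this is why negative
    indices iterate [rec3_step t s] from the reversed triple. *)
Lemma rec3_solN s t a b c (n : int) :
  rec3_sol s t a b c (- n) = rec3_sol t s c b a n.
Proof.
case: n => [[|n]|n] //.
Qed.

Lemma rec3_sol_rec_pos s t a b c (m : nat) :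
  rec3_sol s t a b c (m%:Z + 2) =
  s * rec3_sol s t a b c (m%:Z + 1) - t * rec3_sol s t a b c m%:Z
  + rec3_sol s t a b c (m%:Z - 1).
Proof.
have -> : m%:Z + 2 = m.+2%:Z by lia.
have -> : m%:Z + 1 = m.+1%:Z by lia.
case: m => [|m]; first by rewrite add0r.
by have -> : m.+1%:Z - 1 = m%:Z by lia.
Qed.

Lemma rec3_solP s t a b c : rec3 s t (rec3_sol s t a b c).
Proof.
case=> m; first exact: rec3_sol_rec_pos.
rewrite NegzE; case: m => [|m].
  have -> : - 1%:Z + 2 = 1 by lia.
  have -> : - 1%:Z + 1 = 0 by lia.
  have -> : - 1%:Z - 1 = - 2%:Z by lia.
  by rewrite !rec3_solN /rec3_sol /rec3_step /=; ring.
have -> : - m.+2%:Z + 2 = - m%:Z by lia.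
have -> : - m.+2%:Z + 1 = - (m%:Z + 1) by lia.
have -> : - m.+2%:Z - 1 = - (m%:Z + 1 + 2) by lia.
have -> : m.+2%:Z = m%:Z + 1 + 1 by lia.
rewrite !rec3_solN.
have := rec3_sol_rec_pos t s c b a m.+1.
have -> : m.+1%:Z = m%:Z + 1 by lia.
have -> : m%:Z + 1 - 1 = m%:Z by lia.
by move=> ->; ring.
Qed.

Lemma rec3D s t u v : rec3 s t u -> rec3 s t v -> rec3 s t (fun n => u n + v n).
Proof. by move=> ur vr n; rewrite ur vr; ring. Qed.

End LinearRecurrence.

(** As x y z = 1, x is a root of T^3 - s T^2 + t T - 1, with s and t the first two elementary
    symmetric functions; this equation is multiplied by x^(n - 1). *)
Lemma rec3_exprz (F : fieldType) (x y z : F) : x * y * z = 1 ->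
  rec3 (x + y + z) (x * y + x * z + y * z) (fun n => x ^ n).
Proof.
move=> xyz n.
have x0 : x != 0 by apply: contra_eq_neq xyz => ->; rewrite !mul0r eq_sym oner_eq0.
have -> : x ^ (n + 2) = x ^ (n - 1) * (x * x * x).
  have -> : n + 2 = n - 1 + 1 + 1 + 1 by lia.
  by rewrite !(expfzDr _ _ x0) expr1z !mulrA.
have -> : x ^ (n + 1) = x ^ (n - 1) * (x * x).
  have -> : n + 1 = n - 1 + 1 + 1 by lia.
  by rewrite !(expfzDr _ _ x0) expr1z !mulrA.
have -> : x ^ n = x ^ (n - 1) * x.
  by rewrite -[in LHS](subrK 1 n) (expfzDr _ _ x0) expr1z.
set w := x ^ (n - 1); rewrite -[X in _ + X]mulr1 -xyz; ring.
Qed.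

(** * Evaluation of bivariate polynomials and roots of cubics *)

Section PolyEval.
Variable F : numClosedFieldType.

Lemma poly_natroots_eq0 (A : idomainType) (f : nat -> A) (p : {poly A}) :
  injective f -> (forall n, p.[f n] = 0) -> p = 0.
Proof.
move=> fI pf; apply/eqP; apply: contraT => p0.
have /(max_poly_roots p0) : all (root p) [seq f i | i <- iota 0 (size p)].
  by apply/allP => _ /mapP[i _ ->]; apply/eqP.
by rewrite map_inj_uniq// iota_uniq size_map size_iota ltnn => /(_ isT).
Qed.

Lemma poly2_eq0 (p : {poly {poly F}}) : (forall x y, p.[x, y] = 0) -> p = 0.
Proof.
move=> p0; apply: (@poly_natroots_eq0 _ (fun n => (n%:R : F)%:P)).
  by move=> m n /polyC_inj/eqP; rewrite eqr_nat => /eqP.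
move=> n; apply: (@poly_natroots_eq0 _ (fun n => n%:R)) => [m k /eqP|k].
  by rewrite eqr_nat => /eqP.
exact: p0.
Qed.

(** After a first root x, the second is a root of the quotient T^2 - (a - x) T + x^-1 and the third
    is a - x - y. Any values of Z and Zbar can thus be expressed through roots with product 1, where
    polynomial identities are easier to check. *)
Lemma cubic_roots (a b : F) : exists z : F * F * F,
  [/\ z.1.1 + z.1.2 + z.2 = a,
      z.1.1 * z.1.2 + z.1.1 * z.2 + z.1.2 * z.2 = b &
      z.1.1 * z.1.2 * z.2 = 1].
Proof.
have [x] := @solve_monicpoly F 3 (fun i => [:: 1; - b; a]`_i) isT.
rewrite !big_ord_recl big_ord0 /= /bump /= => xE.
have x3 : x ^+ 3 = 1 - b * x + a * x ^+ 2 by rewrite xE; ring.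
have x0 : x != 0.
  by apply: contra_eq_neq x3 => ->; rewrite !expr0n !mulr0 subr0 addr0 eq_sym oner_eq0.
have [y] := @solve_monicpoly F 2 (fun i => [:: - x^-1; a - x]`_i) isT.
rewrite !big_ord_recl big_ord0 /= /bump /= => yE.
have y2 : y ^+ 2 = - x^-1 + (a - x) * y by rewrite yE; ring.
have yz : y * (a - x - y) = x^-1.
  by transitivity ((a - x) * y - y ^+ 2); [ring | rewrite y2; ring].
exists (x, y, a - x - y) => /=; split; first ring.
- transitivity (x * (a - x) + y * (a - x - y)); first ring.
  rewrite yz; apply: (mulfI x0); rewrite mulrDr mulfV//.
  by transitivity (a * x ^+ 2 - x ^+ 3 + 1); [ring | rewrite x3; ring].
- by rewrite -mulrA yz mulfV.
Qed.

End PolyEval.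

(** * Polynomials in Z and Zbar *)

Section Bipoly.
Variable R : realType.
Local Notation B := {poly {poly R[i]}}.
Implicit Types (p q f g : B) (c : R[i]) (l : R).

Local Notation W := (vZbar : B).
Local Notation Z := (vZ : B).

Definition cstC c : B := c%:P%:P.

Fact cstC_is_zmod_morphism : zmod_morphism cstC.
Proof. by move=> x y; rewrite /cstC !rmorphB. Qed.
Fact cstC_is_monoid_morphism : monoid_morphism cstC.
Proof. by split=> [|x y]; rewrite /cstC !(rmorph1, rmorphM). Qed.
HB.instance Definition _ :=
  GRing.isZmodMorphism.Build _ _ cstC cstC_is_zmod_morphism.
HB.instance Definition _ :=
  GRing.isMonoidMorphism.Build _ _ cstC cstC_is_monoid_morphism.

Lemma realC_cstC (a : R) : realC a = cstC (a%:C)%C. Proof. by []. Qed.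

Fact realC_is_zmod_morphism : zmod_morphism (@realC R).
Proof. by move=> x y; rewrite !realC_cstC (rmorphB (real_complex R)) (rmorphB cstC). Qed.
Fact realC_is_monoid_morphism : monoid_morphism (@realC R).
Proof.
split=> [|x y]; first exact: (rmorph1 cstC).
by rewrite !realC_cstC (rmorphM (real_complex R)) (rmorphM cstC).
Qed.
HB.instance Definition _ :=
  GRing.isZmodMorphism.Build _ _ (@realC R) realC_is_zmod_morphism.
HB.instance Definition _ :=
  GRing.isMonoidMorphism.Build _ _ (@realC R) realC_is_monoid_morphism.

Lemma realC_nat (n : nat) : realC n%:R = n%:R :> B.
Proof. exact: (rmorph_nat (@realC R)). Qed.
Lemma realC1 : realC 1 = 1 :> B. Proof. exact: (rmorph1 (@realC R)). Qed.
Lemma realC0 : realC 0 = 0 :> B. Proof. exact: (rmorph0 (@realC R)). Qed.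
Lemma realCM (a b : R) : realC (a * b) = realC a * realC b.
Proof. exact: (rmorphM (@realC R)). Qed.
Lemma realCD (a b : R) : realC (a + b) = realC a + realC b.
Proof. exact: (rmorphD (@realC R)). Qed.
Lemma realCB (a b : R) : realC (a - b) = realC a - realC b.
Proof. exact: (rmorphB (@realC R)). Qed.
Lemma realCN (a : R) : realC (- a) = - realC a.
Proof. exact: (rmorphN (@realC R)). Qed.

Lemma realC_half : realC 2^-1 * 2 = 1 :> B.
Proof.
have -> : 2 = realC 2 :> B by exact/esym/realC_nat.
by rewrite -realCM mulVf ?realC1// pnatr_eq0.
Qed.

Fact dZ_is_zmod_morphism : zmod_morphism (@dZ R).
Proof. by move=> x y; rewrite /dZ derivB. Qed.
Fact dZbar_is_zmod_morphism : zmod_morphism (@dZbar R).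
Proof. by move=> x y; rewrite /dZbar raddfB. Qed.
HB.instance Definition _ :=
  GRing.isZmodMorphism.Build _ _ (@dZ R) dZ_is_zmod_morphism.
HB.instance Definition _ :=
  GRing.isZmodMorphism.Build _ _ (@dZbar R) dZbar_is_zmod_morphism.

Lemma cstCM (a b : R[i]) : cstC (a * b) = cstC a * cstC b.
Proof. exact: (rmorphM cstC). Qed.
Lemma cstCN (a : R[i]) : cstC (- a) = - cstC a.
Proof. exact: (rmorphN cstC). Qed.
Lemma cstC1 : cstC 1 = 1 :> B. Proof. exact: (rmorph1 cstC). Qed.
Lemma cstC_nat (n : nat) : cstC n%:R = n%:R.
Proof. exact: (rmorph_nat cstC). Qed.

Lemma dZB p q : dZ (p - q) = dZ p - dZ q.
Proof. exact: dZ_is_zmod_morphism. Qed.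
Lemma dZbarB p q : dZbar (p - q) = dZbar p - dZbar q.
Proof. exact: dZbar_is_zmod_morphism. Qed.
Lemma dZD p q : dZ (p + q) = dZ p + dZ q.
Proof. exact: derivD. Qed.
Lemma dZbarD p q : dZbar (p + q) = dZbar p + dZbar q.
Proof. exact: (raddfD (@dZbar R)). Qed.

Lemma dZbarE p : dZbar p = swapXY (dZ (swapXY p)).
Proof.
apply/polyP => i; apply/polyP => j.
by rewrite coef_map /= coef_deriv coef_swapXY coef_deriv coefMn coef_swapXY.
Qed.

Lemma dZ_swap p : dZ (swapXY p) = swapXY (dZbar p).
Proof. by rewrite dZbarE swapXYK. Qed.

Lemma dZbar_swap p : dZbar (swapXY p) = swapXY (dZ p).
Proof. by rewrite dZbarE swapXYK. Qed.

Lemma dZM p q : dZ (p * q) = dZ p * q + p * dZ q.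
Proof. exact: derivM. Qed.

Lemma dZbarM p q : dZbar (p * q) = dZbar p * q + p * dZbar q.
Proof. by rewrite !dZbarE rmorphM /= dZM rmorphD /= !rmorphM /= !swapXYK. Qed.

Lemma swap_cstC c : swapXY (cstC c) = cstC c.
Proof. by rewrite /cstC swapXY_polyC map_polyC. Qed.

Lemma dZ_cstC c : dZ (cstC c) = 0.
Proof. exact: derivC. Qed.

Lemma dZbar_cstC c : dZbar (cstC c) = 0.
Proof. by rewrite dZbarE swap_cstC dZ_cstC raddf0. Qed.

Lemma dZZ : dZ Z = 1. Proof. exact: derivX. Qed.
Lemma dZW : dZ W = 0. Proof. exact: derivC. Qed.
Lemma swapZ : swapXY Z = W. Proof. exact: swapXY_X. Qed.
Lemma swapW : swapXY W = Z. Proof. exact: swapXY_Y. Qed.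
Lemma dWZ : dZbar Z = 0. Proof. by rewrite dZbarE swapZ dZW raddf0. Qed.
Lemma dWW : dZbar W = 1. Proof. by rewrite dZbarE swapW dZZ rmorph1. Qed.

Lemma dZ1 : dZ (1 : B) = 0. Proof. exact: derivC. Qed.
Lemma dW1 : dZbar (1 : B) = 0.
Proof. by rewrite dZbarE rmorph1 dZ1 raddf0. Qed.

Lemma dZ_dZbarC p : dZbar (dZ p) = dZ (dZbar p).
Proof.
apply/polyP => i; apply/polyP => j.
by rewrite coef_map /= !coef_deriv !coefMn coef_map /= coef_deriv mulrnAC.
Qed.

Lemma dZ_int (n : int) : dZ (n%:~R : B) = 0.
Proof. by rewrite -(rmorph_int cstC) dZ_cstC. Qed.
Lemma dW_int (n : int) : dZbar (n%:~R : B) = 0.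
Proof. by rewrite -(rmorph_int cstC) dZbar_cstC. Qed.
Lemma dZ_nat (n : nat) : dZ (n%:R : B) = 0.
Proof. exact: (dZ_int n). Qed.
Lemma dW_nat (n : nat) : dZbar (n%:R : B) = 0.
Proof. exact: (dW_int n). Qed.

Lemma dZ0 : dZ (0 : B) = 0. Proof. exact: raddf0. Qed.
Lemma dW0 : dZbar (0 : B) = 0. Proof. exact: raddf0. Qed.

Definition dE := (dZ0, dW0, dZM, dZbarM, dZ_cstC, dZbar_cstC, dZZ, dZW, dWZ, dWW, dZ1,
  dW1, dZ_int, dW_int, dZ_nat, dW_nat).

(** Twice the square field operator Gamma(f, g): the factor 2 is the one of the product rule [LopM]
    and it clears the denominator of [GammaZZbar]. *)
Definition Gamma2 f g : B := 2 * GammaZZ * dZ f * dZ g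
  + (1 - Z * W) * (dZ f * dZbar g + dZbar f * dZ g)
  + 2 * GammaZbarZbar * dZbar f * dZbar g.

Definition Euler p : B := Z * dZ p + W * dZbar p.

Lemma twoGammaZZbar : 2 * @GammaZZbar R = 1 - Z * W.
Proof.
by rewrite /GammaZZbar mulrA (mulrC 2) realC_half mul1r.
Qed.

Fact Lop_is_zmod_morphism l : zmod_morphism (Lop l : B -> B).
Proof. by move=> p q; rewrite /Lop !raddfB /=; ring. Qed.
HB.instance Definition _ l :=
  GRing.isZmodMorphism.Build B B (Lop l) (Lop_is_zmod_morphism l).

Lemma LopB l f g : Lop l (f - g) = Lop l f - Lop l g.
Proof. exact: raddfB. Qed.
Lemma LopD l f g : Lop l (f + g) = Lop l f + Lop l g.
Proof. exact: raddfD. Qed.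

Lemma LopM l f g : Lop l (f * g) = f * Lop l g + g * Lop l f + Gamma2 f g.
Proof.
rewrite /Lop /Gamma2 twoGammaZZbar !dE !raddfD /= !dE; ring.
Qed.

Lemma Lop_cstM l c p : Lop l (cstC c * p) = cstC c * Lop l p.
Proof.
have L0 : Lop l (cstC c) = 0 by rewrite /Lop dZ_cstC dZbar_cstC !raddf0 !mulr0 !addr0 !subr0.
rewrite LopM L0 mulr0 addr0 /Gamma2 dZ_cstC dZbar_cstC; ring.
Qed.

Lemma Lop_Euler l p : Lop l p = Lop 1 p - realC (l - 1) * Euler p.
Proof. rewrite /Lop /Euler rmorphB rmorph1; ring. Qed.

Lemma EulerM f g : Euler (f * g) = f * Euler g + g * Euler f.
Proof. rewrite /Euler !dE; ring. Qed.

Fact Euler_is_zmod_morphism : zmod_morphism Euler.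
Proof. by move=> p q; rewrite /Euler !raddfB /=; ring. Qed.
HB.instance Definition _ :=
  GRing.isZmodMorphism.Build B B Euler Euler_is_zmod_morphism.

Lemma EulerB f g : Euler (f - g) = Euler f - Euler g.
Proof. exact: raddfB. Qed.
Lemma EulerD f g : Euler (f + g) = Euler f + Euler g.
Proof. exact: raddfD. Qed.

Lemma Gamma2C f g : Gamma2 f g = Gamma2 g f.
Proof. rewrite /Gamma2; ring. Qed.

Lemma Gamma2Mr f g p : Gamma2 f (g * p) = g * Gamma2 f p + p * Gamma2 f g.
Proof. rewrite /Gamma2 !dE; ring. Qed.

Fact Gamma2_is_zmod_morphism f : zmod_morphism (Gamma2 f).
Proof. by move=> p q; rewrite /Gamma2 !raddfB /=; ring. Qed.
HB.instance Definition _ f :=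
  GRing.isZmodMorphism.Build B B (Gamma2 f) (Gamma2_is_zmod_morphism f).

Lemma Gamma2B f g p : Gamma2 f (g - p) = Gamma2 f g - Gamma2 f p.
Proof. exact: raddfB. Qed.
Lemma Gamma2D f g p : Gamma2 f (g + p) = Gamma2 f g + Gamma2 f p.
Proof. exact: raddfD. Qed.

Lemma swapM p q : swapXY (p * q) = swapXY p * swapXY q.
Proof. exact: rmorphM. Qed.
Lemma swapD p q : swapXY (p + q) = swapXY p + swapXY q.
Proof. exact: raddfD. Qed.
Lemma swapB p q : swapXY (p - q) = swapXY p - swapXY q.
Proof. exact: raddfB. Qed.
Lemma swap1 : swapXY (1 : B) = 1.
Proof. exact: rmorph1. Qed.

Lemma swap_GammaZZ : swapXY (@GammaZZ R) = GammaZbarZbar.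
Proof. by rewrite /GammaZZ swapB expr2 swapM swapZ swapW -expr2. Qed.

Lemma swap_GammaZbarZbar : swapXY (@GammaZbarZbar R) = GammaZZ.
Proof. by rewrite -swap_GammaZZ swapXYK. Qed.

Lemma swap_realC (a : R) : swapXY (realC a) = realC a.
Proof. exact: swap_cstC. Qed.

Lemma swap_twoGammaZZbar : swapXY (2 * @GammaZZbar R) = 2 * GammaZZbar.
Proof. by rewrite twoGammaZZbar swapB swapM swap1 swapZ swapW (mulrC W). Qed.

Lemma swap_Lop l p : swapXY (Lop l p) = Lop l (swapXY p).
Proof.
rewrite /Lop !dZ_swap !dZbar_swap !dZ_swap -dZ_dZbarC.
rewrite !swapB !swapD ![swapXY (_ * dZ _)]swapM ![swapXY (_ * dZbar _)]swapM.
rewrite swap_GammaZZ swap_GammaZbarZbar swap_twoGammaZZbar.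
rewrite !swapM swap_realC swapZ swapW; ring.
Qed.

End Bipoly.

(** * Power sums of the roots *)

(** Closes by [ring] a goal that is a multiple of a known equation. *)
Lemma lincomb (A : pzRingType) (x y u v c : A) :
  u = v -> x - y = c * (u - v) -> x = y.
Proof. by move=> -> /eqP; rewrite subrr mulr0 subr_eq0 => /eqP. Qed.

Section PowerSums.
Variable R : realType.
Local Notation B := {poly {poly R[i]}}.
Implicit Types (p q f g : B) (n m a b c : int).

Local Notation W := (vZbar : B).
Local Notation Z := (vZ : B).

(* pw n is the power sum z1^n + z2^n + z3^n, where z1, z2, z3 are the roots of
   T^3 - 3 Z T^2 + 3 Zbar T - 1. *)
Definition pw n : B := rec3_sol (3 * Z) (3 * W) (3 * W) 3 (3 * Z) n.

(* Half the sum over i < j of (zi + zj) / (zi - zj) * (zi^n - zj^n). *)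
Definition Phi n : B := rec3_sol (3 * Z) (3 * W) (- (3 * W)) 0 (3 * Z) n.

Lemma pw_rec n : pw (n + 2) = 3 * Z * pw (n + 1) - 3 * W * pw n + pw (n - 1).
Proof. exact: rec3_solP. Qed.

Lemma Phi_rec n : Phi (n + 2) = 3 * Z * Phi (n + 1) - 3 * W * Phi n + Phi (n - 1).
Proof. exact: rec3_solP. Qed.

Lemma pw0 : pw 0 = 3. Proof. by []. Qed.
Lemma pw1 : pw 1 = 3 * Z. Proof. by []. Qed.
Lemma pwN1 : pw (-1) = 3 * W. Proof. by []. Qed.
Lemma pw2 : pw 2 = 9 * Z ^+ 2 - 6 * W.
Proof. have := pw_rec 0; rewrite !add0r => ->; rewrite pw0 pw1 pwN1; ring. Qed.
Lemma pwN2 : pw (-2) = 9 * W ^+ 2 - 6 * Z.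
Proof.
have := pw_rec (-1); rewrite (_ : -1 + 2 = 1)// (_ : -1 + 1 = 0)// (_ : -1 - 1 = -2)//.
rewrite pw0 pw1 pwN1 => h; apply/eqP; rewrite -subr_eq0.
move/eqP: h; rewrite -subr_eq0 => /eqP h.
by rewrite -[0]oppr0 -h; apply/eqP; ring.
Qed.
Lemma Phi0 : Phi 0 = 0. Proof. by []. Qed.
Lemma Phi1 : Phi 1 = 3 * Z. Proof. by []. Qed.
Lemma PhiN1 : Phi (-1) = - (3 * W). Proof. by []. Qed.
Lemma Phi2 : Phi 2 = 9 * Z ^+ 2 - 3 * W.
Proof. have := Phi_rec 0; rewrite !add0r => ->; rewrite Phi0 Phi1 PhiN1; ring. Qed.

Lemma Gamma2_rec f n : Gamma2 f (pw (n + 2)) =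
  3 * (Z * Gamma2 f (pw (n + 1)) + pw (n + 1) * Gamma2 f Z)
  - 3 * (W * Gamma2 f (pw n) + pw n * Gamma2 f W) + Gamma2 f (pw (n - 1)).
Proof. rewrite pw_rec Gamma2D Gamma2B !Gamma2Mr /Gamma2 !dE; ring. Qed.

Lemma Gamma2ZZ : Gamma2 Z Z = 2 * (W - Z ^+ 2).
Proof. rewrite /Gamma2 !dE /GammaZZ; ring. Qed.
Lemma Gamma2ZW : Gamma2 Z W = 1 - Z * W.
Proof. rewrite /Gamma2 !dE /GammaZZ; ring. Qed.
Lemma Gamma2WW : Gamma2 W W = 2 * (Z - W ^+ 2).
Proof. rewrite /Gamma2 !dE /GammaZbarZbar; ring. Qed.

Lemma Lop1Z : Lop 1 Z = - Z.
Proof. rewrite /Lop (rmorph1 (@realC R)) !dE; ring. Qed.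
Lemma Lop1W : Lop 1 W = - W.
Proof. rewrite /Lop (rmorph1 (@realC R)) !dE; ring. Qed.
Lemma Lop_nat l (k : nat) : Lop l (k%:R : B) = 0.
Proof. rewrite /Lop !dE; ring. Qed.

Lemma Lop1_rec n : Lop 1 (pw (n + 2)) =
  3 * (Z * Lop 1 (pw (n + 1)) - pw (n + 1) * Z + Gamma2 Z (pw (n + 1)))
  - 3 * (W * Lop 1 (pw n) - pw n * W + Gamma2 W (pw n)) + Lop 1 (pw (n - 1)).
Proof.
rewrite pw_rec LopD LopB !LopM Lop1Z Lop1W Lop_nat /Gamma2 !dE; ring.
Qed.

Lemma Euler_rec n : Euler (pw (n + 2)) =
  3 * (Z * Euler (pw (n + 1)) + pw (n + 1) * Z)
  - 3 * (W * Euler (pw n) + pw n * W) + Euler (pw (n - 1)).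
Proof. rewrite pw_rec EulerD EulerB !EulerM /Euler !dE; ring. Qed.

Lemma addn21 n : n + 2 + 1 = n + 1 + 2. Proof. by rewrite addrAC. Qed.
Lemma addn11 n : n + 1 + 1 = n + 2. Proof. by rewrite -addrA. Qed.

(** The difference of the two sides solves the recurrence of [pw] in [n] and vanishes at -1, 0, 1.
    The formulas below for [Gamma2], [Lop 1] and [Euler] on power sums are obtained in the same
    way. *)
Lemma Gamma2_Z_pw n : Gamma2 Z (pw n) = n%:~R * (Z * pw n - pw (n + 1)).
Proof.
apply/eqP; rewrite -subr_eq0; apply/eqP; move: n.
apply: (@rec3_eq0 _ (3 * Z) (3 * W)).
- move=> n; rewrite Gamma2_rec Gamma2ZZ Gamma2ZW addn21 addn11 (pw_rec (n + 1)).
  by rewrite addn11 addrK subrK (pw_rec n); ring.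
- by rewrite pwN1 addNr pw0 Gamma2Mr Gamma2ZW /Gamma2 !dE; ring.
- by rewrite pw0 /Gamma2 !dE; ring.
- by rewrite pw1 (_ : 1 + 1 = 2)// pw2 Gamma2Mr Gamma2ZZ /Gamma2 !dE; ring.
Qed.

Lemma Gamma2_W_pw n : Gamma2 W (pw n) = - n%:~R * (W * pw n - pw (n - 1)).
Proof.
apply/eqP; rewrite -subr_eq0; apply/eqP; move: n.
apply: (@rec3_eq0 _ (3 * Z) (3 * W)).
- move=> n; rewrite Gamma2_rec Gamma2WW (Gamma2C W Z) Gamma2ZW addrK.
  have -> : n + 2 - 1 = n + 1 by rewrite -addrA.
  have := pw_rec (n - 1); rewrite subrK (_ : n - 1 + 2 = n + 1); last by rewrite -addrA.
  by rewrite (pw_rec n) => ->; ring.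
- by rewrite pwN1 (_ : -1 - 1 = -2)// pwN2 Gamma2Mr Gamma2WW /Gamma2 !dE; ring.
- by rewrite pw0 /Gamma2 !dE; ring.
- by rewrite pw1 subrr pw0 Gamma2Mr (Gamma2C W Z) Gamma2ZW /Gamma2 !dE; ring.
Qed.

(** In terms of the roots, the left side is the sum over i, j of zi^(n-1) zj^m (zi zj (zi + zj - 3
    Z) + 1). The terms with i <> j vanish because z1 z2 z3 = 1, and those with i = j give the right
    side. This is what the recurrence in [m] leaves over in [Gamma2_pw]. *)
Lemma pw_pw n m :
  pw n * (pw (m + 2) - 3 * Z * pw (m + 1)) + pw (n + 1) * pw (m + 1)
  + pw (n - 1) * pw m
  = 3 * pw (n + (m + 2)) - 6 * Z * pw (n + (m + 1)) + 3 * W * pw (n + m).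
Proof.
apply/eqP; rewrite -subr_eq0; apply/eqP; move: m.
apply: (@rec3_eq0 _ (3 * Z) (3 * W)).
- have F k : pw (n + (k + 2)) =
      3 * Z * pw (n + (k + 1)) - 3 * W * pw (n + k) + pw (n + (k - 1)).
    by have := pw_rec (n + k); rewrite -!(addrA n).
  have s1 k : k - 1 + 2 = k + 1 :> int by rewrite -addrA.
  have s2 k : k + 2 - 1 = k + 1 :> int by rewrite -addrA.
  move=> m; rewrite subrK s1 (pw_rec (m + 2)) (F (m + 2)) s2 addn21 addn11.
  by rewrite (pw_rec (m + 1)) (F (m + 1)) addn11 addrK (pw_rec m) (F m); ring.
- rewrite (_ : -1 + 2 = 1)// addNr pw0 pw1 pwN1 addr0; ring.
- rewrite !add0r pw2 pw1 pw0 addr0 pw_rec; ring.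
- rewrite (_ : 1 + 1 = 2)// (pw_rec 1) (_ : 1 + 1 = 2)// subrr pw2 pw1 pw0.
  rewrite (_ : n + (1 + 2) = n + 1 + 2); last by rewrite addrA.
  by rewrite (pw_rec (n + 1)) addn11 addrK (pw_rec n); ring.
Qed.

(** Formally, [Gamma2] of log zi and log zj is 1, minus 3 when i = j. These are constants: for
    lambda = 1 the operator is a flat Laplacian on the torus z1 z2 z3 = 1, with monomials as
    eigenfunctions. *)
Lemma Gamma2_pw n m :
  Gamma2 (pw n) (pw m) = (n * m)%:~R * (pw n * pw m - 3 * pw (n + m)).
Proof.
apply/eqP; rewrite -subr_eq0; apply/eqP; move: m.
apply: (@rec3_eq0 _ (3 * Z) (3 * W)).
- move=> m; rewrite Gamma2_rec (Gamma2C (pw n) Z) (Gamma2C (pw n) W) Gamma2_Z_pw Gamma2_W_pw.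
  have e2 : pw (n + (m + 2)) = 3 * Z * pw (n + (m + 1)) - 3 * W * pw (n + m) + pw (n + (m - 1)).
    by have := pw_rec (n + m); rewrite -!(addrA n).
  apply: (@lincomb _ _ _ _ _ (- (3 * n%:~R)) (pw_pw n m)).
  by rewrite e2 (pw_rec m); ring.
- by rewrite pwN1 Gamma2Mr (Gamma2C _ W) Gamma2_W_pw /Gamma2 !dE; ring.
- by rewrite pw0 addr0 /Gamma2 !dE; ring.
- by rewrite pw1 Gamma2Mr (Gamma2C _ Z) Gamma2_Z_pw /Gamma2 !dE; ring.
Qed.

Lemma Lop1_pw n : Lop 1 (pw n) = - (n ^+ 2)%:~R * pw n.
Proof.
apply/eqP; rewrite -subr_eq0; apply/eqP; move: n.
apply: (@rec3_eq0 _ (3 * Z) (3 * W)).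
- move=> n; rewrite Lop1_rec Gamma2_Z_pw Gamma2_W_pw addn11 (pw_rec n); ring.
- by rewrite pwN1 LopM Lop_nat Lop1W /Gamma2 !dE; ring.
- by rewrite pw0 Lop_nat; ring.
- by rewrite pw1 LopM Lop_nat Lop1Z /Gamma2 !dE; ring.
Qed.

Lemma Phi_pw n :
  3 * Phi (n + 2) = 3 * Z * pw (n + 1) - 3 * W * pw n
                    + 6 * Z * Phi (n + 1) - 3 * W * Phi n.
Proof.
apply/eqP; rewrite -subr_eq0; apply/eqP; move: n.
apply: (@rec3_eq0 _ (3 * Z) (3 * W)).
- move=> n; rewrite addn21 addn11 subrK !(Phi_rec (n + 2)).
  rewrite (_ : n + 2 - 1 = n + 1); last by rewrite -addrA.
  rewrite addn21 (Phi_rec (n + 1)) (pw_rec (n + 1)) addn11 addrK (_ : n - 1 + 2 = n + 1); last by rewrite -addrA.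
  by rewrite (Phi_rec n) (pw_rec n); ring.
- by rewrite (_ : -1 + 2 = 1)// addNr Phi0 Phi1 PhiN1 pw0 pwN1; ring.
- by rewrite !add0r Phi2 Phi1 Phi0 pw1 pw0; ring.
- by rewrite (_ : 1 + 1 = 2)// Phi_rec (_ : 1 + 1 = 2)// subrr Phi2 Phi1 Phi0 pw2 pw1; ring.
Qed.

Lemma Euler_pw n : Euler (pw n) = n%:~R * Phi n.
Proof.
apply/eqP; rewrite -subr_eq0; apply/eqP; move: n.
apply: (@rec3_eq0 _ (3 * Z) (3 * W)).
- move=> n; rewrite Euler_rec.
  (* With n + 2 = (n - 1) + 3, the recurrence of [Phi] handles the first part and [Phi_pw] the
     second. *)
  rewrite (_ : (n + 2)%:~R * Phi (n + 2) = (n - 1)%:~R * Phi (n + 2) + 3 * Phi (n + 2)); last by ring.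
  by rewrite Phi_pw (Phi_rec n); ring.
- by rewrite pwN1 PhiN1 EulerM /Euler !dE; ring.
- by rewrite pw0 Phi0 /Euler !dE; ring.
- by rewrite pw1 Phi1 EulerM /Euler !dE; ring.
Qed.

(** This is S(a, b): subtracting [pw (a + b)] removes the terms with i = j. *)
Definition pwS a b : B := pw a * pw b - pw (a + b).

Lemma Lop1_pwS a b :
  Lop 1 (pwS a b) = - (a ^+ 2 + b ^+ 2 - a * b)%:~R * pwS a b.
Proof. by rewrite /pwS LopB LopM !Lop1_pw Gamma2_pw; ring. Qed.

Lemma Euler_pwS a b : Euler (pwS a b) =
  a%:~R * Phi a * pw b + b%:~R * Phi b * pw a - (a + b)%:~R * Phi (a + b).
Proof. by rewrite /pwS EulerB EulerM !Euler_pw; ring. Qed.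

End PowerSums.

Arguments pw {R} n.
Arguments Phi {R} n.
Arguments pwS {R} a b.

(** * Strings of monomials joining two powers *)

Section Strings.

(* Sum of the interior points of the string from y^m to x^m. *)
Definition string_sum (A : pzRingType) (m : nat) (x y : A) : A :=
  \sum_(1 <= l < m) x ^+ l * y ^+ (m - l).

Lemma string_sumC (A : comPzRingType) m (x y : A) :
  string_sum m x y = string_sum m y x.
Proof.
rewrite /string_sum big_nat_rev /= !big_nat; apply: eq_bigr => l /andP[l0 lm].
have -> : (1 + m - l.+1 = m - l)%N by lia.
have -> : (m - (m - l) = l)%N by lia.
by rewrite mulrC.
Qed.

(** The sum telescopes after multiplication by x - y. Dividing by x - y, the quotient (x + y) (x^m -
    y^m) / (x - y) is the sum of the two end points and twice the interior points of a string; all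
    coefficients are positive. *)
Lemma string_sumP (A : comPzRingType) m (x y : A) : (0 < m)%N ->
  (x + y) * (x ^+ m - y ^+ m) = (x - y) * (x ^+ m + y ^+ m + string_sum m x y *+ 2).
Proof.
move=> m0.
have tel : (x - y) * string_sum m x y = x ^+ m * y - x * y ^+ m.
  rewrite /string_sum mulr_sumr.
  pose f l := x ^+ l * y ^+ (m.+1 - l).
  rewrite (_ : \sum_(_ <= _ < _) _ = \sum_(1 <= l < m) (f l.+1 - f l)).
    by rewrite telescope_sumr// /f subSnn subn1 expr1 [_.-1]/=.
  rewrite !big_nat; apply: eq_bigr => l /andP[l0 lm].
  rewrite /f subSS; have -> : (m.+1 - l = (m - l).+1)%N by lia.
  by rewrite !exprS; ring.
transitivity ((x - y) * (x ^+ m + y ^+ m) + ((x - y) * string_sum m x y) *+ 2); last ring.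
by rewrite tel; ring.
Qed.

End Strings.

(** * Identities checked at the roots of the cubic *)

Section Pointwise.
Variable R : realType.
Local Notation C := R[i].
Local Notation B := {poly {poly C}}.
Implicit Types (p q f g : B) (n m a b c : int).

Local Notation W := (vZbar : B).
Local Notation Z := (vZ : B).

Definition ev (x y : C) : B -> C := horner_eval y \o horner_eval x%:P.
HB.instance Definition _ x y := GRing.RMorphism.on (ev x y).

Lemma evE x y p : p.[x, y] = ev x y p. Proof. by []. Qed.

Lemma evZ x y : ev x y Z = x.
Proof. by rewrite /ev /= /horner_eval /vZ !hornerE. Qed.
Lemma evW x y : ev x y W = y.
Proof. by rewrite /ev /= /horner_eval /vZbar !hornerE. Qed.
Lemma ev_cstC x y (c : C) : ev x y (cstC c) = c.
Proof. by rewrite /ev /= /horner_eval /cstC !hornerE. Qed.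

Lemma evM x y p q : ev x y (p * q) = ev x y p * ev x y q.
Proof. exact: rmorphM. Qed.
Lemma evD x y p q : ev x y (p + q) = ev x y p + ev x y q.
Proof. exact: rmorphD. Qed.
Lemma evB x y p q : ev x y (p - q) = ev x y p - ev x y q.
Proof. exact: rmorphB. Qed.
Lemma evN x y p : ev x y (- p) = - ev x y p.
Proof. exact: rmorphN. Qed.
Lemma evX x y p k : ev x y (p ^+ k) = ev x y p ^+ k.
Proof. exact: rmorphXn. Qed.
Lemma ev1 x y : ev x y 1 = 1. Proof. exact: rmorph1. Qed.
Lemma ev0 x y : ev x y 0 = 0. Proof. exact: raddf0. Qed.
Lemma ev_int x y n : ev x y n%:~R = n%:~R. Proof. exact: rmorph_int. Qed.
Lemma ev_nat x y (n : nat) : ev x y n%:R = n%:R. Proof. exact: rmorph_nat. Qed.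

Lemma ev_realC x y (a : R) : ev x y (realC a) = (a%:C)%C.
Proof. exact: ev_cstC. Qed.

Lemma ev_inj p q : (forall x y, ev x y p = ev x y q) -> p = q.
Proof.
move=> pq; apply/eqP; rewrite -subr_eq0; apply/eqP/poly2_eq0 => x y.
by rewrite evE evB pq subrr.
Qed.

Lemma ev_GammaZZbar x y : ev x y GammaZZbar = 2^-1 * (1 - x * y).
Proof.
by rewrite /GammaZZbar evM ev_realC evB ev1 evM evZ evW rmorphV ?unitfE ?pnatr_eq0// rmorph_nat.
Qed.

Lemma ev_detGamma x y :
  ev x y detGamma = (2^-1 * (1 - x * y)) ^+ 2 - (y - x ^+ 2) * (x - y ^+ 2).
Proof.
by rewrite /detGamma evB evX ev_GammaZZbar evM /GammaZZ /GammaZbarZbar !evB !evX evZ evW.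
Qed.

Lemma detGamma_neq0 : @detGamma R != 0.
Proof.
apply/eqP => /(congr1 (ev 0 0)).
rewrite ev_detGamma ev0 !(mul0r, mulr0, expr0n, subr0, mulr1) /= => /eqP.
by rewrite expf_eq0 /= invr_eq0 pnatr_eq0.
Qed.

(** Both sides are multiplied by the nonzero polynomial [detGamma]. This permits quotients by
    differences of roots, which are nonzero off its zero set. *)
Lemma ev_inj_generic p q :
  (forall x y, ev x y detGamma != 0 -> ev x y p = ev x y q) -> p = q.
Proof.
move=> pq; apply: (mulIf detGamma_neq0); apply: ev_inj => x y.
rewrite !evM; have [->|/pq->//] := eqVneq (ev x y detGamma) 0.
by rewrite !mulr0.
Qed.

(** The sum of zi^a zj^b zk^c over the permutations of the roots: as z1 z2 z3 = 1, only differences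
    of exponents matter. *)
Definition pwT a b c : B := pwS (a - c) (b - c).

(** Orbit sums at the interior points of the string of exponents from (b, b + m, c) to (b + m, b,
    c). *)
Definition string (m : nat) b c : B :=
  \sum_(1 <= l < m) pwT (b + l%:Z) (b + (m - l)%:Z) c.

Definition rdiff (u v : C) := (u + v) / (u - v).

Section Roots.
Variables (x y z1 z2 z3 : C).
Hypotheses (h1 : z1 + z2 + z3 = 3 * x)
  (h2 : z1 * z2 + z1 * z3 + z2 * z3 = 3 * y) (h3 : z1 * z2 * z3 = 1).

Lemma ev_pw n : ev x y (pw n) = z1 ^ n + z2 ^ n + z3 ^ n.
Proof.
move: n; apply: (@rec3_inj _ (z1 + z2 + z3) (z1 * z2 + z1 * z3 + z2 * z3)).
- move=> n /=; rewrite pw_rec evD evB !evM evZ evW !ev_nat h1 h2; ring.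
- have e1 : rec3 (z1 + z2 + z3) (z1 * z2 + z1 * z3 + z2 * z3) (exprz z1).
    exact: rec3_exprz.
  have e2 : rec3 (z1 + z2 + z3) (z1 * z2 + z1 * z3 + z2 * z3) (exprz z2).
    have h : z2 * z1 * z3 = 1 by rewrite (mulrC z2).
    by have := rec3_exprz h; congr rec3; ring.
  have e3 : rec3 (z1 + z2 + z3) (z1 * z2 + z1 * z3 + z2 * z3) (exprz z3).
    have h : z3 * z1 * z2 = 1 by rewrite -mulrA mulrC.
    by have := rec3_exprz h; congr rec3; ring.
  exact: rec3D (rec3D e1 e2) e3.
- rewrite pwN1 evM evW ev_nat -h2 !exprN1.
  have [n1 n2 n3] : [/\ z1 != 0, z2 != 0 & z3 != 0].
    by split; apply: contra_eq_neq h3 => ->; rewrite ?(mulr0, mul0r) eq_sym oner_eq0.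
  apply: (mulfI n1); apply: (mulfI n2); apply: (mulfI n3).
  transitivity ((z1 * z2 * z3) * (z1 * z2 + z1 * z3 + z2 * z3)); first ring.
  by rewrite h3 mul1r; field; rewrite ?n1 ?n2 ?n3.
- by rewrite pw0 ev_nat !expr0z; ring.
- by rewrite pw1 evM evZ ev_nat -h1 !expr1z.
Qed.

Lemma roots_neq0 : [/\ z1 != 0, z2 != 0 & z3 != 0].
Proof.
by split; apply: contra_eq_neq h3 => ->; rewrite ?(mulr0, mul0r) eq_sym oner_eq0.
Qed.

(** The discriminant of T^3 - 3 Z T^2 + 3 Zbar T - 1 is -108 [detGamma]. *)
Lemma roots_distinct : ev x y detGamma != 0 ->
  [/\ z1 - z2 != 0, z1 - z3 != 0 & z2 - z3 != 0].
Proof.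
have e : ((z1 - z2) * (z1 - z3) * (z2 - z3)) ^+ 2 = - 108 * ev x y detGamma.
  transitivity ((3 * x) ^+ 2 * (3 * y) ^+ 2 - 4 * (3 * y) ^+ 3 * (z1 * z2 * z3)
    - 4 * (3 * x) ^+ 3 * (z1 * z2 * z3) + 18 * (3 * x) * (3 * y) * (z1 * z2 * z3)
    - 27 * (z1 * z2 * z3) ^+ 2); last first.
    by rewrite h3 ev_detGamma; field.
  transitivity ((3 * x) ^+ 2 * (3 * y) ^+ 2 - 4 * (3 * y) ^+ 3
    - 4 * (3 * x) ^+ 3 * (z1 * z2 * z3) + 18 * (3 * x) * (3 * y) * (z1 * z2 * z3)
    - 27 * (z1 * z2 * z3) ^+ 2); last by rewrite h3; ring.
  by rewrite -h1 -h2; ring.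
by move=> P0; split; apply: contra_neq P0 => h; apply/eqP; move/eqP: e;
  rewrite h !(mul0r, mulr0) expr0n eq_sym mulf_eq0 oppr_eq0 pnatr_eq0.
Qed.

Lemma ev_Phi n : z1 - z2 != 0 -> z1 - z3 != 0 -> z2 - z3 != 0 ->
  ev x y (Phi n) = 2^-1 * (rdiff z1 z2 * (z1 ^ n - z2 ^ n)
    + rdiff z1 z3 * (z1 ^ n - z3 ^ n) + rdiff z2 z3 * (z2 ^ n - z3 ^ n)).
Proof.
move=> d12 d13 d23; move: n.
apply: (@rec3_inj _ (z1 + z2 + z3) (z1 * z2 + z1 * z3 + z2 * z3)).
- move=> n /=; rewrite Phi_rec evD evB !evM evZ evW !ev_nat h1 h2; ring.
- have e1 := rec3_exprz h3.
  have e2 : rec3 (z1 + z2 + z3) (z1 * z2 + z1 * z3 + z2 * z3) (exprz z2).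
    have h : z2 * z1 * z3 = 1 by rewrite (mulrC z2).
    by have := rec3_exprz h; congr rec3; ring.
  have e3 : rec3 (z1 + z2 + z3) (z1 * z2 + z1 * z3 + z2 * z3) (exprz z3).
    have h : z3 * z1 * z2 = 1 by rewrite -mulrA mulrC.
    by have := rec3_exprz h; congr rec3; ring.
  move=> n; rewrite e1 e2 e3.
  move: (z1 ^ (n + 1)) (z1 ^ n) (z1 ^ (n - 1)) => a1 a2 a3.
  move: (z2 ^ (n + 1)) (z2 ^ n) (z2 ^ (n - 1)) => b1 b2 b3.
  move: (z3 ^ (n + 1)) (z3 ^ n) (z3 ^ (n - 1)) => c1 c2 c3.
  move: (z1 + z2 + z3) (z1 * z2 + _ + _) (rdiff z1 z2) (rdiff z1 z3) (rdiff z2 z3) => s t q1 q2 q3.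
  ring.
- rewrite PhiN1 evN evM evW ev_nat -h2 !exprN1.
  have [n1 n2 n3] := roots_neq0.
  have i1 : z1^-1 = z2 * z3 by apply: (mulfI n1); rewrite mulfV// mulrA h3.
  have i2 : z2^-1 = z1 * z3.
    by apply: (mulfI n2); rewrite mulfV// mulrA (mulrC z2) h3.
  have i3 : z3^-1 = z1 * z2 by apply: (mulfI n3); rewrite mulfV// mulrC h3.
  rewrite i1 i2 i3 /rdiff; field; rewrite ?d12 ?d13 ?d23 //.
- by rewrite Phi0 ev0 !expr0z; ring.
- by rewrite Phi1 evM evZ ev_nat -h1 !expr1z /rdiff; field; rewrite ?d12 ?d13 ?d23.
Qed.

Lemma ev_pwS a b : ev x y (pwS a b) =
  z1 ^ a * z2 ^ b + z2 ^ a * z1 ^ b + z1 ^ a * z3 ^ b + z3 ^ a * z1 ^ b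
  + z2 ^ a * z3 ^ b + z3 ^ a * z2 ^ b.
Proof.
have [n1 n2 n3] := roots_neq0.
rewrite /pwS evB evM !ev_pw !expfzDr//.
move: (z1 ^ a) (z2 ^ a) (z3 ^ a) (z1 ^ b) (z2 ^ b) (z3 ^ b) => ? ? ? ? ? ?; ring.
Qed.

Lemma ev_pwT a b c : ev x y (pwT a b c) =
  z1 ^ a * z2 ^ b * z3 ^ c + z2 ^ a * z1 ^ b * z3 ^ c
  + z1 ^ a * z3 ^ b * z2 ^ c + z3 ^ a * z1 ^ b * z2 ^ c
  + z2 ^ a * z3 ^ b * z1 ^ c + z3 ^ a * z2 ^ b * z1 ^ c.
Proof.
have [n1 n2 n3] := roots_neq0.
have hc : z1 ^ c * z2 ^ c * z3 ^ c = 1 by rewrite -!expfzMl h3 exp1rz.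
have i1 : z1 ^ (- c) = z2 ^ c * z3 ^ c.
  by rewrite -invr_expz; apply: (mulfI (expfz_neq0 c n1)); rewrite mulfV ?expfz_neq0// mulrA hc.
have i2 : z2 ^ (- c) = z1 ^ c * z3 ^ c.
  rewrite -invr_expz; apply: (mulfI (expfz_neq0 c n2)); rewrite mulfV ?expfz_neq0//.
  by rewrite mulrA (mulrC (z2 ^ c)) hc.
have i3 : z3 ^ (- c) = z1 ^ c * z2 ^ c.
  rewrite -invr_expz; apply: (mulfI (expfz_neq0 c n3)); rewrite mulfV ?expfz_neq0//.
  by rewrite mulrC hc.
rewrite /pwT ev_pwS !expfzDr// i1 i2 i3.
move: hc; move: (z1 ^ c) (z2 ^ c) (z3 ^ c) (z1 ^ a) (z2 ^ a) (z3 ^ a)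
  (z1 ^ b) (z2 ^ b) (z3 ^ b) => u1 u2 u3 v1 v2 v3 w1 w2 w3 hc.
pose X := v1 * w2 * u3 + v2 * w1 * u3 + v1 * w3 * u2 + v3 * w1 * u2
  + v2 * w3 * u1 + v3 * w2 * u1.
transitivity ((u1 * u2 * u3) * X); first by rewrite /X; ring.
by rewrite hc mul1r.
Qed.

Lemma ev_string (m : nat) b c : ev x y (string m b c) =
  2 * (z1 ^ b * z2 ^ b * z3 ^ c * string_sum m z1 z2
     + z1 ^ b * z3 ^ b * z2 ^ c * string_sum m z1 z3
     + z2 ^ b * z3 ^ b * z1 ^ c * string_sum m z2 z3).
Proof.
have [n1 n2 n3] := roots_neq0.
have two u v : 2 * string_sum m u v = string_sum m u v + string_sum m v u :> C.
  by rewrite (string_sumC m v); ring.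
rewrite /string (raddf_sum (ev x y)) 2!mulrDr 3!(mulrCA 2) 3!two /string_sum.
rewrite -[in RHS]big_split -[in RHS]big_split -[in RHS]big_split /= 3!mulr_sumr.
rewrite -big_split -big_split /=; apply: eq_bigr => l _.
rewrite ev_pwT !expfzDr// -!exprnP.
move: (z1 ^ b) (z2 ^ b) (z3 ^ b) (z1 ^ c) (z2 ^ c) (z3 ^ c) => ? ? ? ? ? ?.
move: (z1 ^+ l) (z2 ^+ l) (z3 ^+ l) (z1 ^+ _) (z2 ^+ _) (z3 ^+ _) => ? ? ? ? ? ?; ring.
Qed.

End Roots.

(** The contribution of one pair of roots u, v to the Euler field of S(n, -k), with t the third
    root. The string lengths n + k, n and k are the gaps between the exponents n, 0, -k. *)
Lemma rdiff_string (n k : nat) (u v t : C) : u != 0 -> v != 0 -> u - v != 0 ->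
  rdiff u v * ((n + k)%:R * (u ^ n * v ^ (- k%:Z) - v ^ n * u ^ (- k%:Z))
    + n%:R * (u ^ n - v ^ n) * t ^ (- k%:Z)
    - k%:R * (u ^ (- k%:Z) - v ^ (- k%:Z)) * t ^ n) =
  (n + k)%:R * (u ^ n * v ^ (- k%:Z) + v ^ n * u ^ (- k%:Z)
     + 2 * string_sum (n + k) u v * (u ^ (- k%:Z) * v ^ (- k%:Z)))
  + n%:R * (u ^ n + v ^ n + 2 * string_sum n u v) * t ^ (- k%:Z)
  + k%:R * (u ^ (- k%:Z) + v ^ (- k%:Z)
     + 2 * string_sum k u v * (u ^ (- k%:Z) * v ^ (- k%:Z))) * t ^ n.
Proof.
move=> u0 v0 uv.
(* The factor [m] absorbs the case m = 0, where [string_sumP] fails because the single point would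
   be counted twice as an end point. *)
have key (m : nat) : m%:R * (rdiff u v * (u ^+ m - v ^+ m)) =
    m%:R * (u ^+ m + v ^+ m + 2 * string_sum m u v) :> C.
  case: m => [|m]; first by rewrite !mul0r.
  congr (_ * _); rewrite /rdiff mulrAC string_sumP// mulrAC mulfV// mul1r; ring.
have uk : u ^ (- k%:Z) * u ^+ k = 1 by rewrite -exprnN mulVf// expf_neq0.
have vk : v ^ (- k%:Z) * v ^+ k = 1 by rewrite -exprnN mulVf// expf_neq0.
have h1 := key (n + k)%N; have h2 := key n; have h3 := key k.
move: uk vk h1 h2 h3; rewrite !exprD -!exprnP.
set a := u ^ _; set b := v ^ _; set x := u ^+ n; set y := v ^+ n.
set x' := u ^+ k; set y' := v ^+ k; set q := rdiff u v => uk vk h1 h2 h3.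
move: uk vk h1 h2 h3; clearbody a b x y x' y' q; move=> uk vk h1 h2 h3.
have -> : x * b - y * a = (a * b) * (x * x' - y * y').
  transitivity (x * b * (a * x') - y * a * (b * y')); first by rewrite uk vk !mulr1.
  ring.
have -> : a - b = (a * b) * (y' - x').
  transitivity (a * (b * y') - b * (a * x')); first by rewrite uk vk !mulr1.
  ring.
transitivity ((a * b) * ((n + k)%:R * (q * (x * x' - y * y')))
  + n%:R * (q * (x - y)) * t ^ (- k%:Z)
  + (a * b) * (k%:R * (q * (x' - y'))) * t ^+ n); first ring.
rewrite h1 h2 h3.
transitivity ((n + k)%:R * (x * b * (a * x') + y * a * (b * y')
     + 2 * string_sum (n + k) u v * (a * b))
  + n%:R * (x + y + 2 * string_sum n u v) * t ^ (- k%:Z)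
  + k%:R * (a * (b * y') + b * (a * x')
     + 2 * string_sum k u v * (a * b)) * t ^+ n); first ring.
by rewrite uk vk !mulr1 (addrC a).
Qed.

(** The sum of [rdiff_string] over the three pairs of roots. That every coefficient is a natural
    number is the source of all positivity at the cusp. *)
Lemma Euler_string (n k : nat) : 2 * Euler (pwS n%:Z (- k%:Z) : B) =
  (n + k)%:R * (2 * pwS n%:Z (- k%:Z) + string (n + k) (- k%:Z) 0)
  + n%:R * string n 0 (- k%:Z) + k%:R * string k (- k%:Z) n%:Z.
Proof.
apply: ev_inj_generic => x y.
have [[[z1 z2] z3] /= [h1 h2 h3]] := cubic_roots (3 * x) (3 * y).
move=> /(roots_distinct h1 h2 h3)[d12 d13 d23].
have [n1 n2 n3] := roots_neq0 h3.
rewrite Euler_pwS !(ev_nat, ev_int, evB, evM, evD).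
rewrite !(ev_Phi h1 h2 h3)// !(ev_string h1 h2 h3) ?(ev_pwS h1 h2 h3) !(ev_pw h1 h2 h3).
rewrite !expfzDr//.
have := rdiff_string n k z3 n1 n2 d12.
have := rdiff_string n k z2 n1 n3 d13.
have := rdiff_string n k z1 n2 n3 d23.
rewrite !expr0z intrD !mulrNz -!pmulrn natrD.
move: (z1 ^ n) (z2 ^ n) (z3 ^ n) => x1 x2 x3.
move: (z1 ^ (- k%:Z)) (z2 ^ (- k%:Z)) (z3 ^ (- k%:Z)) => y1 y2 y3.
move: (rdiff z1 z2) (rdiff z1 z3) (rdiff z2 z3) => q1 q2 q3.
move: (string_sum (n + k)) (string_sum n) (string_sum k) => A1 A2 A3.
move=> p23 p13 p12.
transitivity ((2 * 2^-1) *
  (q1 * ((n%:R + k%:R) * (x1 * y2 - x2 * y1) + n%:R * (x1 - x2) * y3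
     - k%:R * (y1 - y2) * x3)
   + q2 * ((n%:R + k%:R) * (x1 * y3 - x3 * y1) + n%:R * (x1 - x3) * y2
     - k%:R * (y1 - y3) * x2)
   + q3 * ((n%:R + k%:R) * (x2 * y3 - x3 * y2) + n%:R * (x2 - x3) * y1
     - k%:R * (y2 - y3) * x1))); first by ring.
by rewrite p12 p13 p23 mulfV ?pnatr_eq0// mul1r; ring.
Qed.

End Pointwise.

Arguments string {R} m b c.
Arguments pwT {R} a b c.

(** * Eigenvectors and their values at the cusp *)

(** Turns integer powers into variables so that [ring] treats them as atoms. *)
Ltac gen_exprz := repeat match goal with
  |- context [@exprz ?U ?x ?n] => move: (@exprz U x n) => ? end.

Section Spectrum.
Variable R : realType.
Local Notation C := R[i].
Local Notation B := {poly {poly C}}.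
Implicit Types (p q f g u v : B) (a b c : int).

Local Notation W := (vZbar : B).
Local Notation Z := (vZ : B).

Lemma pwT_eqP p q :
  (forall x y z1 z2 z3, z1 + z2 + z3 = 3 * x ->
    z1 * z2 + z1 * z3 + z2 * z3 = 3 * y -> z1 * z2 * z3 = 1 ->
    ev x y p = ev x y q) -> p = q.
Proof.
move=> pq; apply: ev_inj => x y.
have [[[z1 z2] z3] /= [h1 h2 h3]] := cubic_roots (3 * x) (3 * y).
exact: (pq _ _ _ _ _ h1 h2 h3).
Qed.

Lemma pwT_swap12 a b c : pwT b a c = pwT a b c :> B.
Proof.
by apply: pwT_eqP => x y z1 z2 z3 h1 h2 h3; rewrite !(ev_pwT h1 h2 h3); gen_exprz; ring.
Qed.

Lemma pwT_swap23 a b c : pwT a c b = pwT a b c :> B.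
Proof.
by apply: pwT_eqP => x y z1 z2 z3 h1 h2 h3; rewrite !(ev_pwT h1 h2 h3); gen_exprz; ring.
Qed.

Lemma pw_pwT d a b c :
  pw d * pwT a b c = pwT (a + d) b c + pwT a (b + d) c + pwT a b (c + d) :> B.
Proof.
apply: pwT_eqP => x y z1 z2 z3 h1 h2 h3.
have [n1 n2 n3] := roots_neq0 h3.
by rewrite evM 2!evD !(ev_pwT h1 h2 h3) (ev_pw h1 h2 h3) !expfzDr//; gen_exprz; ring.
Qed.

Lemma pwT0 a b : pwT a b 0 = pwS a b :> B.
Proof. by rewrite /pwT !subr0. Qed.

(** Sorting the exponents brings them into the dominant chamber, n and k being the two consecutive
    gaps and n + k the spread, which [M] bounds. The quadratic form is symmetric in the exponents
    and is the eigenvalue for lambda = 1. *)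
Lemma pwT_dominant (a b c M : int) :
  a - b <= M -> b - a <= M -> a - c <= M -> c - a <= M ->
  b - c <= M -> c - b <= M ->
  exists n k : nat, [/\ pwT a b c = pwS n%:Z (- k%:Z) :> B, (n + k)%:Z <= M &
    (n ^ 2 + k ^ 2 + n * k)%:Z =
      a ^+ 2 + b ^+ 2 + c ^+ 2 - a * b - b * c - a * c].
Proof.
move=> h1 h2 h3 h4 h5 h6.
have sorted a' b' c' : c' <= b' -> b' <= a' -> a' - c' <= M ->
  exists n k : nat, [/\ pwT a' b' c' = pwS n%:Z (- k%:Z) :> B, (n + k)%:Z <= M &
    (n ^ 2 + k ^ 2 + n * k)%:Z =
      a' ^+ 2 + b' ^+ 2 + c' ^+ 2 - a' * b' - b' * c' - a' * c'].
  move=> cb ba ac; exists `|a' - b'|%N, `|b' - c'|%N.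
  have e1 : `|a' - b'|%N%:Z = a' - b' by lia.
  have e2 : `|b' - c'|%N%:Z = b' - c' by lia.
  split.
  - by rewrite e1 e2 opprB -pwT_swap23.
  - by rewrite PoszD e1 e2; lia.
  - by rewrite -!mulnn !PoszD !PoszM e1 e2; ring.
have [cb|/ltW bc] := leP c b; have [ba|/ltW ab] := leP b a; have [ca|/ltW ac] := leP c a.
- exact: sorted.
- by apply: sorted => //; lia.
- have [n [k [e H1 H2]]] := sorted b a c ca ab h5; exists n, k.
  by split=> //; rewrite -?e ?H2; [exact: pwT_swap12 | ring].
- have [n [k [e H1 H2]]] := sorted b c a ac cb h2; exists n, k.
  by split=> //; rewrite -?e ?H2; [symmetry; rewrite pwT_swap23 pwT_swap12 | ring].
- have [n [k [e H1 H2]]] := sorted a c b bc ca h1; exists n, k.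
  by split=> //; rewrite -?e ?H2; [rewrite pwT_swap23 | ring].
- have [n [k [e H1 H2]]] := sorted c a b ba ac h6; exists n, k.
  by split=> //; rewrite -?e ?H2; [symmetry; rewrite pwT_swap12 pwT_swap23 | ring].
- have [n [k [e H1 H2]]] := sorted b a c ca ab h5; exists n, k.
  by split=> //; rewrite -?e ?H2; [exact: pwT_swap12 | ring].
- have [n [k [e H1 H2]]] := sorted c b a ab bc h4; exists n, k.
  by split=> //; rewrite -?e ?H2; [symmetry; rewrite pwT_swap12 pwT_swap23 pwT_swap12 | ring].
Qed.

Lemma ReD (z w : C) : complex.Re (z + w) = complex.Re z + complex.Re w.
Proof. by case: z; case: w. Qed.

Lemma Re_realM (a : R) (z : C) : complex.Re ((a%:C)%C * z) = a * complex.Re z.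
Proof. by case: z => x y /=; rewrite mul0r subr0. Qed.

Lemma Re_nat (n : nat) : complex.Re (n%:R : C) = n%:R.
Proof. by rewrite -(rmorph_nat (real_complex R)). Qed.

Lemma ev11_pwS a b : ev 1 1 (pwS a b) = 6 :> C.
Proof.
have h : 1 + 1 + 1 = 3 * 1 :> C by ring.
by rewrite (ev_pwS (z1:=1) (z2:=1) (z3:=1)) ?exp1rz ?mulr1//; ring.
Qed.

Variable l : R.
Hypothesis l1 : 1 <= l.

(** The symmetry demanded at eigenvalue 0 serves [integral_swap]: for other eigenvalues the integral
    vanishes, for 0 the invariance must be known directly. *)
Inductive eigen_span : B -> Prop :=
| eigen_span0 : eigen_span 0
| eigen_spanD p q : eigen_span p -> eigen_span q -> eigen_span (p + q)
| eigen_span_eig (E : R) e : Lop l e = - (realC E * e) ->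
    (E = 0 -> swapXY e = e) -> eigen_span e.

Lemma eigen_spanZ (c : C) p : eigen_span p -> eigen_span (cstC c * p).
Proof.
elim=> [|{}p q _ hp _ hq|E e eE e0].
- by rewrite mulr0; exact: eigen_span0.
- by rewrite mulrDr; exact: eigen_spanD.
- apply: (@eigen_span_eig E); first by rewrite Lop_cstM eE mulrN mulrCA.
  by move=> /e0 he; rewrite swapM swap_cstC he.
Qed.

Lemma Lop_realCM (a : R) p : Lop l (realC a * p) = realC a * Lop l p.
Proof. exact: Lop_cstM. Qed.

(** By [Euler_string], what remains of twice the Euler field of S(n, -k) once its diagonal part 2 (n
    + k) S(n, -k) is removed. *)
Definition strings (n k : nat) : B :=
  (n + k)%:R * string (n + k) (- k%:Z) 0
  + n%:R * string n 0 (- k%:Z) + k%:R * string k (- k%:Z) n%:Z.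

Lemma Lop_pwS (n k : nat) : Lop l (pwS n%:Z (- k%:Z)) =
  - (realC (eigval l n k) * pwS n%:Z (- k%:Z))
  - realC ((l - 1) / 2) * strings n k :> B.
Proof.
have -> : Lop l (pwS n%:Z (- k%:Z)) = Lop 1 (pwS n%:Z (- k%:Z))
    - realC ((l - 1) / 2) * (2 * Euler (pwS n%:Z (- k%:Z))) :> B.
  rewrite (Lop_Euler l) realCM; congr (_ - _).
  have := realC_half R; move: (realC 2^-1) (realC (l - 1)) (Euler _) => h c p hp.
  by rewrite -mulrA (mulrA h) hp mul1r.
rewrite Euler_string Lop1_pwS /strings.
have -> : (n%:Z ^+ 2 + (- k%:Z) ^+ 2 - n%:Z * - k%:Z)%:~R =
    realC (n ^ 2 + k ^ 2 + n * k)%:R :> B.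
  rewrite realC_nat pmulrn; congr (_ %:~R).
  by rewrite -!mulnn !PoszD !PoszM; ring.
have -> : realC (eigval l n k) = realC ((l - 1) / 2) * 2 * (n + k)%:R
     + realC (n ^ 2 + k ^ 2 + n * k)%:R :> B.
  rewrite /eigval realCD realCM realC_nat; congr (_ * _ + _).
  by rewrite [realC (_ / _)]realCM -[RHS]mulrA realC_half [RHS]mulr1.
ring.
Qed.

(* The last condition records positivity at the cusp Z = Zbar = 1. *)
Definition resolvable (E0 : R) v := exists u,
  [/\ Lop l u + realC E0 * u = v, eigen_span u & 0 <= complex.Re (ev 1 1 u)].

Lemma resolvable0 E0 : resolvable E0 0.
Proof.
exists 0; split; last by rewrite ev0.
- by rewrite (raddf0 (Lop l)) mulr0 addr0.
- exact: eigen_span0.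
Qed.

Lemma resolvableD E0 u v : resolvable E0 u -> resolvable E0 v -> resolvable E0 (u + v).
Proof.
move=> [u' [<- su pu]] [v' [<- sv pv]]; exists (u' + v'); split.
- by rewrite LopD; ring.
- exact: eigen_spanD.
- by rewrite evD ReD addr_ge0.
Qed.

Lemma resolvableZ E0 (a : R) u : 0 <= a -> resolvable E0 u -> resolvable E0 (realC a * u).
Proof.
move=> a0 [u' [<- su pu]]; exists (realC a * u'); split.
- by rewrite Lop_realCM; ring.
- exact: eigen_spanZ.
- by rewrite evM ev_realC Re_realM mulr_ge0.
Qed.

Lemma resolvable_natM E0 (n : nat) u : resolvable E0 u -> resolvable E0 (n%:R * u).
Proof. by move=> hu; rewrite -realC_nat; exact: resolvableZ. Qed.

Lemma resolvable_sum E0 (m : nat) (F : nat -> B) :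
  (forall i, (1 <= i < m)%N -> resolvable E0 (F i)) ->
  resolvable E0 (\sum_(1 <= i < m) F i).
Proof.
move=> h; rewrite big_nat; elim/big_ind: _ => //; first exact: resolvable0.
by move=> u v; exact: resolvableD.
Qed.

(** Inside a string the spread n' + k' does not exceed n + k and the quadratic form strictly drops;
    for l >= 1 the eigenvalue therefore drops strictly, so that even E0 = [eigval l n k] is
    allowed. *)
Lemma strings_resolvable (n k : nat) E0 :
  (forall n' k' : nat, (n' ^ 2 + k' ^ 2 + n' * k' < n ^ 2 + k ^ 2 + n * k)%N ->
    eigval l n' k' < E0 -> resolvable E0 (pwS n'%:Z (- k'%:Z))) ->
  eigval l n k <= E0 -> resolvable E0 (strings n k).
Proof.
move=> IH EE0.
have term (a b c : int) :
    a - b <= (n + k)%:Z -> b - a <= (n + k)%:Z -> a - c <= (n + k)%:Z ->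
    c - a <= (n + k)%:Z -> b - c <= (n + k)%:Z -> c - b <= (n + k)%:Z ->
    a ^+ 2 + b ^+ 2 + c ^+ 2 - a * b - b * c - a * c <
      (n ^ 2 + k ^ 2 + n * k)%:Z -> resolvable E0 (pwT a b c).
  move=> h1 h2 h3 h4 h5 h6 hN.
  have [n' [k' [-> hM hN']]] := pwT_dominant h1 h2 h3 h4 h5 h6.
  have {hN}hN : (n' ^ 2 + k' ^ 2 + n' * k' < n ^ 2 + k ^ 2 + n * k)%N.
    by rewrite -ltz_nat hN'.
  apply: (IH n' k' hN).
  apply: lt_le_trans EE0; rewrite /eigval ler_ltD//; last by rewrite ltr_nat.
  by rewrite ler_wpM2l ?subr_ge0// ler_nat -lez_nat.
(* Moving i steps into a string of length m lowers the quadratic form by 3 i (m - i). *)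
have lt3 (N' x y : int) : 0 < x -> 0 < y -> N' - 3 * (x * y) < N'.
  by move=> x0 y0; rewrite ltrBlDr ltrDl mulr_gt0// mulr_gt0.
have nk2 : (n ^ 2 + k ^ 2 + n * k)%:Z = n%:Z ^+ 2 + k%:Z ^+ 2 + n%:Z * k%:Z.
  by rewrite -!mulnn !PoszD !PoszM; ring.
rewrite /strings; apply: resolvableD; first apply: resolvableD;
  apply: resolvable_natM; apply: resolvable_sum => i /andP[i1 ilt].
- have -> : (n + k - i)%:Z = n%:Z + k%:Z - i%:Z by lia.
  apply: term; try lia; rewrite nk2.
  set N' := (X in _ < X); rewrite [X in X < _](_ : _ = N' - 3 * (i%:Z * (n%:Z + k%:Z - i%:Z))).
    by apply: lt3; lia.
  by rewrite /N'; ring.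
- have -> : (n - i)%:Z = n%:Z - i%:Z by lia.
  apply: term; try lia; rewrite nk2.
  set N' := (X in _ < X); rewrite [X in X < _](_ : _ = N' - 3 * (i%:Z * (n%:Z - i%:Z))).
    by apply: lt3; lia.
  by rewrite /N'; ring.
- have -> : (k - i)%:Z = k%:Z - i%:Z by lia.
  apply: term; try lia; rewrite nk2.
  set N' := (X in _ < X); rewrite [X in X < _](_ : _ = N' - 3 * (i%:Z * (k%:Z - i%:Z))).
    by apply: lt3; lia.
  by rewrite /N'; ring.
Qed.

(** Induction on the quadratic form. If u solves the equation for [strings n k], then L + E0 sends S
    + (l - 1)/2 u to (E0 - eigval) S; dividing by E0 - eigval > 0 preserves the sign at the cusp. *)
Lemma pwS_resolvable (n k : nat) : eigen_span (pwS n%:Z (- k%:Z)) /\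
  forall E0, eigval l n k < E0 -> resolvable E0 (pwS n%:Z (- k%:Z)).
Proof.
have [N] := ubnP (n ^ 2 + k ^ 2 + n * k)%N; elim: N n k => // N IH n k; rewrite ltnS => nkN.
have low E0 : eigval l n k <= E0 -> resolvable E0 (strings n k).
  apply: strings_resolvable => n' k' lt_nk.
  by have [_] := IH n' k' (leq_trans lt_nk nkN); exact.
have c0 : 0 <= (l - 1) / 2 by rewrite divr_ge0// subr_ge0.
have sS : eigen_span (pwS n%:Z (- k%:Z)).
  have [/eqP|N0] := eqVneq (n ^ 2 + k ^ 2 + n * k)%N 0.
    rewrite !addn_eq0 !expn_eq0 /= !andbT => /andP[/andP[/eqP -> /eqP ->] _].
    have -> : pwS 0%:Z (- 0%:Z) = 6%:R :> B by rewrite /pwS oppr0 addr0 pw0; ring.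
    apply: (@eigen_span_eig 0) => [|_]; first by rewrite Lop_nat realC0 mul0r oppr0.
    by rewrite -realC_nat swap_realC.
  have [u [uE su _]] := low _ (lexx (eigval l n k)).
  (* S is the eigenvector S + (l - 1)/2 u minus a vector already in the span. *)
  rewrite -[pwS _ _](addrK (realC ((l - 1) / 2) * u)) -mulNr -realCN realC_cstC.
  apply: eigen_spanD; last exact: eigen_spanZ.
  apply: (@eigen_span_eig (eigval l n k)).
    rewrite LopD Lop_pwS Lop_realCM -uE; ring.
  (* The quadratic form is nonzero here, so the eigenvalue is positive and the condition at
     eigenvalue 0 is vacuous. *)
  move/eqP; rewrite gt_eqF// /eigval ltr_wpDl//; last by rewrite ltr0n lt0n.
  by rewrite mulr_ge0// subr_ge0.
split=> // E0 EE0; have [u [uE su u0]] := low _ (ltW EE0).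
have d0 : 0 < E0 - eigval l n k by rewrite subr_gt0.
have -> : pwS n%:Z (- k%:Z) = realC (E0 - eigval l n k)^-1 *
    (realC (E0 - eigval l n k) * pwS n%:Z (- k%:Z)) :> B.
  by rewrite mulrA -realCM mulVf ?gt_eqF// realC1 mul1r.
apply: resolvableZ; first by rewrite invr_ge0 ltW.
exists (pwS n%:Z (- k%:Z) + realC ((l - 1) / 2) * u); split.
- by rewrite LopD Lop_pwS Lop_realCM -uE realCB; ring.
- by apply: eigen_spanD => //; rewrite realC_cstC; exact: eigen_spanZ.
- rewrite evD ev11_pwS evM ev_realC.
  by rewrite ReD Re_realM Re_nat addr_ge0// mulr_ge0.
Qed.

Lemma pwS_eigen_span a b : eigen_span (pwS a b).
Proof.
rewrite -pwT0; have [n [k [-> _ _]]] := @pwT_dominant a b 0 (`|a| + `|b|)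
  ltac:(lia) ltac:(lia) ltac:(lia) ltac:(lia) ltac:(lia) ltac:(lia).
by have [] := pwS_resolvable n k.
Qed.

Inductive pwS_span : B -> Prop :=
| pwS_span0 : pwS_span 0
| pwS_spanD p q : pwS_span p -> pwS_span q -> pwS_span (p + q)
| pwS_span_pwS (c : C) a b : pwS_span (cstC c * pwS a b).

Lemma pwS_spanM (d : int) (c : C) p : pwS_span p -> pwS_span (cstC c * pw d * p).
Proof.
elim=> [|{}p q _ hp _ hq|e a b].
- by rewrite mulr0; exact: pwS_span0.
- by rewrite mulrDr; exact: pwS_spanD.
- have -> : cstC c * pw d * (cstC e * pwS a b) = cstC (c * e) * (pw d * pwT a b 0).
    by rewrite pwT0 cstCM; ring.
  by rewrite pw_pwT 2!mulrDr; do 2?apply: pwS_spanD; exact: pwS_span_pwS.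
Qed.

(** The span contains the constants and is stable under [pw 1] and [pw (-1)], which are 3 Z and 3
    Zbar. *)
Lemma all_pwS_span p : pwS_span p.
Proof.
have third : cstC 3^-1 * 3 = 1 :> B.
  have -> : 3 = cstC 3 :> B by exact/esym/cstC_nat.
  by rewrite -cstCM mulVf ?cstC1// pnatr_eq0.
have spanZ q : pwS_span q -> pwS_span (q * Z).
  move/(pwS_spanM 1 3^-1); rewrite pw1.
  have -> : cstC 3^-1 * (3 * Z) * q = cstC 3^-1 * 3 * (q * Z) :> B by ring.
  by rewrite third mul1r.
have spanW q : pwS_span q -> pwS_span (q * W).
  move/(pwS_spanM (-1) 3^-1); rewrite pwN1.
  have -> : cstC 3^-1 * (3 * W) * q = cstC 3^-1 * 3 * (q * W) :> B by ring.
  by rewrite third mul1r.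
have spanC (c : C) : pwS_span (cstC c).
  have -> : cstC c = cstC (c * 6^-1) * pwS 0 0.
    rewrite /pwS addr0 pw0 (_ : 3 * 3 - 3 = cstC 6); last first.
      by rewrite cstC_nat; ring.
    have c6 : c = c * 6^-1 * 6 by rewrite -mulrA mulVf ?mulr1// pnatr_eq0.
    by rewrite {1}c6 cstCM.
  exact: pwS_span_pwS.
elim/poly_ind: p => [|p c hp]; first exact: pwS_span0.
apply: pwS_spanD; first exact: spanZ.
elim/poly_ind: c => [|c d hc]; first by rewrite polyC0; exact: pwS_span0.
by rewrite polyCD polyCM; apply: pwS_spanD; [exact: spanW | exact: spanC].
Qed.

Theorem eigen_span_all p : eigen_span p.
Proof.
elim: (all_pwS_span p) => [|{}p q _ hp _ hq|c a b].
- exact: eigen_span0.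
- exact: eigen_spanD.
- exact/eigen_spanZ/pwS_eigen_span.
Qed.

(** Here E0 is the eigenvalue of S(n, -k) itself, since only the strings have to be inverted. At the
    cusp all roots equal 1: S contributes 6 and the correction is nonnegative. *)
Theorem eigenvector_pos (n k : nat) : exists e, eigenvector l n k e /\
  0 < complex.Re (ev 1 1 e).
Proof.
have [||u [uE _ u0]] := @strings_resolvable n k (eigval l n k).
- by move=> n' k' _; have [_] := pwS_resolvable n' k'; exact.
- by [].
have c0 : 0 <= (l - 1) / 2 by rewrite divr_ge0// subr_ge0.
exists (pwS n%:Z (- k%:Z) + realC ((l - 1) / 2) * u); split.
  by rewrite /eigenvector LopD Lop_pwS Lop_realCM -uE; ring.
rewrite evD ev11_pwS evM ev_realC.
rewrite ReD Re_realM Re_nat; apply: ltr_pwDl; [by rewrite ltr0n | exact: mulr_ge0].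
Qed.
End Spectrum.

(** * Real values of polynomials and geometry of the deltoid *)

Section EvalReal.
Variable R : realType.
Local Notation C := R[i].
Local Notation B := {poly {poly C}}.
Implicit Types (p q f g u v : B) (z : R * R).

(** The real part of a product involves imaginary parts, so regularity and bounds are proved for
    [evalR] and [evalI] together, along [bipoly_ind]. *)
Definition evalI p z : R := complex.Im (evalC p z).

Lemma evalCE p z : evalC p z = ev (Complex z.1 z.2) (Complex z.1 (- z.2)) p.
Proof. by []. Qed.

Lemma bipoly_ind (P : B -> Prop) :
  (forall c, P (cstC c)) -> P vZ -> P vZbar ->
  (forall p q, P p -> P q -> P (p + q)) ->
  (forall p q, P p -> P q -> P (p * q)) -> forall p, P p.
Proof.
move=> PC PZ PW PD PM.
have P0 : P 0 by have := PC 0; rewrite (raddf0 (@cstC R)).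
move=> p; elim/poly_ind: p => [//|p c Pp]; apply: (PD); first exact: (PM).
elim/poly_ind: c => [|c d Pc]; first by rewrite polyC0.
by rewrite polyCD polyCM; apply: (PD); [exact: (PM) | exact: (PC)].
Qed.

Lemma evalRD p q z : evalR (p + q) z = evalR p z + evalR q z.
Proof. by rewrite /evalR !evalCE evD ReD. Qed.
Lemma evalID p q z : evalI (p + q) z = evalI p z + evalI q z.
Proof. by rewrite /evalI !evalCE evD; case: (ev _ _ p); case: (ev _ _ q). Qed.
Lemma evalRM p q z : evalR (p * q) z = evalR p z * evalR q z - evalI p z * evalI q z.
Proof. by rewrite /evalR /evalI !evalCE evM; case: (ev _ _ p); case: (ev _ _ q). Qed.
Lemma evalIM p q z : evalI (p * q) z = evalR p z * evalI q z + evalI p z * evalR q z.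
Proof.
by rewrite /evalR /evalI !evalCE evM; case: (ev _ _ p); case: (ev _ _ q) => a b c d /=; rewrite addrC (mulrC d) (mulrC c) addrC.
Qed.
Lemma evalR_cstC c z : evalR (cstC c) z = complex.Re c.
Proof. by rewrite /evalR evalCE ev_cstC. Qed.
Lemma evalI_cstC c z : evalI (cstC c) z = complex.Im c.
Proof. by rewrite /evalI evalCE ev_cstC. Qed.
Lemma evalR_Z z : evalR vZ z = z.1. Proof. by rewrite /evalR evalCE evZ. Qed.
Lemma evalI_Z z : evalI vZ z = z.2. Proof. by rewrite /evalI evalCE evZ. Qed.
Lemma evalR_W z : evalR vZbar z = z.1. Proof. by rewrite /evalR evalCE evW. Qed.
Lemma evalI_W z : evalI vZbar z = - z.2. Proof. by rewrite /evalI evalCE evW. Qed.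
Lemma evalRN p z : evalR (- p) z = - evalR p z.
Proof. by rewrite /evalR !evalCE evN; case: (ev _ _ p). Qed.
Lemma evalIN p z : evalI (- p) z = - evalI p z.
Proof. by rewrite /evalI !evalCE evN; case: (ev _ _ p). Qed.
Lemma evalRB p q z : evalR (p - q) z = evalR p z - evalR q z.
Proof. by rewrite evalRD evalRN. Qed.
Lemma evalIB p q z : evalI (p - q) z = evalI p z - evalI q z.
Proof. by rewrite evalID evalIN. Qed.
Lemma evalR_realC a z : evalR (realC a) z = a. Proof. exact: evalR_cstC. Qed.
Lemma evalI_realC a z : evalI (realC a) z = 0. Proof. exact: evalI_cstC. Qed.
Lemma evalR0 z : evalR 0 z = 0. Proof. by rewrite -realC0 evalR_realC. Qed.
Lemma evalR1 z : evalR 1 z = 1. Proof. by rewrite -realC1 evalR_realC. Qed.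
Lemma evalI1 z : evalI 1 z = 0. Proof. by rewrite -realC1 evalI_realC. Qed.
Lemma evalR_realCM a p z : evalR (realC a * p) z = a * evalR p z.
Proof. by rewrite evalRM evalR_realC evalI_realC mul0r subr0. Qed.
Lemma evalR_realM p q z : real_valued p -> evalR (p * q) z = evalR p z * evalR q z.
Proof. by move=> rp; rewrite evalRM /evalI rp mul0r subr0. Qed.

Lemma continuous_evalRI p : continuous (evalR p) /\ continuous (evalI p).
Proof.
have cfst : continuous (fun z : R * R => z.1) by move=> z; exact: cvg_fst.
have csnd : continuous (fun z : R * R => z.2) by move=> z; exact: cvg_snd.
elim/bipoly_ind: p => [c|||p q [cp cp'] [cq cq']|p q [cp cp'] [cq cq']].
- split; [rewrite (_ : evalR _ = cst (complex.Re c)) | rewrite (_ : evalI _ = cst (complex.Im c))];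
    by [exact: cst_continuous | apply/funext => z; rewrite ?evalR_cstC ?evalI_cstC].
- by split; [rewrite (_ : evalR _ = fst) | rewrite (_ : evalI _ = snd)] => //;
    apply/funext => z; rewrite ?evalR_Z ?evalI_Z.
- split; [rewrite (_ : evalR _ = fst) | rewrite (_ : evalI _ = \- snd)] => //;
    do ?[by apply/funext => z; rewrite ?evalR_W ?evalI_W].
  by move=> z; apply: cvgN; exact: csnd.
- split; [rewrite (_ : evalR _ = evalR p \+ evalR q) | rewrite (_ : evalI _ = evalI p \+ evalI q)];
    do ?[by apply/funext => z; rewrite ?evalRD ?evalID]; move=> z;
    by apply: cvgD; [exact: cp || exact: cp' | exact: cq || exact: cq'].
- split; [rewrite (_ : evalR _ = (evalR p \* evalR q) \- (evalI p \* evalI q)) |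
    rewrite (_ : evalI _ = (evalR p \* evalI q) \+ (evalI p \* evalR q))];
    do ?[by apply/funext => z; rewrite ?evalRM ?evalIM]; move=> z.
  + by apply: cvgB; apply: cvgM; [exact: cp|exact: cq|exact: cp'|exact: cq'].
  + by apply: cvgD; apply: cvgM; [exact: cp|exact: cq'|exact: cp'|exact: cq].
Qed.

Lemma continuous_evalR p : continuous (evalR p).
Proof. by case: (continuous_evalRI p). Qed.

Lemma measurable_evalRI p : measurable_fun setT (evalR p) /\ measurable_fun setT (evalI p).
Proof.
elim/bipoly_ind: p => [c|||p q [cp cp'] [cq cq']|p q [cp cp'] [cq cq']].
- split; [rewrite (_ : evalR _ = cst (complex.Re c)) | rewrite (_ : evalI _ = cst (complex.Im c))];
    by [exact: measurable_cst | apply/funext => z; rewrite ?evalR_cstC ?evalI_cstC].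
- by split; [rewrite (_ : evalR _ = fst) | rewrite (_ : evalI _ = snd)] => //;
    apply/funext => z; rewrite ?evalR_Z ?evalI_Z.
- split; [rewrite (_ : evalR _ = fst) | rewrite (_ : evalI _ = \- snd)] => //;
    do ?[by apply/funext => z; rewrite ?evalR_W ?evalI_W].
  by apply: measurable_funN; exact: measurable_snd.
- by split; [rewrite (_ : evalR _ = evalR p \+ evalR q) | rewrite (_ : evalI _ = evalI p \+ evalI q)];
    do ?[by apply/funext => z; rewrite ?evalRD ?evalID]; exact: measurable_funD.
- split; [rewrite (_ : evalR _ = (evalR p \* evalR q) \- (evalI p \* evalI q)) |
    rewrite (_ : evalI _ = (evalR p \* evalI q) \+ (evalI p \* evalR q))];
    do ?[by apply/funext => z; rewrite ?evalRM ?evalIM].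
  + by apply: measurable_funB; exact: measurable_funM.
  + by apply: measurable_funD; exact: measurable_funM.
Qed.

Lemma measurable_evalR p : measurable_fun setT (evalR p).
Proof. by case: (measurable_evalRI p). Qed.

Lemma bounded_evalRI p : exists M : R, 0 <= M /\ forall z,
  `|z.1| <= 2 -> `|z.2| <= 2 -> `|evalR p z| <= M /\ `|evalI p z| <= M.
Proof.
elim/bipoly_ind: p => [c|||p q [M [M0 hM]] [N [N0 hN]]|p q [M [M0 hM]] [N [N0 hN]]].
- exists (`|complex.Re c| + `|complex.Im c|); split; first by rewrite addr_ge0.
  by move=> z _ _; rewrite evalR_cstC evalI_cstC lerDl lerDr.
- by exists 2; split => // z; rewrite evalR_Z evalI_Z.
- by exists 2; split => // z; rewrite evalR_W evalI_W normrN.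
- exists (M + N); split; first exact: addr_ge0.
  move=> z z1 z2; have [h1 h2] := hM z z1 z2; have [h3 h4] := hN z z1 z2.
  by rewrite evalRD evalID; split; apply: (le_trans (ler_normD _ _)); exact: lerD.
- exists (M * N + M * N); split; first by rewrite addr_ge0// mulr_ge0.
  move=> z z1 z2; have [h1 h2] := hM z z1 z2; have [h3 h4] := hN z z1 z2.
  rewrite evalRM evalIM; split.
    by apply: (le_trans (ler_normB _ _)); rewrite !normrM; apply: lerD; exact: ler_pM.
  by apply: (le_trans (ler_normD _ _)); rewrite !normrM; apply: lerD; exact: ler_pM.
Qed.

Definition dP (x y : R) : R :=
  4^-1 - 3 / 2 * (x ^+ 2 + y ^+ 2) - 3 / 4 * (x ^+ 2 + y ^+ 2) ^+ 2
  + 2 * (x ^+ 3 - 3 * x * y ^+ 2).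

Lemma evalR_detGamma z : evalR detGamma z = dP z.1 z.2.
Proof.
rewrite /detGamma /GammaZZbar /GammaZZ /GammaZbarZbar !expr2.
rewrite !(evalR1, evalI1, evalR_realC, evalI_realC, evalR_Z, evalI_Z,
  evalR_W, evalI_W, evalRB, evalIB, evalRM, evalIM).
by rewrite /dP; field.
Qed.

Lemma evalI_detGamma z : evalI detGamma z = 0.
Proof.
rewrite /detGamma /GammaZZbar /GammaZZ /GammaZbarZbar !expr2.
rewrite !(evalR1, evalI1, evalR_realC, evalI_realC, evalR_Z, evalI_Z,
  evalR_W, evalI_W, evalRB, evalIB, evalRM, evalIM).
by field.
Qed.

End EvalReal.

(** * The deltoid as the domain where [dP] is positive *)

Section Geometry.
Variable R : realType.
Implicit Types (x y s t : R) (z : R * R).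

(** With a = |z|^2 and b = Re z^3, [dP] is 2 b - g for g = 3/2 a + 3/4 a^2 - 1/4, and b^2 <= a^3.
    The zeros a = 1 and a = 1/9 of g^2 - 4 a^3 are the circumscribed and inscribed circles of the
    deltoid. *)
Lemma dP_identity x y :
  (3 / 2 * (x ^+ 2 + y ^+ 2) + 3 / 4 * (x ^+ 2 + y ^+ 2) ^+ 2 - 4^-1) ^+ 2
  - 4 * (x ^+ 2 + y ^+ 2) ^+ 3
  = 9 / 16 * (x ^+ 2 + y ^+ 2 - 1) ^+ 3 * (x ^+ 2 + y ^+ 2 - 9^-1).
Proof. by field. Qed.

Lemma dP_disc x y : 0 <= dP x y -> x ^+ 2 + y ^+ 2 <= 1.
Proof.
rewrite leNgt => h; rewrite leNgt; apply/negP => a1; move: h; apply/negP; rewrite negbK.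
have := dP_identity x y; rewrite /dP.
(* The difference of the two sides is the square of Im z^3. *)
have cube : (x ^+ 3 - 3 * x * y ^+ 2) ^+ 2 <= (x ^+ 2 + y ^+ 2) ^+ 3.
  rewrite -subr_ge0 (_ : _ - _ = (3 * x ^+ 2 * y - y ^+ 3) ^+ 2) ?sqr_ge0//; ring.
move: cube a1; set a := x ^+ 2 + y ^+ 2; set b := x ^+ 3 - _ => cube a1 e.
have pos : 0 < 9 / 16 * (a - 1) ^+ 3 * (a - 9^-1).
  by rewrite !mulr_gt0 ?divr_gt0 ?exprn_gt0 ?subr_gt0// (lt_trans _ a1)// invf_lt1 ?ltr1n.
set g := 3 / 2 * a + 3 / 4 * a ^+ 2 - 4^-1 in e.
have g0 : 0 < g by rewrite /g; nra.
have bg : (2 * b) ^+ 2 < g ^+ 2.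
  rewrite -subr_gt0; apply: (lt_le_trans pos); rewrite -e; nra.
have : 2 * b < g.
  rewrite ltNge; apply/negP => gb; move: bg; rewrite ltNge.
  by rewrite (@lerXn2r _ 2) ?nnegrE// ?ltW// (lt_le_trans g0).
rewrite /g; lra.
Qed.

(** The closed deltoid is star-shaped about 0, and the shrunk point is interior. Subtracting s^3
    [dP x y] leaves a multiple of 1 - s whose cofactor is positive because |z| <= 1. *)
Lemma dP_star x y s : 0 <= dP x y -> 0 <= s < 1 -> 0 < dP (s * x) (s * y).
Proof.
move=> h /andP[s0 s1]; have a1 := dP_disc h.
have a0 : 0 <= x ^+ 2 + y ^+ 2 by rewrite addr_ge0// sqr_ge0.
have -> : dP (s * x) (s * y) = s ^+ 3 * dP x y + (1 - s) *
   (4^-1 * (1 + s + s ^+ 2) - 3 / 2 * s ^+ 2 * (x ^+ 2 + y ^+ 2)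
    + 3 / 4 * s ^+ 3 * (x ^+ 2 + y ^+ 2) ^+ 2) by rewrite /dP; field.
apply: ltr_wpDl; first by rewrite mulr_ge0// exprn_ge0.
apply: mulr_gt0; first by rewrite subr_gt0.
move: a0 a1; set a := x ^+ 2 + y ^+ 2 => a0 a1.
(* The first term on the right is the value at a = 1; the second carries the factor 1 - a. *)
have -> : 4^-1 * (1 + s + s ^+ 2) - 3 / 2 * s ^+ 2 * a + 3 / 4 * s ^+ 3 * a ^+ 2 =
  4^-1 * (1 - s) ^+ 2 * (1 + 3 * s)
  + 3 / 4 * s ^+ 2 * (1 - a) * ((1 - s) + (1 - s * a)) by field.
apply: ltr_pwDl.
  by rewrite !mulr_gt0 ?invr_gt0 ?exprn_gt0 ?subr_gt0// ltr_pwDl// mulr_ge0.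
have sa : s * a <= 1 by rewrite mulr_ile1// ltW.
by rewrite !mulr_ge0 ?exprn_ge0 ?subr_ge0// addr_ge0 ?subr_ge0// ltW.
Qed.

Lemma dP00 : dP 0 0 = 4^-1 :> R.
Proof. rewrite /dP; ring. Qed.

Lemma curve_dP0 z : deltoid_curve z -> dP z.1 z.2 = 0.
Proof.
move=> [t _ <-] /=.
have -> : 2 * t = t + t by ring.
have := cos2Dsin2 t; rewrite cosD sinD.
move: (cos t) (sin t) => c s cs.
have s2 : s ^+ 2 = 1 - c ^+ 2 by rewrite -cs; ring.
have -> : c * c - s * s = 2 * c ^+ 2 - 1 by rewrite -!expr2 s2; ring.
rewrite /dP.
have -> : (3^-1 * (2 * s - (s * c + c * s))) ^+ 2 = 4 / 9 * (1 - c) ^+ 2 * s ^+ 2 by field.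
rewrite s2; by field.
Qed.

Lemma unit_circle c s : c ^+ 2 + s ^+ 2 = 1 -> exists t, cos t = c /\ sin t = s.
Proof.
move=> cs.
have c1 : -1 <= c <= 1.
  have : c ^+ 2 <= 1 by rewrite -cs lerDl sqr_ge0.
  by rewrite -ler_norml -[1 in X in _ -> X](sqrtr1 R) -sqrtr_sqr => h; rewrite ler_wsqrtr.
have ca : cos (acos c) = c by rewrite acosK// in_itv.
have sa : sin (acos c) = `|s|.
  by rewrite sin_acos// -sqrtr_sqr; congr Num.sqrt; rewrite -cs; ring.
have [s0|s0] := leP 0 s.
  by exists (acos c); rewrite ca sa ger0_norm.
by exists (- acos c); rewrite cosN sinN ca sa ltr0_norm// opprK.
Qed.

(** With g = Zbar - Z^2 and D = 1 - |z|^2, [dP] is D^2 / 4 - |g|^2. On its zero set u = 2 conj(g) /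
    D has modulus 1, and it is the parameter e^(it) of the curve Z = (2 u + u^-2) / 3. *)
Lemma dP0_curve z : dP z.1 z.2 = 0 -> deltoid_curve z.
Proof.
case: z => x y /= P0.
suff [c [s [cs xE yE]]] : exists c s, [/\ c ^+ 2 + s ^+ 2 = 1,
    x = 3^-1 * (2 * c + (c * c - s * s)) & y = 3^-1 * (2 * s - (s * c + c * s))].
  have [t [tc ts]] := unit_circle cs; exists t => //.
  by rewrite (_ : 2 * t = t + t) ?cosD ?sinD ?tc ?ts -?xE -?yE//; ring.
pose g1 := x - x ^+ 2 + y ^+ 2; pose g2 := - y - 2 * x * y.
pose D := 1 - x ^+ 2 - y ^+ 2.
have PD : dP x y = D ^+ 2 / 4 - (g1 ^+ 2 + g2 ^+ 2).
  by rewrite /dP /D /g1 /g2; field.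
(* [re] and [im] are the two parts of g^2 + D conj(g) - 3 Z |g|^2 = 4 Z [dP]; where [dP] vanishes
   and D does not, this says 3 Z = 2 u + u^-2. *)
have re : g1 ^+ 2 - g2 ^+ 2 + D * g1 - 3 * x * (g1 ^+ 2 + g2 ^+ 2) = 4 * x * dP x y.
  by rewrite /dP /D /g1 /g2; field.
have im : 2 * g1 * g2 - D * g2 - 3 * y * (g1 ^+ 2 + g2 ^+ 2) = 4 * y * dP x y.
  by rewrite /dP /D /g1 /g2; field.
have DD : D ^+ 2 = 4 * (g1 ^+ 2 + g2 ^+ 2).
  apply/eqP; rewrite -subr_eq0; apply/eqP.
  by transitivity (4 * dP x y); [rewrite PD; field | rewrite P0 mulr0].
rewrite P0 !mulr0 in re im.
(* D = 0 forces g = 0, so |z| = 1 and Zbar = Z^2: these are the cusps, where u = Z. *)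
have [D0|D0] := eqVneq D 0.
  have g0 : g1 ^+ 2 + g2 ^+ 2 = 0 by move: DD; rewrite D0; lra.
  have [/eqP h1 /eqP h2] : g1 == 0 /\ g2 == 0.
    by move/eqP: g0; rewrite paddr_eq0 ?sqr_ge0// !sqrf_eq0 => /andP[].
  exists x, y; split.
  - by move: D0; rewrite /D; lra.
  - by move: h1; rewrite /g1; lra.
  - by move: h2; rewrite /g2; lra.
have g0 : g1 ^+ 2 + g2 ^+ 2 != 0.
  by apply: contra_neq D0 => h; apply/eqP; rewrite -sqrf_eq0 DD h mulr0.
exists (2 * g1 / D), (- 2 * g2 / D); split.
- transitivity (4 * (g1 ^+ 2 + g2 ^+ 2) / D ^+ 2); first by field.
  by rewrite -DD mulfV// expf_neq0.
- apply: (mulIf (expf_neq0 2 D0)).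
  transitivity (3^-1 * (4 * D * g1 + 4 * (g1 ^+ 2 - g2 ^+ 2))); last by field.
  rewrite DD; apply/eqP; rewrite -subr_eq0; apply/eqP.
  by transitivity (- (4 / 3) * (g1 ^+ 2 - g2 ^+ 2 + D * g1 - 3 * x * (g1 ^+ 2 + g2 ^+ 2))); [field | rewrite re mulr0].
- apply: (mulIf (expf_neq0 2 D0)).
  transitivity (3^-1 * (- 4 * D * g2 + 8 * (g1 * g2))); last by field.
  rewrite DD; apply/eqP; rewrite -subr_eq0; apply/eqP.
  by transitivity (- (4 / 3) * (2 * g1 * g2 - D * g2 - 3 * y * (g1 ^+ 2 + g2 ^+ 2))); [field | rewrite im mulr0].
Qed.

Lemma continuous_dP : continuous (fun z : R * R => dP z.1 z.2).
Proof.
rewrite (_ : (fun z => _) = evalR detGamma); first exact: continuous_evalR.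
by apply/funext => z; rewrite evalR_detGamma.
Qed.

Lemma continuous_ray z : continuous (fun s => (s * z.1, s * z.2)).
Proof.
move=> s.
have h r : (fun u => u * r) u @[u --> s] --> s * r.
  by apply: cvgM; [exact: cvg_id | exact: cvg_cst].
exact: (cvg_pair (h z.1) (h z.2)).
Qed.

(** A connected set that contains 0 and avoids the curve keeps [dP] positive by the intermediate
    value theorem. Conversely, by [dP_star], the segment from 0 to a point with [dP] positive avoids
    the curve. *)
Lemma OmegaE : @Omega R = [set z | 0 < dP z.1 z.2].
Proof.
apply/seteqP; split => z /=.
  move=> zO; set A := connected_component (~` @deltoid_curve R) (0, 0).
  have cA : connected A by exact: component_connected.
  have nc w : A w -> dP w.1 w.2 <> 0.
    by move=> /connected_component_sub + /dP0_curve; exact.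
  have A0 : A (0, 0).
    apply: connected_component_refl => /curve_dP0 /= h.
    by have := dP00; rewrite h => /eqP; rewrite eq_sym invr_eq0 pnatr_eq0.
  rewrite ltNge; apply/negP => z0.
  have ci : connected ((fun w : R * R => dP w.1 w.2) @` A).
    by apply: connected_continuous_connected => //; exact/continuous_subspaceT/continuous_dP.
  have /connected_intervalP itv := ci.
  have [w Aw w0] : ((fun w : R * R => dP w.1 w.2) @` A) 0.
    apply: (itv (dP z.1 z.2) (dP 0 0)); [by exists z | by exists (0, 0) |].
    by rewrite z0 dP00 invr_ge0/= ler0n.
  exact: nc Aw w0.
move=> z0; set B := (fun s => (s * z.1, s * z.2)) @` `[0, 1].
have Bz : B z.
  by exists 1; [rewrite /= in_itv/= lexx ler01 | rewrite !mul1r -surjective_pairing].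
have B0 : B (0, 0).
  by exists 0; [rewrite /= in_itv/= lexx ler01 | rewrite !mul0r].
apply: (@connected_component_max _ _ B) => //.
- move=> w [s] /=; rewrite in_itv /= => /andP[s0 s1] <- /curve_dP0 /=.
  move: s1; rewrite le_eqVlt => /orP[/eqP->|s1].
    by rewrite !mul1r => h; move: z0; rewrite h ltxx.
  by have := @dP_star z.1 z.2 s (ltW z0); rewrite s0 s1 => /(_ isT) + h; rewrite h ltxx.
- apply: connected_continuous_connected; first exact: segment_connected.
  exact/continuous_subspaceT/continuous_ray.
Qed.

Lemma open_Omega : open (@Omega R).
Proof.
rewrite OmegaE (_ : [set z | _] = (fun z : R * R => dP z.1 z.2) @^-1` [set r | 0 < r]) //.
apply: open_comp; first by move=> *; exact: continuous_dP.
exact: open_gt.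
Qed.

(** A point with [dP] >= 0 is the limit of s z as s increases to 1, and these points are in Omega by
    [dP_star]. *)
Lemma closure_OmegaE : closure (@Omega R) = [set z | 0 <= dP z.1 z.2].
Proof.
apply/seteqP; split.
  have -> : [set z : R * R | 0 <= dP z.1 z.2] = closure [set z : R * R | 0 <= dP z.1 z.2].
    apply/closure_id.
    rewrite (_ : [set z | _] = (fun z : R * R => dP z.1 z.2) @^-1` [set r | 0 <= r]) //.
    apply: closed_comp; first by move=> *; exact: continuous_dP.
    exact: closed_ge.
  by apply: closure_subset; rewrite OmegaE => z /ltW.
move=> z z0 A Az.
have h : (fun s => (s * z.1, s * z.2)) s @[s --> 1^'-] --> z.
  apply: cvg_at_left_filter; rewrite [X in _ --> X](_ : z = (1 * z.1, 1 * z.2)).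
    exact: continuous_ray.
  by rewrite !mul1r -surjective_pairing.
have /= nA := h _ Az.
have : \forall s \near 1^'-, @Omega R (s * z.1, s * z.2).
  near=> s; rewrite OmegaE /=; apply: dP_star => //.
  by apply/andP; split; [near: s; exact: nbhs_left_ge | near: s; exact: nbhs_left_lt].
move=> nO.
have [s [As Os]] : exists s, A (s * z.1, s * z.2) /\ @Omega R (s * z.1, s * z.2).
  by apply: (@filter_ex _ 1^'-); apply: filterI.
by exists (s * z.1, s * z.2).
Unshelve. all: by end_near. Qed.

Lemma Omega_bounded z : closure (@Omega R) z -> `|z.1| <= 1 /\ `|z.2| <= 1.
Proof.
rewrite closure_OmegaE => /dP_disc h.
have sq t : t ^+ 2 <= 1 -> `|t| <= 1.
  by rewrite -[1 in X in _ -> X](sqrtr1 R) -sqrtr_sqr => h'; rewrite ler_wsqrtr.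
by split; apply: sq; apply: le_trans h; rewrite ?lerDl ?lerDr sqr_ge0.
Qed.

Lemma measurable_Omega : measurable (@Omega R).
Proof.
rewrite OmegaE (_ : [set z | _] = setT `&` (evalR detGamma) @^-1` `]0, +oo[); last first.
  by apply/seteqP; split => z /=; rewrite in_itv/= andbT evalR_detGamma; [split|case].
by apply: (@measurable_evalR R).
Qed.

Lemma measurable_closure_Omega : measurable (closure (@Omega R)).
Proof.
rewrite closure_OmegaE (_ : [set z | _] = setT `&` (evalR detGamma) @^-1` `[0, +oo[); last first.
  by apply/seteqP; split => z /=; rewrite in_itv/= andbT evalR_detGamma; [split|case].
by apply: (@measurable_evalR R).
Qed.

Lemma compact_closure_Omega : compact (closure (@Omega R)).
Proof.
apply: (@subclosed_compact _ _ (`[(-1 : R), 1]%classic `*` `[(-1 : R), 1]%classic)).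
- exact: closed_closure.
- by apply: compact_setX; exact: segment_compact.
- by move=> z /Omega_bounded[]; rewrite !ler_norml => h1 h2; split; rewrite /= in_itv.
Qed.

Lemma Omega_cusp : closure (@Omega R) (1, 0).
Proof.
have d0 : dP 1 0 = 0 :> R by rewrite /dP; field.
by rewrite closure_OmegaE /= d0.
Qed.

End Geometry.

(** * Integration by parts on the deltoid *)

Section Cutoff.
Variable R : realType.
Implicit Types (al b e t x y : R).

Definition tpos t : R := (t + `|t|) / 2.

Lemma tpos_ge0 t : 0 <= t -> tpos t = t.
Proof. by move=> t0; rewrite /tpos ger0_norm//; field. Qed.

Lemma tpos_le0 t : t <= 0 -> tpos t = 0.
Proof. by move=> t0; rewrite /tpos ler0_norm// subrr mul0r. Qed.

Lemma continuous_tpos : continuous tpos.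
Proof.
move=> t; apply: cvgM; last exact: cvg_cst.
by apply: cvgD; [exact: cvg_id | apply: cvg_norm; exact: cvg_id].
Qed.

(** The square makes the positive part C^1: the first-order remainder is at most h^2 even across
    0. *)
Lemma is_derive_tpos2 t : is_derive t 1 (fun s => tpos s ^+ 2) (2 * tpos t).
Proof.
have bound h : `|tpos (h + t) ^+ 2 - tpos t ^+ 2 - 2 * tpos t * h| <= h ^+ 2.
  have [t0|/ltW t0] := leP 0 t; have [s0|/ltW s0] := leP 0 (h + t).
  - rewrite !tpos_ge0// (_ : _ - _ = h ^+ 2); last ring.
    by rewrite ger0_norm ?sqr_ge0.
  - rewrite (tpos_ge0 t0) (tpos_le0 s0) expr0n /= sub0r ler_norml; apply/andP; split; nra.
  - rewrite (tpos_le0 t0) (tpos_ge0 s0) expr0n /= mulr0 mul0r !subr0.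
    by rewrite ger0_norm ?sqr_ge0//; nra.
  - by rewrite !tpos_le0// expr0n /= mulr0 mul0r !subr0 normr0 sqr_ge0.
have cv : h^-1 *: (((fun s => tpos s ^+ 2) \o shift t) (h *: 1) - tpos t ^+ 2) @[h --> 0^'] --> 2 * tpos t.
  apply/cvgrPdist_le => e e0; near=> h.
  have h0 : h != 0 by near: h; exact: nbhs_dnbhs_neq.
  have he : `|h| <= e by near: h; apply: dnbhs0_le.
  rewrite /= [h *: 1]mulr1 -[2 * tpos t](mulKf h0) -mulrBr.
  rewrite normrM normfV ler_pdivrMl ?normr_gt0// distrC.
  have := bound h; rewrite [h * _]mulrC => /le_trans; apply.
  by rewrite -(real_normK (num_real h)) expr2 ler_wpM2l.
by apply: DeriveDef; [apply/cvg_ex; exists (2 * tpos t) | apply/cvg_lim].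
Unshelve. all: by end_near. Qed.

(* A C^1 cutoff of t^al, vanishing for t <= 0. *)
Definition cutoff al e t : R := tpos t ^+ 2 * (t ^+ 2 + e) `^ (al / 2 - 1).

Definition dcutoff al e t : R :=
  tpos t ^+ 2 * ((al / 2 - 1) * (t ^+ 2 + e) `^ (al / 2 - 1 - 1) * (2 * t))
  + (t ^+ 2 + e) `^ (al / 2 - 1) * (2 * tpos t).

Lemma is_derive_sq_powR b e t : 0 < e ->
  is_derive t 1 (fun s => (s ^+ 2 + e) `^ b) (b * (t ^+ 2 + e) `^ (b - 1) * (2 * t)).
Proof.
move=> e0; have te : 0 < t ^+ 2 + e by rewrite ltr_wpDl// sqr_ge0.
have h1 : is_derive t 1 (fun s => s ^+ 2 + e) (2 * t).
  apply: is_derive_eq; rewrite /GRing.scale /=; ring.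
exact: (@is_derive1_comp R (fun u => u `^ b) (fun s => s ^+ 2 + e) t _ _ (is_derive1_powR _ te) h1).
Qed.

Lemma is_derive_cutoff al e t : 0 < e ->
  is_derive t 1 (cutoff al e) (dcutoff al e t).
Proof.
by move=> e0; exact: (is_deriveM (is_derive_tpos2 t) (is_derive_sq_powR (al / 2 - 1) t e0)).
Qed.

Lemma continuous_sq_powR b e : 0 < e -> continuous (fun s : R => (s ^+ 2 + e) `^ b).
Proof.
move=> e0 t; have [h _] := is_derive_sq_powR b t e0.
exact/differentiable_continuous/derivable1_diffP.
Qed.

Lemma continuous_cutoff al e : 0 < e -> continuous (cutoff al e).
Proof.
move=> e0 t; have [h _] := is_derive_cutoff al t e0.
exact/differentiable_continuous/derivable1_diffP.
Qed.

Lemma continuous_dcutoff al e : 0 < e -> continuous (dcutoff al e).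
Proof.
move=> e0 t; have ct : tpos s @[s --> t] --> tpos t by exact: continuous_tpos.
have cid : s @[s --> t] --> t by exact: cvg_id.
have c2 : (tpos s ^+ 2) @[s --> t] --> tpos t ^+ 2.
  by have [/derivable1_diffP/differentiable_continuous h _] := is_derive_tpos2 t; exact: h.
have cp b : ((s ^+ 2 + e) `^ b) @[s --> t] --> (t ^+ 2 + e) `^ b.
  exact: continuous_sq_powR.
have ck (k : R) (f : R -> R) (l : R) : f s @[s --> t] --> l -> (k * f s) @[s --> t] --> k * l.
  by move=> fl; apply: cvgM => //; exact: cvg_cst.
have cm (f g : R -> R) (a b : R) : f s @[s --> t] --> a -> g s @[s --> t] --> b ->
    (f s * g s) @[s --> t] --> a * b by move=> fa gb; exact: cvgM.
have h1 := ck 2 _ _ cid; have h2 := ck 2 _ _ ct.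
have h3 := ck (al / 2 - 1) _ _ (cp (al / 2 - 1 - 1)).
have h5 := cm _ _ _ _ c2 (cm _ _ _ _ h3 h1).
have h6 := cm _ _ _ _ (cp (al / 2 - 1)) h2.
by apply: cvgD; [exact: h5 | exact: h6].
Qed.

Lemma cutoff_le0 al e t : t <= 0 -> cutoff al e t = 0.
Proof. by move=> t0; rewrite /cutoff tpos_le0// expr0n mul0r. Qed.

Lemma dcutoff_le0 al e t : t <= 0 -> dcutoff al e t = 0.
Proof. by move=> t0; rewrite /dcutoff tpos_le0// expr0n mul0r !mulr0 addr0. Qed.

End Cutoff.

(** * Real partial derivatives of polynomials in Z and Zbar *)

Section EvalDerivative.
Variable R : realType.

Lemma is_derive_mul (f g : R -> R) (x df dg : R) :
  is_derive x 1 f df -> is_derive x 1 g dg ->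
  is_derive x 1 (fun t => f t * g t) (df * g x + f x * dg).
Proof.
move=> hf hg; have := is_deriveM hf hg.
by rewrite /GRing.scale /= (addrC _ (g x * df)) (mulrC (g x)).
Qed.

Lemma is_derive_mul_sub (f1 g1 f2 g2 : R -> R) (x a1 b1 a2 b2 : R) :
  is_derive x 1 f1 a1 -> is_derive x 1 g1 b1 ->
  is_derive x 1 f2 a2 -> is_derive x 1 g2 b2 ->
  is_derive x 1 (fun t => f1 t * g1 t - f2 t * g2 t)
    (a1 * g1 x - a2 * g2 x + (f1 x * b1 - f2 x * b2)).
Proof.
move=> h1 h2 h3 h4; rewrite addrACA -opprD.
exact: (is_deriveB (is_derive_mul h1 h2) (is_derive_mul h3 h4)).
Qed.

Lemma is_derive_mul_add (f1 g1 f2 g2 : R -> R) (x a1 b1 a2 b2 : R) :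
  is_derive x 1 f1 a1 -> is_derive x 1 g1 b1 ->
  is_derive x 1 f2 a2 -> is_derive x 1 g2 b2 ->
  is_derive x 1 (fun t => f1 t * g1 t + f2 t * g2 t)
    (a1 * g1 x + a2 * g2 x + (f1 x * b1 + f2 x * b2)).
Proof.
move=> h1 h2 h3 h4; rewrite addrACA.
exact: (is_deriveD (is_derive_mul h1 h2) (is_derive_mul h3 h4)).
Qed.

Local Notation B := {poly {poly R[i]}}.
Implicit Types (p q : B) (x y : R).

Definition dX p : B := dZ p + dZbar p.
Definition dY p : B := cstC (Complex 0 1) * (dZ p - dZbar p).

Lemma dXM p q : dX (p * q) = dX p * q + p * dX q.
Proof. by rewrite /dX !dE; ring. Qed.
Lemma dYM p q : dY (p * q) = dY p * q + p * dY q.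
Proof. by rewrite /dY !dE; ring. Qed.
Lemma dXD p q : dX (p + q) = dX p + dX q.
Proof. by rewrite /dX !raddfD /=; ring. Qed.
Lemma dYD p q : dY (p + q) = dY p + dY q.
Proof. by rewrite /dY !raddfD /=; ring. Qed.

Lemma is_derive_evalX p x y :
  is_derive x 1 (fun t => evalR p (t, y)) (evalR (dX p) (x, y)) /\
  is_derive x 1 (fun t => evalI p (t, y)) (evalI (dX p) (x, y)).
Proof.
elim/bipoly_ind: p => [c|||p q [p1 p2] [q1 q2]|p q [p1 p2] [q1 q2]].
- have -> : dX (cstC c) = realC 0 by rewrite /dX !dE addr0 realC0.
  rewrite evalR_realC evalI_realC; split.
    by under eq_fun do rewrite evalR_cstC; exact: is_derive_cst.
  by under eq_fun do rewrite evalI_cstC; exact: is_derive_cst.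
- have -> : dX vZ = realC 1 :> B by rewrite /dX !dE addr0 realC1.
  rewrite evalR_realC evalI_realC; split.
    by under eq_fun do rewrite evalR_Z /=; exact: is_derive_id.
  by under eq_fun do rewrite evalI_Z /=; exact: is_derive_cst.
- have -> : dX vZbar = realC 1 :> B by rewrite /dX !dE add0r realC1.
  rewrite evalR_realC evalI_realC; split.
    by under eq_fun do rewrite evalR_W /=; exact: is_derive_id.
  by under eq_fun do rewrite evalI_W /=; exact: is_derive_cst.
- rewrite dXD evalRD evalID; split.
    by under eq_fun do rewrite evalRD; exact: is_deriveD.
  by under eq_fun do rewrite evalID; exact: is_deriveD.
- rewrite dXM !evalRD !evalID !evalRM !evalIM; split.
    under eq_fun do rewrite evalRM.
    exact: (is_derive_mul_sub p1 q1 p2 q2).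
  under eq_fun do rewrite evalIM.
  exact: (is_derive_mul_add p1 q2 p2 q1).
Qed.

Lemma is_derive_evalY p x y :
  is_derive y 1 (fun t => evalR p (x, t)) (evalR (dY p) (x, y)) /\
  is_derive y 1 (fun t => evalI p (x, t)) (evalI (dY p) (x, y)).
Proof.
elim/bipoly_ind: p => [c|||p q [p1 p2] [q1 q2]|p q [p1 p2] [q1 q2]].
- have -> : dY (cstC c) = realC 0 by rewrite /dY !dE subrr mulr0 realC0.
  rewrite evalR_realC evalI_realC; split.
    by under eq_fun do rewrite evalR_cstC; exact: is_derive_cst.
  by under eq_fun do rewrite evalI_cstC; exact: is_derive_cst.
- have -> : dY vZ = cstC (Complex 0 1) :> B by rewrite /dY !dE subr0 mulr1.
  rewrite evalR_cstC evalI_cstC; split.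
    by under eq_fun do rewrite evalR_Z /=; exact: is_derive_cst.
  by under eq_fun do rewrite evalI_Z /=; exact: is_derive_id.
- have -> : dY vZbar = - cstC (Complex 0 1) :> B by rewrite /dY dZW dWW sub0r mulrN1.
  rewrite evalRN evalIN evalR_cstC evalI_cstC /= oppr0; split.
    by under eq_fun do rewrite evalR_W /=; exact: is_derive_cst.
  by under eq_fun do rewrite evalI_W /=; exact: is_deriveNid.
- rewrite dYD evalRD evalID; split.
    by under eq_fun do rewrite evalRD; exact: is_deriveD.
  by under eq_fun do rewrite evalID; exact: is_deriveD.
- rewrite dYM evalRD evalID (evalRM (dY p)) (evalRM p) (evalIM (dY p)) (evalIM p); split.
    under eq_fun do rewrite evalRM.
    exact: (is_derive_mul_sub p1 q1 p2 q2).
  under eq_fun do rewrite evalIM.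
  exact: (is_derive_mul_add p1 q2 p2 q1).
Qed.

End EvalDerivative.

(** * Vanishing of the integral of a compactly supported derivative *)

Section Stokes.
Variable R : realType.
Local Notation B := {poly {poly R[i]}}.
Local Notation leb := (@lebesgue_measure R).
Local Notation leb2 := (leb \x leb)%E.
(* Lebesgue measure carries its own copy of the Borel structure of R. *)
Local Notation RR := (measurableTypeR R * measurableTypeR R)%type.
Implicit Types (p q : B) (x y al e : R) (f : R * R -> R).

(** It contains the unit disc, hence the deltoid, with a margin, so the cutoffs vanish on its
    edges. *)
Definition box : set (R * R) := [set z | `|z.1| <= 2 /\ `|z.2| <= 2].

Lemma boxE : box = `[(-2 : R), 2] `*` `[(-2 : R), 2].
Proof. by apply/seteqP; split => z /=; rewrite /box /= !in_itv/= !ler_norml. Qed.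

Lemma measurable_box : measurable (box : set RR).
Proof. by rewrite boxE; exact: measurableX. Qed.

Lemma leb2_box : (leb2 box < +oo)%E.
Proof.
rewrite boxE product_measure1E//= lebesgue_measure_itv /= lte_fin.
by rewrite ifT; [rewrite -EFinB -EFinM ltry | lra].
Qed.

Lemma box_integrable f : measurable_fun (setT : set RR) f ->
  (exists M, forall z, box z -> `|f z| <= M) -> (forall z, ~ box z -> f z = 0) ->
  leb2.-integrable setT (EFin \o f).
Proof.
move=> mf [M fM] f0.
have -> : EFin \o f = (EFin \o f) \_ box.
  apply/funext => z; rewrite patchE; case: ifPn => // zb.
  by move: zb; rewrite notin_setE /= => /f0 ->.
rewrite -(integrable_mkcond _ measurable_box).
apply: measurable_bounded_integrable; [exact: measurable_box | exact: leb2_box | |].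
  exact: measurable_funTS.
exists M; split; first exact: num_real.
by move=> M' MM' z /fM /le_trans; apply; exact: ltW.
Qed.

Lemma slice_integral0 (F f : R -> R) : continuous f ->
  (forall x, is_derive x 1 F (f x)) -> F 2 = 0 -> F (-2) = 0 ->
  (forall x, ~ (`|x| <= 2) -> f x = 0) ->
  (\int[leb]_x (f x)%:E = 0)%E.
Proof.
move=> cf dF F2 Fm2 f0.
have cF : continuous F.
  by move=> x; have [/derivable1_diffP/differentiable_continuous h _] := dF x; exact: h.
have := @continuous_FTC2 R f F (-2) 2.
rewrite F2 Fm2 -EFinB subrr => FTC.
rewrite -[RHS]FTC; last 4 first.
- by lra.
- exact: continuous_subspaceT.
- split; first by move=> x _; have [] := dF x.
    exact/cvg_at_right_filter/cF.
  exact/cvg_at_left_filter/cF.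
- by move=> x _; rewrite derive1E; have [_ ->] := dF x.
rewrite [RHS]integral_mkcond; apply: eq_integral => x _; rewrite patchE; case: ifPn => //.
by rewrite notin_setE /= in_itv/= -ler_norml => /f0 ->.
Qed.

(** By the chain rule, the derivative along [d] of the cutoff of [dP] times [p], for [d] equal to
    [dX] or [dY]. *)
Definition flux al e (d : B -> B) p z : R :=
  dcutoff al e (dP z.1 z.2) * evalR (d detGamma) z * evalR p z
  + cutoff al e (dP z.1 z.2) * evalR (d p) z.

Lemma dP_far x y : 1 < x ^+ 2 + y ^+ 2 -> dP x y <= 0.
Proof.
move=> h; rewrite leNgt; apply/negP => /ltW/dP_disc.
by rewrite leNgt h.
Qed.

Lemma outside_box z : ~ box z -> dP z.1 z.2 <= 0.
Proof.
move=> nb; rewrite leNgt; apply/negP => P0; apply: nb.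
have /Omega_bounded[h1 h2] : closure (@Omega R) z by rewrite closure_OmegaE; exact: ltW.
by split; [apply: le_trans h1 _ | apply: le_trans h2 _]; rewrite ler1n.
Qed.

Lemma measurable_dP : measurable_fun (setT : set RR) (fun z : R * R => dP z.1 z.2).
Proof.
rewrite (_ : (fun z => _) = evalR detGamma); first exact: (@measurable_evalR R detGamma).
by apply/funext => z; rewrite evalR_detGamma.
Qed.

Lemma measurable_flux al e d p : 0 < e ->
  measurable_fun (setT : set RR) (flux al e d p).
Proof.
move=> e0; have md := measurable_dP.
have mc : measurable_fun (setT : set RR) (fun z : R * R => cutoff al e (dP z.1 z.2)).
  apply: (measurableT_comp (f := cutoff al e)) => //.
  by apply: continuous_measurable_fun; exact: continuous_cutoff.
have mdc : measurable_fun (setT : set RR) (fun z : R * R => dcutoff al e (dP z.1 z.2)).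
  apply: (measurableT_comp (f := dcutoff al e)) => //.
  by apply: continuous_measurable_fun; exact: continuous_dcutoff.
by apply: measurable_funD; repeat apply: measurable_funM => //; exact: (@measurable_evalR R).
Qed.

Lemma bounded_dP : exists M : R, forall z, box z -> `|dP z.1 z.2| <= M.
Proof.
have [M [_ h]] := bounded_evalRI (@detGamma R); exists M => z [z1 z2].
by rewrite -evalR_detGamma; case: (h z z1 z2).
Qed.

Lemma bounded_comp_dP (g : R -> R) : continuous g ->
  exists M : R, 0 <= M /\ forall z, box z -> `|g (dP z.1 z.2)| <= M.
Proof.
move=> cg; have [N hN] := bounded_dP.
have : compact (g @` `[- N, N]).
  by apply: continuous_compact; [exact: continuous_subspaceT | exact: segment_compact].
move=> /compact_bounded[M [_ hM]]; exists (`|M| + 1); split; first by rewrite addr_ge0.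
move=> z zb; apply: (hM (`|M| + 1)); first by rewrite ltr_pwDr// ler_norm.
by exists (dP z.1 z.2) => //; rewrite /= in_itv/= -ler_norml hN.
Qed.

Lemma integrable_flux al e d p : 0 < e -> leb2.-integrable setT (EFin \o flux al e d p).
Proof.
move=> e0; apply: box_integrable; first exact: measurable_flux.
- have [M1 [M10 h1]] := bounded_comp_dP (@continuous_dcutoff R al e e0).
  have [M2 [M20 h2]] := bounded_comp_dP (@continuous_cutoff R al e e0).
  have [N1 [N10 n1]] := bounded_evalRI (d (@detGamma R)).
  have [N2 [N20 n2]] := bounded_evalRI p.
  have [N3 [N30 n3]] := bounded_evalRI (d p).
  exists (M1 * N1 * N2 + M2 * N3) => z zb; have [z1 z2] := zb.
  have [r1 _] := n1 z z1 z2; have [r2 _] := n2 z z1 z2; have [r3 _] := n3 z z1 z2.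
  move: (h1 z zb) (h2 z zb); rewrite /flux.
  move: (dcutoff _ _ _) (cutoff _ _ _) => c c' hc hc'.
  rewrite (le_trans (ler_normD _ _))// !normrM; apply: lerD; last exact: ler_pM.
  by apply: ler_pM => //; exact: ler_pM.
- by move=> z /outside_box z0; rewrite /flux dcutoff_le0// cutoff_le0// !mul0r addr0.
Qed.

(** By Fubini: on each horizontal line the flux is the continuous derivative of a function vanishing
    at both ends of the box. *)
Lemma fluxX_integral0 al e p : 0 < e -> (\int[leb2]_z (flux al e (@dX R) p z)%:E = 0)%E.
Proof.
move=> e0; rewrite -(integral21_prod_meas1 (@integrable_flux al e (@dX R) p e0)).
rewrite -[RHS](@integral0 _ _ _ leb setT); apply: eq_integral => y _.
apply: (@slice_integral0 (fun x => cutoff al e (dP x y) * evalR p (x, y))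
  (fun x => flux al e (@dX R) p (x, y))).
- have cE q : continuous (fun x => evalR q (x, y)).
    by move=> x; have [[/derivable1_diffP/differentiable_continuous h _] _] := is_derive_evalX q x y; exact: h.
  have cd : continuous (fun x => dP x y).
    rewrite (_ : (fun x => _) = (fun x => evalR detGamma (x, y))); first exact: cE.
    by apply/funext => x; rewrite evalR_detGamma.
  move=> x; apply: cvgD; apply: cvgM; do ?exact: cE.
    apply: cvgM; last exact: cE.
    by apply: (@continuous_comp _ _ _ (fun x => dP x y)); [exact: cd | exact: continuous_dcutoff].
  by apply: (@continuous_comp _ _ _ (fun x => dP x y)); [exact: cd | exact: continuous_cutoff].
- move=> x; have h : is_derive x 1 (fun t => dP t y) (evalR (dX detGamma) (x, y)).
    rewrite (_ : (fun t => _) = (fun t => evalR detGamma (t, y))).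
      by have [] := is_derive_evalX (@detGamma R) x y.
    by apply/funext => t; rewrite evalR_detGamma.
  have hc := @is_derive1_comp R (cutoff al e) (fun t => dP t y) x _ _ (@is_derive_cutoff R al e _ e0) h.
  exact: (is_derive_mul hc (is_derive_evalX p x y).1).
- by rewrite cutoff_le0 ?mul0r//; apply: dP_far; have := sqr_ge0 y; lra.
- by rewrite cutoff_le0 ?mul0r//; apply: dP_far; have := sqr_ge0 y; lra.
- move=> x nx; have P0 : dP x y <= 0 by apply: (@outside_box (x, y)) => -[].
  by rewrite /flux dcutoff_le0// cutoff_le0// !mul0r addr0.
Qed.

Lemma fluxY_integral0 al e p : 0 < e -> (\int[leb2]_z (flux al e (@dY R) p z)%:E = 0)%E.
Proof.
move=> e0; rewrite -(integral12_prod_meas1 (@integrable_flux al e (@dY R) p e0)).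
rewrite -[RHS](@integral0 _ _ _ leb setT); apply: eq_integral => x _.
apply: (@slice_integral0 (fun y => cutoff al e (dP x y) * evalR p (x, y))
  (fun y => flux al e (@dY R) p (x, y))).
- have cE q : continuous (fun y => evalR q (x, y)).
    by move=> y; have [[/derivable1_diffP/differentiable_continuous h _] _] := is_derive_evalY q x y; exact: h.
  have cd : continuous (fun y => dP x y).
    rewrite (_ : (fun y => _) = (fun y => evalR detGamma (x, y))); first exact: cE.
    by apply/funext => y; rewrite evalR_detGamma.
  move=> y; apply: cvgD; apply: cvgM; do ?exact: cE.
    apply: cvgM; last exact: cE.
    by apply: (@continuous_comp _ _ _ (fun y => dP x y)); [exact: cd | exact: continuous_dcutoff].
  by apply: (@continuous_comp _ _ _ (fun y => dP x y)); [exact: cd | exact: continuous_cutoff].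
- move=> y; have h : is_derive y 1 (fun t => dP x t) (evalR (dY detGamma) (x, y)).
    rewrite (_ : (fun t => _) = (fun t => evalR detGamma (x, t))).
      by have [] := is_derive_evalY (@detGamma R) x y.
    by apply/funext => t; rewrite evalR_detGamma.
  have hc := @is_derive1_comp R (cutoff al e) (fun t => dP x t) y _ _ (@is_derive_cutoff R al e _ e0) h.
  exact: (is_derive_mul hc (is_derive_evalY p x y).1).
- by rewrite cutoff_le0 ?mul0r//; apply: dP_far; have := sqr_ge0 x; lra.
- by rewrite cutoff_le0 ?mul0r//; apply: dP_far; have := sqr_ge0 x; lra.
- move=> y ny; have P0 : dP x y <= 0 by apply: (@outside_box (x, y)) => -[].
  by rewrite /flux dcutoff_le0// cutoff_le0// !mul0r addr0.
Qed.

End Stokes.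

(** * Divergence form of the operator *)

Section Divergence.
Variable R : realType.
Local Notation B := {poly {poly R[i]}}.
Implicit Types (p q : B).

Lemma half2 : realC (5 / 2) = 2 + realC 2^-1 :> B.
Proof.
have -> : 5 / 2 = 2 + 2^-1 :> R by field.
by rewrite realCD; congr (_ + _); exact: (realC_nat R 2).
Qed.

Lemma dZ_GammaZZbar : dZ (@GammaZZbar R) = - (realC 2^-1 * vZbar).
Proof.
by rewrite /GammaZZbar dZM [dZ (realC _)]dZ_cstC dZB dZ1 dZM dZZ dZW; move: (realC _) => h; ring.
Qed.
Lemma dZbar_GammaZZbar : dZbar (@GammaZZbar R) = - (realC 2^-1 * vZ).
Proof.
by rewrite /GammaZZbar dZbarM [dZbar (realC _)]dZbar_cstC dZbarB dW1 dZbarM dWZ dWW; move: (realC _) => h; ring.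
Qed.
Lemma dZ_GammaZZ : dZ (@GammaZZ R) = - (2 * vZ).
Proof. by rewrite /GammaZZ dZB expr2 dZM !dE; ring. Qed.
Lemma dZbar_GammaZZ : dZbar (@GammaZZ R) = 1.
Proof. by rewrite /GammaZZ dZbarB expr2 dZbarM !dE; ring. Qed.
Lemma dZ_GammaWW : dZ (@GammaZbarZbar R) = 1.
Proof. by rewrite /GammaZbarZbar dZB expr2 dZM !dE; ring. Qed.
Lemma dZbar_GammaWW : dZbar (@GammaZbarZbar R) = - (2 * vZbar).
Proof. by rewrite /GammaZbarZbar dZbarB expr2 dZbarM !dE; ring. Qed.

(** The square field operator in its own normalisation, half of [Gamma2]. *)
Definition Gam p q : B := GammaZZ * dZ p * dZ q
  + GammaZZbar * (dZ p * dZbar q + dZbar p * dZ q)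
  + GammaZbarZbar * dZbar p * dZbar q.

Lemma GamC p q : Gam p q = Gam q p.
Proof. by rewrite /Gam; ring. Qed.

(* The deltoid is the zero set of detGamma, and Gamma(detGamma, -) vanishes on it. *)
Lemma Gam_detGamma p : Gam detGamma p = - (3 * detGamma * Euler p).
Proof.
have dz : dZ detGamma = - (2 * GammaZZbar * realC 2^-1 * vZbar)
    + 2 * vZ * GammaZbarZbar - GammaZZ :> B.
  rewrite /detGamma dZB expr2 2!dZM dZ_GammaZZbar dZ_GammaZZ dZ_GammaWW; move: (realC _) => h; ring.
have dw : dZbar detGamma = - (2 * GammaZZbar * realC 2^-1 * vZ)
    - GammaZbarZbar + 2 * vZbar * GammaZZ :> B.
  rewrite /detGamma dZbarB expr2 2!dZbarM dZbar_GammaZZbar dZbar_GammaZZ dZbar_GammaWW; move: (realC _) => h; ring.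
have half : (2^-1)%:C%C = 2^-1 :> R[i].
  by rewrite (fmorphV (real_complex R)) (rmorph_nat (real_complex R)).
have e1 : GammaZZ * dZ detGamma + GammaZZbar * dZbar detGamma = - (3 * detGamma * vZ) :> B.
  apply: ev_inj => x y; rewrite dz dw.
  rewrite !(ev_nat, ev_GammaZZbar, ev_detGamma, ev_realC, evZ, evW, evN, evB, evX, evM, evD).
  by rewrite half; field.
have e2 : GammaZZbar * dZ detGamma + GammaZbarZbar * dZbar detGamma = - (3 * detGamma * vZbar) :> B.
  apply: ev_inj => x y; rewrite dz dw.
  rewrite !(ev_nat, ev_GammaZZbar, ev_detGamma, ev_realC, evZ, evW, evN, evB, evX, evM, evD).
  by rewrite half; field.
transitivity ((GammaZZ * dZ detGamma + GammaZZbar * dZbar detGamma) * dZ p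
  + (GammaZZbar * dZ detGamma + GammaZbarZbar * dZbar detGamma) * dZbar p).
  by rewrite /Gam; ring.
by rewrite e1 e2 /Euler; ring.
Qed.

Lemma evalI_dX_detGamma z : evalI (dX detGamma) z = 0 :> R.
Proof.
have [_ h] := is_derive_evalX (@detGamma R) z.1 z.2.
move: h; under eq_fun do rewrite evalI_detGamma.
by case: z => x y /= [_ <-]; exact: derive_cst.
Qed.

Lemma evalI_dY_detGamma z : evalI (dY detGamma) z = 0 :> R.
Proof.
have [_ h] := is_derive_evalY (@detGamma R) z.1 z.2.
move: h; under eq_fun do rewrite evalI_detGamma.
by case: z => x y /= [_ <-]; exact: derive_cst.
Qed.

Lemma cstC_ii : cstC (Complex 0 1) * cstC (Complex 0 1) = -1 :> B.
Proof.
by rewrite -cstCM -[X in cstC X]expr2 (@sqr_i R) cstCN cstC1.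
Qed.

(* The real divergence of the complex field A1 d/dZ + A2 d/dZbar. *)
Lemma dX_dY_dZ (A1 A2 : B) :
  dX (realC 2^-1 * (A1 + A2)) + dY (realC 2^-1 * cstC (Complex 0 1) * (A2 - A1)) =
  dZ A1 + dZbar A2.
Proof.
have dXC c p : dX (cstC c * p) = cstC c * dX p.
  by rewrite /dX dZM dZbarM dZ_cstC dZbar_cstC !mul0r !add0r mulrDr.
have dYC c p : dY (cstC c * p) = cstC c * dY p.
  by rewrite /dY dZM dZbarM dZ_cstC dZbar_cstC !mul0r !add0r -mulrBr mulrCA.
have h2 := realC_half R; have ii := cstC_ii.
rewrite -mulrA !realC_cstC dXC 2!dYC -!realC_cstC /dX /dY dZB dZbarB (dZD A1) (dZbarD A1).
move: h2 ii; move: (realC _) (cstC _) => h i h2 ii.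
transitivity (h * (dZ A1 + dZ A2 + (dZbar A1 + dZbar A2))
  + (i * i) * h * (dZ A2 - dZ A1 - (dZbar A2 - dZbar A1))); first ring.
rewrite ii; transitivity ((h * 2) * (dZ A1 + dZbar A2)); first ring.
by rewrite h2 mul1r.
Qed.

Lemma dX_dY_grad p (A1 A2 : B) :
  dX p * (realC 2^-1 * (A1 + A2)) + dY p * (realC 2^-1 * cstC (Complex 0 1) * (A2 - A1)) =
  dZ p * A1 + dZbar p * A2.
Proof.
have h2 := realC_half R; have ii := cstC_ii; rewrite /dX /dY.
move: h2 ii; move: (realC _) (cstC _) => h i h2 ii.
transitivity ((dZ p + dZbar p) * (h * (A1 + A2))
   + (i * i) * (dZ p - dZbar p) * (h * (A2 - A1))); first ring.
rewrite ii; transitivity ((h * 2) * (dZ p * A1 + dZbar p * A2)); first ring.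
by rewrite h2 mul1r.
Qed.

Lemma div_Gam p q :
  dZ ((GammaZZ * dZ p + GammaZZbar * dZbar p) * q)
  + dZbar ((GammaZZbar * dZ p + GammaZbarZbar * dZbar p) * q)
  = Lop (5 / 2) p * q + Gam p q.
Proof.
rewrite !dZM !dZbarM !dZD !dZbarD 2!dZM 2!dZbarM dZ_GammaZZ dZ_GammaZZbar.
rewrite dZbar_GammaZZbar dZbar_GammaWW dZ_dZbarC /Lop /Gam half2.
move: (realC _) => h; ring.
Qed.

Local Notation leb := (@lebesgue_measure R).
Local Notation leb2 := (leb \x leb)%E.
Local Notation RR := (measurableTypeR R * measurableTypeR R)%type.
Implicit Types (al e t : R).

(** The divergence theorem for the field Gamma(grad p) times q and the cutoff. Differentiating the
    cutoff produces Gamma(detGamma, p), which [Gam_detGamma] turns into -3 detGamma [Euler p]; hence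
    [dcutoff] only occurs multiplied by [dP]. *)
Lemma stokes_cutoff al e p q : 0 < e ->
  (\int[leb2]_z (cutoff al e (dP z.1 z.2) * evalR (Lop (5 / 2) p * q + Gam p q) z
    - 3 * (dcutoff al e (dP z.1 z.2) * dP z.1 z.2) * evalR (Euler p * q) z)%:E = 0)%E.
Proof.
move=> e0.
pose A1 := (GammaZZ * dZ p + GammaZZbar * dZbar p) * q.
pose A2 := (GammaZZbar * dZ p + GammaZbarZbar * dZbar p) * q.
pose A := realC 2^-1 * (A1 + A2).
pose A' := realC 2^-1 * cstC (Complex 0 1) * (A2 - A1).
transitivity (\int[leb2]_z ((flux al e (@dX R) A z)%:E + (flux al e (@dY R) A' z)%:E))%E; last first.
  rewrite integralD; [|exact: measurableT|exact: integrable_flux|exact: integrable_flux].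
  by rewrite fluxX_integral0// fluxY_integral0// adde0.
apply: eq_integral => z _; rewrite -EFinD; congr EFin; rewrite /flux.
rewrite -div_Gam -/A1 -/A2 -(dX_dY_dZ A1 A2) -/A -/A' (evalRD (dX A)).
(* The gradient of [detGamma] paired with the field A, A' is Gamma(detGamma, p) q, a real multiple
   of [dP] times [Euler p * q]. *)
have key : dP z.1 z.2 * evalR (Euler p * q) z =
    - 3^-1 * (evalR (dX detGamma) z * evalR A z + evalR (dY detGamma) z * evalR A' z).
  have -> : evalR (dX detGamma) z * evalR A z + evalR (dY detGamma) z * evalR A' z =
      evalR (dX detGamma * A + dY detGamma * A') z.
    rewrite (evalRD (dX detGamma * A)) (evalRM (dX detGamma)) (evalRM (dY detGamma)).
    by rewrite evalI_dX_detGamma evalI_dY_detGamma !mul0r !subr0.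
  rewrite dX_dY_grad (_ : dZ _ * A1 + _ = Gam detGamma p * q); last first.
    by rewrite /A1 /A2 /Gam; ring.
  rewrite Gam_detGamma (_ : - (3 * detGamma * Euler p) * q = - (realC 3 * (detGamma * (Euler p * q)))); last first.
    by rewrite (realC_nat R 3); ring.
  rewrite evalRN evalR_realCM (evalRM detGamma) evalI_detGamma mul0r subr0 evalR_detGamma.
  by field.
move: key; move: (evalR (Euler p * q) z) (dP _ _) (cutoff _ _ _) (dcutoff _ _ _) => r d c1 c key.
have -> : 3 * (c * d) * r = 3 * c * (d * r) by ring.
rewrite key.
by move: (evalR (dX detGamma) z) (evalR (dY detGamma) z) (evalR A z) (evalR A' z)
  (evalR (dX A) z) (evalR (dY A') z) => *; field.
Qed.

End Divergence.

(** * Bounds and limits of the cutoffs as e tends to 0 *)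

Section CutoffLimit.
Variable R : realType.
Implicit Types (al b e t u : R).

(** It vanishes for t <= 0 even when al = 0, so that integrals over Omega become integrals over the
    plane. *)
Definition weight al t : R := if 0 < t then t `^ al else 0.

Lemma mul_powRB1 u b : 0 < u -> u * u `^ (b - 1) = u `^ b.
Proof.
move=> u0; rewrite -[X in X * _]powRr1 ?ltW// -powRD ?(gt_eqF u0) ?implybT//.
by congr (_ `^ _); ring.
Qed.

Lemma tpos_sq_le t : tpos t ^+ 2 <= t ^+ 2.
Proof.
have [t0|/ltW t0] := leP 0 t; first by rewrite tpos_ge0.
by rewrite tpos_le0// expr0n sqr_ge0.
Qed.

Lemma tpos_mul t : tpos t * t = tpos t ^+ 2.
Proof.
have [t0|/ltW t0] := leP 0 t; first by rewrite tpos_ge0// expr2.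
by rewrite tpos_le0// expr0n mul0r.
Qed.

(** The factor t makes up for the order al - 1 of the derivative: both terms on the right are of
    order al. *)
Lemma dcutoff_mul al e t : dcutoff al e t * t =
  (al - 2) * (tpos t ^+ 2 * t ^+ 2 * (t ^+ 2 + e) `^ (al / 2 - 1 - 1))
  + 2 * cutoff al e t.
Proof.
rewrite /dcutoff /cutoff -tpos_mul.
by move: (tpos t) (_ `^ (al / 2 - 1 - 1)) (_ `^ (al / 2 - 1)) => s p q; field.
Qed.

Lemma powR_shift_le al e t : 0 <= al -> 0 < e -> e <= 1 ->
  (t ^+ 2 + e) `^ (al / 2) <= (t ^+ 2 + 1) `^ (al / 2).
Proof.
move=> al0 e0 e1; have t0 := sqr_ge0 t.
by rewrite ge0_ler_powR ?divr_ge0// ?nnegrE ?addr_ge0// ?lerD2l// ltW.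
Qed.

(** As [tpos t ^+ 2] is at most t^2 + e, the cutoff is at most (t^2 + e)^(al/2). This increases with
    e because al >= 0, so e = 1 gives a bound free of e. *)
Lemma cutoff_bound al e t : 0 <= al -> 0 < e -> e <= 1 ->
  `|cutoff al e t| <= (t ^+ 2 + 1) `^ (al / 2).
Proof.
move=> al0 e0 e1; have u0 : 0 < t ^+ 2 + e by rewrite ltr_wpDl// sqr_ge0.
rewrite ger0_norm; last by rewrite mulr_ge0// ?sqr_ge0// powR_ge0.
apply: le_trans (powR_shift_le t al0 e0 e1).
rewrite -(mul_powRB1 (al / 2) u0) ler_wpM2r ?powR_ge0//.
by apply: (le_trans (tpos_sq_le t)); rewrite lerDl ltW.
Qed.

Lemma dcutoff_bound al e t : 0 <= al -> 0 < e -> e <= 1 ->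
  `|dcutoff al e t * t| <= (`|al - 2| + 2) * (t ^+ 2 + 1) `^ (al / 2).
Proof.
move=> al0 e0 e1; have u0 : 0 < t ^+ 2 + e by rewrite ltr_wpDl// sqr_ge0.
have := cutoff_bound t al0 e0 e1; rewrite dcutoff_mul; move: (cutoff _ _ _) => c cb.
rewrite (le_trans (ler_normD _ _))// normrM (normrM 2) mulrDl; apply: lerD; last first.
  by rewrite (ger0_norm (ler0n _ 2)) ler_wpM2l.
rewrite ler_wpM2l// 2!normrM.
apply: le_trans (powR_shift_le t al0 e0 e1).
rewrite -(mul_powRB1 (al / 2) u0) -(mul_powRB1 (al / 2 - 1) u0) mulrA.
rewrite (ger0_norm (powR_ge0 _ _)) !ger0_norm ?sqr_ge0// ler_wpM2r ?powR_ge0//.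
have tu : t ^+ 2 <= t ^+ 2 + e by rewrite lerDl ltW.
by apply: ler_pM; rewrite ?sqr_ge0// (le_trans (tpos_sq_le t)).
Qed.

Lemma cvg_powR_shift t b : 0 < t ->
  (t ^+ 2 + n.+1%:R^-1) `^ b @[n --> \oo] --> (t ^+ 2) `^ b.
Proof.
move=> t0; have t2 : 0 < t ^+ 2 by rewrite exprn_gt0.
have [/derivable1_diffP/differentiable_continuous h _] := is_derive1_powR b t2.
have hc : (t ^+ 2 + n.+1%:R^-1) @[n --> \oo] --> t ^+ 2.
  rewrite -[X in _ --> X]addr0; apply: cvgD; first exact: cvg_cst.
  exact: cvg_harmonic.
exact: (continuous_cvg _ h hc).
Qed.

Lemma sq_powR_half t al : 0 < t -> (t ^+ 2) `^ (al / 2) = t `^ al.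
Proof.
move=> t0; rewrite -(powR_mulrn 2) ?ltW// -powRrM; congr (_ `^ _).
by field.
Qed.

(** For t > 0 the limit is t^2 (t^2)^(al/2 - 1) = t^al. *)
Lemma cvg_cutoff al t : cutoff al n.+1%:R^-1 t @[n --> \oo] --> weight al t.
Proof.
rewrite /weight; case: ltP => t0; last first.
  by under eq_fun do rewrite cutoff_le0//; exact: cvg_cst.
rewrite -(sq_powR_half al t0) -(mul_powRB1 (al / 2)) ?exprn_gt0//.
rewrite /cutoff (tpos_ge0 (ltW t0)).
by apply: cvgM; [exact: cvg_cst | exact: cvg_powR_shift].
Qed.

Lemma cvg_dcutoff al t :
  (dcutoff al n.+1%:R^-1 t * t) @[n --> \oo] --> al * weight al t.
Proof.
have [t0|t0] := ltP 0 t; last first.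
  rewrite /weight ltNge t0 /= mulr0.
  by under eq_fun do rewrite dcutoff_le0// mul0r; exact: cvg_cst.
under eq_fun do rewrite dcutoff_mul.
have -> : al * weight al t = (al - 2) * weight al t + 2 * weight al t by ring.
apply: cvgD; (apply: cvgM; first exact: cvg_cst); last exact: cvg_cutoff.
rewrite /weight t0 -(sq_powR_half al t0) -(mul_powRB1 (al / 2)) ?exprn_gt0//.
rewrite -(mul_powRB1 (al / 2 - 1)) ?exprn_gt0// mulrA (tpos_ge0 (ltW t0)).
by apply: cvgM; [exact: cvg_cst | exact: cvg_powR_shift].
Qed.

End CutoffLimit.

Section Stokes.
Variable R : realType.
Local Notation B := {poly {poly R[i]}}.
Implicit Types (p q : B) (al e t : R).
Local Notation leb := (@lebesgue_measure R).
Local Notation leb2 := (leb \x leb)%E.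
Local Notation RR := (measurableTypeR R * measurableTypeR R)%type.

(** The limit e = 1/(n + 1) -> 0 of [stokes_cutoff]. The term with [dcutoff] tends to -3 al times
    the weighted Euler field, exactly the difference between the drifts at 5/2 + 3 al and at 5/2.
    The integrands are dominated by a constant on [box]. *)
Lemma stokes al l p q : 0 <= al -> l = 5 / 2 + 3 * al ->
  (\int[leb2]_z (weight al (dP z.1 z.2) * evalR (Lop l p * q + Gam p q) z)%:E = 0)%E.
Proof.
move=> al0 lE.
pose F (n : nat) (z : R * R) : R :=
  cutoff al n.+1%:R^-1 (dP z.1 z.2) * evalR (Lop (5 / 2) p * q + Gam p q) z
  - 3 * (dcutoff al n.+1%:R^-1 (dP z.1 z.2) * dP z.1 z.2) * evalR (Euler p * q) z.
pose G (z : R * R) : R := weight al (dP z.1 z.2) * evalR (Lop (5 / 2) p * q + Gam p q) z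
  - 3 * (al * weight al (dP z.1 z.2)) * evalR (Euler p * q) z.
have GE z : weight al (dP z.1 z.2) * evalR (Lop l p * q + Gam p q) z = G z.
  rewrite /G (_ : Lop l p * q + Gam p q =
    Lop (5 / 2) p * q + Gam p q - realC (3 * al) * (Euler p * q)); last first.
    rewrite (Lop_Euler l) (Lop_Euler (5 / 2)) lE.
    rewrite (_ : 5 / 2 + 3 * al - 1 = 5 / 2 - 1 + 3 * al); last ring.
    by rewrite (realCD (5 / 2 - 1)); move: (realC _) (realC _) => a b; ring.
  rewrite (evalRB (Lop _ _ * q + _)) evalR_realCM.
  by move: (evalR _ _) (evalR _ _) (weight _ _) => *; ring.
under eq_integral do rewrite GE.
have e0 n : 0 < n.+1%:R^-1 :> R by rewrite invr_gt0.
have e1 n : n.+1%:R^-1 <= 1 :> R by rewrite invf_le1// ler1n.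
have FG z : F ^~ z @ \oo --> G z.
  apply: cvgB; apply: cvgM; do ?exact: cvg_cst; first exact: cvg_cutoff.
  by apply: cvgM; [exact: cvg_cst | exact: cvg_dcutoff].
have [N0 hN0] := bounded_dP R.
have [N1 [N10 n1]] := bounded_evalRI (Lop (5 / 2) p * q + Gam p q).
have [N2 [N20 n2]] := bounded_evalRI (Euler p * q).
pose W := (N0 ^+ 2 + 1) `^ (al / 2).
pose M := W * N1 + 3 * ((`|al - 2| + 2) * W) * N2.
have FM n z : `|F n z| <= M * \1_(@box R) z.
  have [zb|nzb] := pselect (box z); last first.
    have P0 := outside_box nzb.
    by rewrite /F cutoff_le0// dcutoff_le0// !(mul0r, mulr0) subr0 normr0 indicE memNset// mulr0.
  rewrite indicE mem_set// mulr1.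
  have dPW : (dP z.1 z.2 ^+ 2 + 1) `^ (al / 2) <= W.
    rewrite ge0_ler_powR ?divr_ge0// ?nnegrE ?addr_ge0 ?sqr_ge0// lerD2r.
    by rewrite -[X in X <= _](real_normK (num_real _)) lerXn2r// ?nnegrE// ?hN0// (le_trans _ (hN0 z zb)).
  have c1 := le_trans (cutoff_bound (dP z.1 z.2) al0 (e0 n) (e1 n)) dPW.
  have c2 : `|dcutoff al n.+1%:R^-1 (dP z.1 z.2) * dP z.1 z.2| <= (`|al - 2| + 2) * W.
    apply: le_trans (dcutoff_bound (dP z.1 z.2) al0 (e0 n) (e1 n)) _.
    by rewrite ler_wpM2l// addr_ge0.
  have [z1 z2] := zb; have [r1 _] := n1 z z1 z2; have [r2 _] := n2 z z1 z2.
  move: c1 c2 r1 r2; rewrite /F /M.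
  move: (dcutoff _ _ _ * _) (cutoff _ _ _) (evalR _ _) (evalR _ _) => a b c d h1 h2 h3 h4.
  rewrite (le_trans (ler_normB _ _))// !normrM; apply: lerD; first exact: ler_pM.
  by rewrite (ger0_norm (ler0n _ 3)) ler_pM// ?mulr_ge0// ler_wpM2l.
have mF n : measurable_fun (setT : set RR) (F n).
  have md := @measurable_dP R.
  have mc : measurable_fun (setT : set RR) (fun z : R * R => cutoff al n.+1%:R^-1 (dP z.1 z.2)).
    apply: (measurableT_comp (f := cutoff al n.+1%:R^-1)) => //.
    by apply: continuous_measurable_fun; exact: continuous_cutoff.
  have mdc : measurable_fun (setT : set RR) (fun z : R * R => dcutoff al n.+1%:R^-1 (dP z.1 z.2)).
    apply: (measurableT_comp (f := dcutoff al n.+1%:R^-1)) => //.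
    by apply: continuous_measurable_fun; exact: continuous_dcutoff.
  apply: measurable_funB; apply: measurable_funM; do ?exact: (@measurable_evalR R) => //.
    exact: mc.
  by apply: measurable_funM => //; exact: measurable_funM.
have mG : measurable_fun (setT : set RR) G.
  apply: (@measurable_fun_cvg _ RR R setT F G) => // z _; exact: FG.
have iM : leb2.-integrable setT (EFin \o (fun z : R * R => M * \1_(@box R) z)).
  apply: box_integrable.
  - apply: measurable_funM; first exact: measurable_cst.
    by apply: measurable_indic; exact: (@measurable_box R).
  - by exists `|M| => z zb; rewrite indicE mem_set// mulr1.
  - by move=> z nz; rewrite indicE memNset// mulr0.
have d1 n : measurable_fun (setT : set RR) (fun z => (F n z)%:E) by exact/measurable_EFinP.
have d2 : measurable_fun (setT : set RR) (fun z => (G z)%:E) by exact/measurable_EFinP.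
have d3 : {ae leb2, forall z, setT z -> (fun n => (F n z)%:E) @ \oo --> (G z)%:E}.
  apply: aeW => z _; apply: cvg_EFin; last exact: FG.
  exact: nearW.
have d4 : {ae leb2, forall z n, setT z -> (`|(F n z)%:E| <= (M * \1_(@box R) z)%:E)%E}.
  by apply: aeW => z n _; rewrite lee_fin; exact: FM.
have [_ _] := dominated_convergence measurableT d1 d2 d3 iM d4.
under eq_fun do rewrite (@stokes_cutoff R al _ p q (e0 _)).
by move=> /(cvg_lim (@ereal_hausdorff R)) <-; exact: lim_cst.
Qed.

End Stokes.

(** * Symmetry of the operator in L2(mu) *)

Section Density.
Context d (T : measurableType d) (R : realType).
Variables (mu nu : {measure set T -> \bar R}) (w : T -> R).
Hypotheses (w0 : forall x, 0 <= w x) (mw : measurable_fun setT w).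
Hypothesis nuE : forall A, measurable A -> (nu A = \int[mu]_(x in A) (w x)%:E)%E.
Import HBNNSimple.

(** For simple functions this is the hypothesis on level sets; the rest is monotone convergence. *)
Lemma ge0_integral_density (f : T -> R) :
  (forall x, 0 <= f x) -> measurable_fun setT f ->
  (\int[nu]_x (f x)%:E = \int[mu]_x (w x * f x)%:E)%E.
Proof.
move=> f0 mf; have mEf : measurable_fun setT (EFin \o f) by exact/measurable_EFinP.
pose h := nnsfun_approx measurableT mEf.
have hf x : h n x @[n --> \oo] --> f x.
  apply: (@fine_cvg _ _ _ _ (EFin \o (h ^~ x))); apply: cvg_nnsfun_approx => //.
  by move=> y _; rewrite lee_fin.
have hnd x : {homo (fun n => h n x) : a b / (a <= b)%N >-> a <= b}.
  by move=> a b ab; exact/lefP/nd_nnsfun_approx.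
(* Used twice: for [nu] with v = 1 and for [mu] with v = w. *)
have mono (g : {measure set T -> \bar R}) (v : T -> R) : (forall x, 0 <= v x) ->
    measurable_fun setT v ->
    (\int[g]_x (v x * f x)%:E = lim (\int[g]_x (v x * h n x)%:E @[n --> \oo]))%E.
  move=> v0 mv; rewrite -monotone_convergence//.
  - apply: eq_integral => x _; apply/esym/cvg_lim => //; apply: cvg_EFin; first exact: nearW.
    by apply: cvgM; [exact: cvg_cst | exact: hf].
  - by move=> n; apply/measurable_EFinP; apply: measurable_funM.
  - by move=> n x _; rewrite lee_fin mulr_ge0.
  - by move=> x _ a b ab; rewrite lee_fin ler_wpM2l// hnd.
have := mono nu (cst 1) (fun=> ler01) (measurable_cst _).
under eq_integral do rewrite mul1r; move=> ->.
rewrite (mono mu w w0 mw); congr (lim (_ @ \oo)); apply/funext => n.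
have indE (y : R) (g : {measure set T -> \bar R}) (v : T -> R) : measurable_fun setT v ->
  (forall x, 0 <= v x) ->
  (\int[g]_x (v x * (y * \1_(h n @^-1` [set y]) x))%:E =
   y%:E * \int[g]_(x in h n @^-1` [set y]) (v x)%:E)%E.
  move=> mv v0; have [y0|y0] := leP 0 y; last first.
    rewrite (_ : h n @^-1` [set y] = set0) ?integral_set0 ?mule0.
      by rewrite integral0_eq// => x _; rewrite indicE in_set0 !mulr0.
    apply/seteqP; split => // x /= hy.
    by move: y0; rewrite -hy ltNge; have -> : 0 <= h n x by [].
  have mv' : measurable_fun setT ((EFin \o v) \_ (h n @^-1` [set y])).
    apply/(measurable_restrictT _ _).1 => //.
    by apply/measurable_EFinP; exact: measurable_funTS.
  have v0' x : setT x -> (0 <= ((EFin \o v) \_ (h n @^-1` [set y])) x)%E.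
    by rewrite patchE; case: ifP; rewrite ?lee_fin//= lee_fin.
  rewrite [in RHS]integral_mkcond -[RHS](ge0_integralZl g measurableT mv' v0')//.
  apply: eq_integral => x _; rewrite patchE indicE.
  by case: ifP => _; rewrite ?mulr1 ?mulr0 ?mule0// EFinM muleC.
have simp (g : {measure set T -> \bar R}) (v : T -> R) : measurable_fun setT v ->
  (forall x, 0 <= v x) ->
  (\int[g]_x (v x * h n x)%:E =
   \sum_(y \in range (h n)) y%:E * \int[g]_(x in h n @^-1` [set y]) (v x)%:E)%E.
  move=> mv v0.
  transitivity (\int[g]_x (\sum_(y \in range (h n)) (v x * (y * \1_(h n @^-1` [set y]) x))%:E))%E.
    apply: eq_integral => x _; rewrite fsumEFin//; congr EFin.
    by rewrite [h n x in LHS]fimfunE !fsbig_finite// big_distrr.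
  rewrite ge0_integral_fsum//; first by apply: eq_fsbigr => y _; exact: indE.
    by move=> y; apply/measurable_EFinP; apply: measurable_funM => //; apply: measurable_funM.
  by move=> y x _; rewrite lee_fin mulr_ge0// -lee_fin EFinM nnfun_muleindic_ge0.
have := simp nu (cst 1) (measurable_cst _) (fun=> ler01).
under eq_integral do rewrite mul1r; move=> ->.
rewrite simp//; apply: eq_fsbigr => y _; congr (_ * _)%E.
by rewrite -nuE// (eq_integral (cst 1%E))// integral_cst// mul1e.
Qed.

End Density.
Section DensityPushforward.
Context d d' (T : measurableType d) (T' : measurableType d') (R : realType).
Variables (mu : {measure set T -> \bar R}) (nu : {measure set T' -> \bar R}).
Variables (phi : T' -> T) (w : T -> R).
Hypotheses (w0 : forall x, 0 <= w x) (mw : measurable_fun setT w).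
Hypothesis mphi : measurable_fun setT phi.
Hypothesis nuE : forall A, measurable A ->
  (nu (phi @^-1` A) = \int[mu]_(x in A) (w x)%:E)%E.

(** Applied with [phi] the identity: the deltoid measure and Lebesgue measure live on two copies of
    the same sigma-algebra, and the map passes between them. Signs are handled by positive and
    negative parts. *)
Lemma integral_density (f : T -> R) : measurable_fun setT f ->
  (\int[nu]_x (f (phi x))%:E = \int[mu]_x (w x * f x)%:E)%E.
Proof.
move=> mf.
have pos (g : T -> R) : (forall x, 0 <= g x) -> measurable_fun setT g ->
    (\int[nu]_x (g (phi x))%:E = \int[mu]_x (w x * g x)%:E)%E.
  move=> g0 mg; rewrite -(ge0_integral_density w0 mw (nu := pushforward nu phi) nuE g0 mg).
  have mEg : measurable_fun setT (EFin \o g) by exact/measurable_EFinP.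
  by rewrite (ge0_integral_pushforward mphi nu measurableT mEg)// => x _; rewrite lee_fin.
rewrite integralE [RHS]integralE; congr (_ - _)%E.
- transitivity (\int[nu]_x (Num.max (f (phi x)) 0)%:E)%E.
    by apply: eq_integral => x _; rewrite funeposE EFin_max.
  rewrite (pos (fun x => Num.max (f x) 0)).
  + by apply: eq_integral => x _; rewrite funeposE -EFin_max maxr_pMr// mulr0.
  + by move=> x; rewrite le_max lexx orbT.
  + exact: measurable_maxr.
- transitivity (\int[nu]_x (Num.max (- f (phi x)) 0)%:E)%E.
    by apply: eq_integral => x _; rewrite funenegE EFin_max.
  rewrite (pos (fun x => Num.max (- f x) 0)).
  + apply: eq_integral => x _.
    by rewrite funenegE -EFinN -EFin_max maxr_pMr// mulr0 mulrN.
  + by move=> x; rewrite le_max lexx orbT.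
  + by apply: measurable_maxr => //; exact: measurableT_comp.
Qed.

End DensityPushforward.

Section DeltoidMeasure.
Context {R : realType}.
Variables (lambda : R) (mu : probability (R * R)%type R).
Hypotheses (hlambda : 5 / 2 <= lambda) (hmu : deltoid_measure lambda mu).
Local Notation leb := (@lebesgue_measure R).
Local Notation leb2 := (leb \x leb)%E.
Local Notation RR := (measurableTypeR R * measurableTypeR R)%type.
Local Notation B := {poly {poly R[i]}}.
Implicit Types (p q : B) (f : R * R -> R).

Let w (z : R * R) : R := weight (alpha lambda) (dP z.1 z.2).

Lemma alpha_ge0 : 0 <= alpha lambda.
Proof. by rewrite /alpha; move: hlambda; lra. Qed.

Lemma weight_ge0 (al t : R) : 0 <= weight al t.
Proof. by rewrite /weight; case: ifP => // _; exact: powR_ge0. Qed.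

Lemma measurable_weight : measurable_fun (setT : set RR) w.
Proof.
apply: (@measurable_fun_cvg _ RR R setT
  (fun n (z : R * R) => cutoff (alpha lambda) n.+1%:R^-1 (dP z.1 z.2))) => //.
- move=> n; apply: (measurableT_comp (f := cutoff (alpha lambda) n.+1%:R^-1)).
    by apply: continuous_measurable_fun; exact: continuous_cutoff.
  exact: (@measurable_dP R).
- by move=> z _; exact: cvg_cutoff.
Qed.

(** The sign of C is not part of [deltoid_measure]; it follows from the total mass 1. *)
Lemma mu_weight : exists C : R, 0 < C /\ forall f, measurable_fun (setT : set RR) f ->
  (\int[mu]_z (f z)%:E = \int[leb2]_z (C * w z * f z)%:E)%E.
Proof.
have [C hC] := hmu; exists C.
have hC' A : measurable (A : set RR) -> (mu A = \int[leb2]_(z in A) (C * w z)%:E)%E.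
  move=> mA; rewrite hC// [LHS]integral_mkcondr.
  apply: eq_integral => z _; rewrite patchE OmegaE evalR_detGamma /w /weight.
  by have [h|/negP h] := boolP (0 < dP z.1 z.2); [rewrite mem_set | rewrite memNset ?mulr0].
have C0 : 0 < C.
  rewrite ltNge; apply/negP => C0.
  have : (mu setT <= 0)%E.
    rewrite hC'; last exact: measurableT.
    have n0 (z : RR) : setT z -> (0 <= (- C * w z)%:E)%E by move=> _; rewrite lee_fin mulr_ge0 ?oppr_ge0//; exact: weight_ge0.
    rewrite (eq_integral (fun z : RR => - (- C * w z)%:E)%E); last first.
      by move=> z _; rewrite -EFinN mulNr opprK.
    rewrite (integral_ge0N _ n0) oppe_le0.
    exact: integral_ge0 n0.
  by rewrite probability_setT lee_fin ler10.
split => // f mf.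
apply: (@integral_density _ _ RR _ R leb2 mu id (fun z => C * w z)) => //.
- by move=> z; rewrite mulr_ge0 ?(ltW C0)//; exact: weight_ge0.
- by apply: measurable_funM => //; exact: measurable_weight.
Qed.

End DeltoidMeasure.

(** * The inner product on square-integrable functions, through representatives *)

Section L2Theory.
Context d (T : measurableType d) (R : realType) (mu : probability T R).
Implicit Types (f g h : T -> R).
Local Notation L2 := (Lfun mu 2%:E).
Local Notation N2 f := (Lnorm mu 2%:E (EFin \o f%R)%FUN).

Definition inner f g : R := \int[mu]_z (f z * g z).

Lemma L2_measurable f : f \in L2 -> measurable_fun setT f.
Proof. by move=> /sub_Lfun_mfun; rewrite inE. Qed.

Lemma L2_norm_lty f : f \in L2 -> (N2 f < +oo)%E.
Proof. by move=> /sub_Lfun_finLfun; rewrite inE. Qed.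

Lemma L2_norm_fin_num f : f \in L2 -> N2 f \is a fin_num.
Proof. by move=> /L2_norm_lty h; rewrite ge0_fin_numE// Lnorm_ge0. Qed.

Lemma L2_linear a f g : f \in L2 -> g \in L2 -> (a \*: f \+ g) \in L2.
Proof.
move=> fL gL; have [_ h] := @Lfun_submod_closed _ T R mu 2%:E (lee1n 2).
exact: (h a f g fL gL).
Qed.

Lemma L2_sub f g : f \in L2 -> g \in L2 -> (f \- g) \in L2.
Proof.
move=> fL gL; rewrite (_ : f \- g = (-1) \*: g \+ f); first exact: L2_linear.
by apply/funext => x /=; rewrite scaleN1r addrC.
Qed.

Lemma L2_cst a : (cst a : T -> R) \in L2.
Proof. exact: Lfun_cst. Qed.

Lemma L2_bounded f M : measurable_fun setT f ->
  {ae mu, forall z, `|f z| <= M} -> f \in L2.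
Proof.
move=> mf fM; rewrite inE; apply/andP; split; first by rewrite inE.
rewrite inE /= /finite_norm.
have M0 : {ae mu, forall z, `|f z| <= `|M|}.
  by move: fM; apply: filterS => z /le_trans; apply; exact: ler_norm.
rewrite unlock /Lnorm poweR_lty//=.
apply: (@le_lt_trans _ _ (\int[mu]_x (`|M| `^ 2)%:E)%E); last first.
  by apply: integrable_lty => //; exact: finite_measure_integrable_cst.
have mfp : measurable_fun setT (fun z => (`|f z| `^ 2)%:E).
  apply/measurable_EFinP; apply: (measurableT_comp (f := @powR R ^~ 2)) => //.
  exact: measurableT_comp.
have p0 (g : T -> R) z : setT z -> (0 <= (`|g z| `^ 2)%:E)%E by rewrite lee_fin powR_ge0.
have mM : measurable_fun (setT : set T) (fun z => (`|cst M z : R| `^ 2)%:E).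
  exact: (measurable_cst (`|M| `^ 2)%:E).
apply: (ae_ge0_le_integral measurableT (p0 f) mfp (p0 (cst M)) mM).
by move: M0; apply: filterS => z h _; rewrite lee_fin ge0_ler_powR// ?nnegrE.
Qed.

Lemma inner_integrable f g : f \in L2 -> g \in L2 ->
  mu.-integrable setT (EFin \o (fun z => f z * g z)).
Proof. by move=> fL gL; apply/Lfun1_integrable; exact: Lfun2_mul_Lfun1. Qed.

Lemma innerC f g : inner f g = inner g f.
Proof. by apply: eq_Rintegral => z _; rewrite mulrC. Qed.

Lemma inner_linear a f g h : f \in L2 -> g \in L2 -> h \in L2 ->
  inner (a \*: f \+ g) h = a * inner f h + inner g h.
Proof.
move=> fL gL hL; rewrite -RintegralZl ?inner_integrable// -RintegralD//.
- by apply: eq_Rintegral => z _ /=; rewrite mulrDl mulrA.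
- have := inner_integrable (L2_linear a fL (L2_cst 0)) hL.
  by congr (_.-integrable _ _); apply/funext => z /=; rewrite addr0 mulrA.
- exact: inner_integrable.
Qed.

Lemma L2_scale a f : f \in L2 -> (a \*: f) \in L2.
Proof.
move=> fL; rewrite (_ : a \*: f = a \*: f \+ cst 0).
  by apply: L2_linear => //; exact: L2_cst.
by apply/funext => z /=; rewrite addr0.
Qed.

Lemma inner_scale a f g : f \in L2 -> g \in L2 -> inner (a \*: f) g = a * inner f g.
Proof.
move=> fL gL; rewrite -RintegralZl ?inner_integrable//.
by apply: eq_Rintegral => z _ /=; rewrite mulrA.
Qed.

Lemma inner_comb a b f g h : f \in L2 -> g \in L2 -> h \in L2 ->
  inner (a \*: f \+ b \*: g) h = a * inner f h + b * inner g h.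
Proof. by move=> fL gL hL; rewrite inner_linear ?L2_scale// inner_scale. Qed.

Lemma inner_sub f g h : f \in L2 -> g \in L2 -> h \in L2 ->
  inner (f \- g) h = inner f h - inner g h.
Proof.
move=> fL gL hL; rewrite -RintegralB ?inner_integrable//.
by apply: eq_Rintegral => z _ /=; rewrite mulrBl.
Qed.

Lemma ae_eq_inner f g h : f \in L2 -> g \in L2 -> h \in L2 ->
  f = g %[ae mu] -> inner f h = inner g h.
Proof.
move=> fL gL hL fg; congr fine; apply: ae_eq_integral => //.
- by have /integrableP[] := inner_integrable fL hL.
- by have /integrableP[] := inner_integrable gL hL.
- by move: fg; apply: filterS => z /[apply] ->.
Qed.

Lemma inner_norm f : f \in L2 -> inner f f = fine (N2 f) ^+ 2.
Proof.
move=> fL; have := poweR_Lnorm mu (EFin \o f) (r := 2).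
rewrite pnatr_eq0 => /(_ isT) h.
rewrite -powR_mulrn ?fine_ge0 ?Lnorm_ge0// /inner /Rintegral.
transitivity (fine (\int[mu]_x (`|(EFin \o f) x| `^ 2)))%E.
  by congr fine; apply: eq_integral => z _ /=; rewrite powR_mulrn// real_normK ?num_real// expr2.
by rewrite -h -{1}(fineK (L2_norm_fin_num fL)).
Qed.

Lemma cauchy_schwarz f g : f \in L2 -> g \in L2 ->
  `|inner f g| <= fine (N2 f) * fine (N2 g).
Proof.
move=> fL gL; apply: le_trans (le_normr_Rintegral measurableT (inner_integrable fL gL)) _.
rewrite -fineM ?L2_norm_fin_num//; apply: fine_le.
- have /integrableP[mfg h] := inner_integrable fL gL.
  rewrite ge0_fin_numE; last by apply: integral_ge0 => z _; rewrite lee_fin.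
  exact: h.
- by rewrite fin_numM ?L2_norm_fin_num.
- have := @hoelder _ T R mu f g 2 2 (L2_measurable fL) (L2_measurable gL).
  by rewrite Lnorm1; apply => //; rewrite [RHS]splitr !div1r.
Qed.

Lemma inner_eq0 f : f \in L2 -> inner f f = 0 -> f = cst 0 %[ae mu].
Proof.
move=> fL; rewrite inner_norm// => /eqP; rewrite sqrf_eq0 => /eqP f0.
have : N2 f = 0%E by rewrite -(fineK (L2_norm_fin_num fL)) f0.
move=> /Lnorm_eq0_eq0 h.
have /h : measurable_fun setT (EFin \o f) by apply/measurable_EFinP; exact: L2_measurable.
have lt02 : (0 < 2%:E :> \bar R)%E by rewrite lte_fin.
by move=> /(_ lt02); apply: filterS => z /(_ I) [].
Qed.

Lemma cvg_inner (F : nat -> T -> R) f g : (forall j, F j \in L2) -> f \in L2 -> g \in L2 ->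
  N2 (F j \- f) @[j --> \oo] --> 0%E -> inner (F j) g @[j --> \oo] --> inner f g.
Proof.
move=> FL fL gL cF; apply/cvgrPdist_le => e e0.
have cF' : fine (N2 (F j \- f)) * fine (N2 g) @[j --> \oo] --> 0.
  rewrite -[X in _ --> X](mul0r (fine (N2 g))); apply: cvgM; last exact: cvg_cst.
  exact: (fine_cvg (a := 0) cF).
move/cvgrPdist_le: cF' => /(_ e e0); apply: filterS => j.
rewrite sub0r normrN => h; rewrite distrC -inner_sub//.
apply: le_trans h; apply: le_trans (ler_norm _).
by apply: cauchy_schwarz => //; exact: L2_sub.
Qed.

End L2Theory.

Section ConjugatePolynomial.
Variable R : realType.
Local Notation C := R[i].
Local Notation B := {poly {poly C}}.
Implicit Types (p q e : B) (c : C).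

(** The polynomial whose value at z is the conjugate of that of [p]. Eigenvectors obtained by the
    algebra have complex values; adding the conjugate makes them real-valued with the same
    eigenvalue. *)
Definition conjXY p : B := swapXY (map_poly (map_poly (@conjc R)) p).

Lemma conjXYD p q : conjXY (p + q) = conjXY p + conjXY q.
Proof. by rewrite /conjXY !raddfD. Qed.
Lemma conjXYM p q : conjXY (p * q) = conjXY p * conjXY q.
Proof. by rewrite /conjXY !rmorphM. Qed.
Lemma conjXYN p : conjXY (- p) = - conjXY p.
Proof. by rewrite /conjXY !raddfN. Qed.
Lemma conjXYB p q : conjXY (p - q) = conjXY p - conjXY q.
Proof. by rewrite conjXYD conjXYN. Qed.
Lemma conjXY1 : conjXY 1 = 1.
Proof. by rewrite /conjXY !rmorph1. Qed.
Lemma conjXY_cstC c : conjXY (cstC c) = cstC (conjc c).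
Proof. by rewrite /conjXY /cstC map_polyC /= map_polyC; exact: swap_cstC. Qed.
Lemma conjXYZ : conjXY vZ = vZbar.
Proof. by rewrite /conjXY map_polyX swapZ. Qed.
Lemma conjXYW : conjXY vZbar = vZ.
Proof. by rewrite /conjXY /vZbar map_polyC /= map_polyX swapW. Qed.
Lemma conjXY_realC (a : R) : conjXY (realC a) = realC a.
Proof. by rewrite realC_cstC conjXY_cstC /= oppr0. Qed.

Lemma dZ_conjXY p : dZ (conjXY p) = conjXY (dZbar p).
Proof.
rewrite /conjXY dZ_swap; congr swapXY; apply/polyP => i.
by rewrite /dZbar coef_map /= coef_map /= deriv_map coef_map /= coef_map.
Qed.

Lemma dZbar_conjXY p : dZbar (conjXY p) = conjXY (dZ p).
Proof. by rewrite /conjXY dZbar_swap; congr swapXY; rewrite /dZ deriv_map. Qed.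

Lemma conjXY_GammaZZ : conjXY (@GammaZZ R) = GammaZbarZbar.
Proof. by rewrite /GammaZZ conjXYB expr2 conjXYM conjXYZ conjXYW -expr2. Qed.
Lemma conjXY_GammaZbarZbar : conjXY (@GammaZbarZbar R) = GammaZZ.
Proof. by rewrite /GammaZbarZbar conjXYB expr2 conjXYM conjXYZ conjXYW -expr2. Qed.
Lemma conjXY_twoGammaZZbar : conjXY (2 * @GammaZZbar R) = 2 * GammaZZbar.
Proof. by rewrite twoGammaZZbar conjXYB conjXYM conjXY1 conjXYZ conjXYW (mulrC vZbar). Qed.

Lemma conjXY_Lop l p : conjXY (Lop l p) = Lop l (conjXY p).
Proof.
rewrite /Lop !dZ_conjXY !dZbar_conjXY !dZ_conjXY -dZ_dZbarC.
rewrite !conjXYB !conjXYD ![conjXY (_ * dZ _)]conjXYM ![conjXY (_ * dZbar _)]conjXYM.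
rewrite conjXY_GammaZZ conjXY_GammaZbarZbar conjXY_twoGammaZZbar.
rewrite !conjXYM conjXY_realC conjXYZ conjXYW; ring.
Qed.

Lemma evalC_conjXY p z : evalC (conjXY p) z = conjc (evalC p z).
Proof.
rewrite !evalCE; elim/bipoly_ind: p => [c|||p q hp hq|p q hp hq].
- by rewrite conjXY_cstC !ev_cstC.
- by rewrite conjXYZ evZ evW.
- by rewrite conjXYW evZ evW /= opprK.
- by rewrite conjXYD !evD hp hq rmorphD.
- by rewrite conjXYM !evM hp hq rmorphM.
Qed.

Lemma real_conjXY e : real_valued (e + conjXY e).
Proof.
move=> z; rewrite evalCE evD -!evalCE evalC_conjXY.
by case: (evalC e z) => a b /=; rewrite subrr.
Qed.

Lemma evalR_conjXY e z : evalR (conjXY e) z = evalR e z.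
Proof. by rewrite /evalR evalC_conjXY; case: (evalC e z). Qed.

Lemma Lop_real_part l (E : R) e : Lop l e = - (realC E * e) ->
  Lop l (e + conjXY e) = - (realC E * (e + conjXY e)).
Proof.
by move=> eE; rewrite LopD -conjXY_Lop eE conjXYN conjXYM conjXY_realC; ring.
Qed.

End ConjugatePolynomial.

(** * Symmetry of the operator on polynomials *)

Section DeltoidL2.
Context {R : realType}.
Variables (lambda : R) (mu : probability (R * R)%type R).
Hypotheses (hlambda : 5 / 2 <= lambda) (hmu : deltoid_measure lambda mu).
Local Notation B := {poly {poly R[i]}}.
Local Notation L2 := (Lfun mu 2%:E).
Implicit Types (p q : B) (f : R * R -> R).

Lemma ae_Omega : {ae mu, forall z, Omega z}.
Proof.
have [C hC] := hmu; exists (~` @Omega R); split => //.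
- by apply: measurableC; exact: measurable_Omega.
- rewrite hC ?setICl ?integral_set0//.
  by apply: measurableC; exact: measurable_Omega.
Qed.

Lemma L2_Omega_bounded f M : measurable_fun setT f ->
  (forall z, Omega z -> `|f z| <= M) -> f \in L2.
Proof. by move=> mf fM; apply: (L2_bounded (M := M)) => //; apply: filterS ae_Omega. Qed.

Lemma L2_evalR p : evalR p \in L2.
Proof.
have [M [_ hM]] := bounded_evalRI p.
apply: (L2_Omega_bounded (M := M)); first exact: measurable_evalR.
move=> z /subset_closure/Omega_bounded[z1 z2].
by case: (hM z) => //; [apply: le_trans z1 _ | apply: le_trans z2 _]; rewrite ler1n.
Qed.

Lemma Gam_realCM (c : R) p q : Gam (realC c * p) q = realC c * Gam p q.
Proof.
have dzr r : dZ (realC c * r) = realC c * dZ r.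
  by rewrite dZM [dZ (realC c)]dZ_cstC mul0r add0r.
have dwr r : dZbar (realC c * r) = realC c * dZbar r.
  by rewrite dZbarM [dZbar (realC c)]dZbar_cstC mul0r add0r.
by rewrite /Gam dzr dwr; ring.
Qed.

Lemma integral_Lop_Gam p q : \int[mu]_z evalR (Lop lambda p * q + Gam p q) z = 0.
Proof.
have [C [C0 hC]] := mu_weight hmu.
rewrite /Rintegral hC; last exact: (@measurable_evalR R).
have lE : lambda = 5 / 2 + 3 * alpha lambda by rewrite /alpha; field.
(* The constant C of the density is absorbed into the first polynomial. *)
rewrite -[RHS](congr1 fine (stokes (realC C * p) q (alpha_ge0 hlambda) lE)).
congr fine; apply: eq_integral => z _; congr EFin.
rewrite Lop_realCM Gam_realCM -(mulrA (realC C)) -mulrDr evalR_realCM.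
by rewrite mulrA (mulrC C).
Qed.

(** Both sides are minus the integral of the symmetric form [Gam p q]. Real values are needed
    because [evalR] is multiplicative only when one factor is real. *)
Lemma Lop_symmetric p q : real_valued p -> real_valued q ->
  inner mu (evalR (Lop lambda p)) (evalR q) = inner mu (evalR p) (evalR (Lop lambda q)).
Proof.
have IG r s : real_valued s ->
    inner mu (evalR (Lop lambda r)) (evalR s) = - \int[mu]_z evalR (Gam r s) z.
  move=> rs; apply/eqP; rewrite -addr_eq0; apply/eqP.
  rewrite -(integral_Lop_Gam r s) -RintegralD//.
  - by apply: eq_Rintegral => z _; rewrite (evalRD (_ * s)) (mulrC _ s) (evalR_realM _ _ rs) mulrC.
  - by apply: inner_integrable; exact: L2_evalR.
  - have := inner_integrable (L2_evalR (Gam r s)) (L2_cst mu 1).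
    by congr (_.-integrable _ _); apply/funext => z /=; rewrite mulr1.
by move=> rp rq; rewrite IG// innerC IG// GamC.
Qed.

End DeltoidL2.

(** * Orthogonality and totality of eigenvectors *)

Section Eigenspaces.
Context {R : realType}.
Variables (lambda : R) (mu : probability (R * R)%type R).
Hypotheses (hlambda : 5 / 2 <= lambda) (hmu : deltoid_measure lambda mu).
Local Notation B := {poly {poly R[i]}}.
Local Notation L2 := (Lfun mu 2%:E).
Implicit Types (p q r e : B) (f g : R * R -> R) (E F : R).

Let lambda_ge1 : 1 <= lambda.
Proof. by move: hlambda; lra. Qed.

Let L2p p : evalR p \in L2.
Proof. exact: L2_evalR hmu p. Qed.

Definition eigen E p := Lop lambda p = - (realC E * p).

(** The summand [cst 0] gives the shape a f + g in which the linearity of K and of [inner] is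
    stated. *)
Lemma evalR_eigen E p : eigen E p -> evalR (Lop lambda p) = (- E) \*: evalR p \+ cst 0.
Proof. by move=> ->; apply/funext => z /=; rewrite evalRN evalR_realCM addr0; apply/esym; exact: mulNr. Qed.

Lemma inner_eigen E p f : f \in L2 -> eigen E p ->
  inner mu (evalR (Lop lambda p)) f = - E * inner mu (evalR p) f.
Proof.
move=> fL pE; rewrite (evalR_eigen pE) inner_linear//; last exact: L2_cst.
rewrite [X in _ + X](_ : _ = 0) ?addr0// /inner.
by under eq_Rintegral do rewrite mul0r; rewrite Rintegral_cst// mul0r.
Qed.

Lemma distinct_scale_eq0 E F (x : R) : E != F -> - E * x = - F * x -> x = 0.
Proof.
move=> EF; rewrite !mulNr => /oppr_inj/eqP.
by rewrite -subr_eq0 -mulrBl mulf_eq0 subr_eq0 (negPf EF) => /eqP.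
Qed.

(** Symmetry holds for the approximating polynomials and passes to the limit: the product of g with
    q is both -E and -F times that of f with q. *)
Lemma L_graph_orth E F f g q : L_graph mu lambda f g -> g = (- E) \*: f %[ae mu] ->
  real_valued q -> eigen F q -> E != F -> inner mu f (evalR q) = 0.
Proof.
move=> [fL gL [p [rp pf pg]]] gf rq qF EF.
have c1 := cvg_inner (fun j => L2p (p j)) fL (L2p q) pf.
have c2 := cvg_inner (fun j => L2p (Lop lambda (p j))) gL (L2p q) pg.
have c3 : - F * inner mu (evalR (p j)) (evalR q) @[j --> \oo] --> inner mu g (evalR q).
  rewrite (_ : (fun j => _) = fun j => inner mu (evalR (Lop lambda (p j))) (evalR q)) //.
  by apply/funext => j; rewrite (Lop_symmetric hlambda hmu)// [RHS]innerC (inner_eigen _ qF)// [in RHS]innerC.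
have c4 : - F * inner mu (evalR (p j)) (evalR q) @[j --> \oo] --> - F * inner mu f (evalR q).
  by apply: cvgM; [exact: cvg_cst | exact: c1].
have : inner mu g (evalR q) = - F * inner mu f (evalR q).
  exact: cvg_unique c3 c4.
rewrite (ae_eq_inner gL (L2_scale (- E) fL) (L2p q) gf) inner_scale//.
exact: distinct_scale_eq0.
Qed.

Lemma eigen_orth E F p q : real_valued p -> real_valued q ->
  eigen E p -> eigen F q -> E != F -> inner mu (evalR p) (evalR q) = 0.
Proof.
move=> rp rq pE qF EF; have := Lop_symmetric hlambda hmu rp rq.
rewrite (inner_eigen (L2p q) pE) innerC (innerC _ _ (evalR (Lop lambda q))).
rewrite (inner_eigen (L2p p) qF) (innerC _ (evalR q)).
exact: distinct_scale_eq0.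
Qed.

(** Every polynomial is a sum of eigenvectors, hence orthogonal to f; as f is itself a limit of
    polynomials, it is orthogonal to itself. *)
Lemma eigen_total f (p : nat -> B) : f \in L2 ->
  norm2 mu (evalR (p j) \- f) @[j --> \oo] --> 0%E ->
  (forall E r, real_valued r -> eigen E r -> inner mu f (evalR r) = 0) ->
  f = cst 0 %[ae mu].
Proof.
move=> fL pf fr; apply: inner_eq0 => //.
have f0 q : inner mu f (evalR q) = 0.
  elim: (eigen_span_all lambda_ge1 q) => [|{}q1 q2 _ h1 _ h2|E e eE _].
  - apply: (fr 0); first by move=> z; rewrite evalCE ev0.
    by rewrite /eigen -[0 in LHS](mulr0 (cstC 0)) Lop_cstM mulr0 mul0r oppr0.
  - rewrite innerC (_ : evalR _ = 1 \*: evalR q1 \+ evalR q2); last first.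
      by apply/funext => z /=; rewrite evalRD scale1r.
    by rewrite inner_linear// !(innerC _ _ f) h1 h2 mulr0 addr0.
  (* The eigenvector e may be complex; e + [conjXY e] is real and its [evalR] is twice that of e. *)
  - have := fr E _ (real_conjXY e) (Lop_real_part eE).
    rewrite innerC (_ : evalR _ = 1 \*: evalR e \+ evalR e); last first.
      by apply/funext => z /=; rewrite evalRD evalR_conjXY scale1r.
    rewrite inner_linear// mul1r innerC => /eqP.
    by rewrite -mulr2n mulrn_eq0 => /eqP.
have := cvg_inner (fun j => L2p (p j)) fL fL pf.
under eq_fun do rewrite innerC f0.
by move=> h; rewrite -(cvg_unique (@Rhausdorff R) h (cvg_cst 0)).
Qed.

Lemma real1 : real_valued (1 : B).
Proof. by move=> z; rewrite evalCE ev1. Qed.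

Lemma eigen1 : eigen 0 (1 : B).
Proof.
have d0 : dZ (0 : B) = 0 by exact: deriv0.
have w0 : dZbar (0 : B) = 0 by rewrite dZbarE (raddf0 (@swapXY R[i])) d0 (raddf0 (@swapXY R[i])).
rewrite /eigen /Lop dZ1 dW1 d0 w0 realC0 mul0r oppr0.
move: GammaZZ (2 * GammaZZbar) GammaZbarZbar (_ * vZ) (_ * vZbar) => a b c x y.
by rewrite !mulr0 !subr0 !addr0.
Qed.

Lemma integral_eigen E e : eigen E e -> E != 0 -> \int[mu]_z evalR e z = 0.
Proof.
move=> eE E0; have := eigen_orth (real_conjXY e) real1 (Lop_real_part eE) eigen1 E0.
have int_e : mu.-integrable setT (EFin \o evalR e).
  have := inner_integrable (L2p e) (L2_cst mu 1).
  by congr (_.-integrable _ _); apply/funext => z /=; rewrite mulr1.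
rewrite (_ : inner _ _ _ = \int[mu]_z (2 * evalR e z)).
  by rewrite RintegralZl// => /eqP; rewrite mulf_eq0 pnatr_eq0 => /eqP.
by apply: eq_Rintegral => z _; rewrite evalRD evalR_conjXY evalR1 mulr1 mulr2n mulrDl mul1r.
Qed.

(** Invariance of mu under conjugation, obtained spectrally: an eigenvector with nonzero eigenvalue
    is orthogonal to 1, as is its swap, and those with eigenvalue 0 in [eigen_span] are
    symmetric. *)
Lemma integral_swap p : \int[mu]_z evalR (swapXY p) z = \int[mu]_z evalR p z.
Proof.
have RD q1 q2 : \int[mu]_z evalR (q1 + q2) z =
    \int[mu]_z evalR q1 z + \int[mu]_z evalR q2 z.
  have int_q q : mu.-integrable setT (EFin \o evalR q).
    have := inner_integrable (L2p q) (L2_cst mu 1).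
    by congr (_.-integrable _ _); apply/funext => z /=; rewrite mulr1.
  by rewrite -RintegralD//; apply: eq_Rintegral => z _; rewrite evalRD.
elim: (eigen_span_all lambda_ge1 p) => [|{}q1 q2 _ h1 _ h2|E e eE e0].
- by rewrite (raddf0 (@swapXY R[i])).
- by rewrite swapD !RD h1 h2.
- have [E0|E0] := eqVneq E 0; first by rewrite e0.
  rewrite !(integral_eigen _ E0)//.
  by rewrite /eigen -swap_Lop eE -mulrN swapM swap_realC (raddfN (@swapXY R[i])) mulrN.
Qed.

Lemma sym_antisym_orth p q : real_valued p -> symmetricZ p -> antisymmetricZ q ->
  inner mu (evalR p) (evalR q) = 0.
Proof.
move=> rp sp sq; have : \int[mu]_z evalR (p * q) z = - \int[mu]_z evalR (p * q) z.
  rewrite -{1}integral_swap swapM sp sq mulrN -[RHS]mulN1r -RintegralZl//.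
    by apply: eq_Rintegral => z _; rewrite evalRN mulN1r.
  have := inner_integrable (L2p (p * q)) (L2_cst mu 1).
  by congr (_.-integrable _ _); apply/funext => z /=; rewrite mulr1.
rewrite (_ : inner _ _ _ = \int[mu]_z evalR (p * q) z).
  by move: (\int[mu]_z _) => x; lra.
by apply: eq_Rintegral => z _; rewrite evalR_realM.
Qed.

End Eigenspaces.

(** * Action of K on the eigenspaces *)

Section OperatorOnEigenspaces.
Context {R : realType}.
Variables (lambda : R) (mu : probability (R * R)%type R).
Local Notation B := {poly {poly R[i]}}.
Variables (P Q : nat -> nat -> B) (K : (R * R -> R) -> (R * R -> R)).
Hypotheses (hlambda : 5 / 2 <= lambda) (hmu : deltoid_measure lambda mu).
Hypothesis hPQ : eigenbasis mu lambda P Q.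
Hypotheses (hKbounded : bounded_linear_L2 mu K) (hKsym : symmetric_L2 mu K).
Hypothesis hKL : commutes_with_L mu lambda K.
Local Notation L2 := (Lfun mu 2%:E).
Implicit Types (p q : B) (f g : R * R -> R) (E : R) (n k : nat).

Let L2p p : evalR p \in L2.
Proof. exact: L2_evalR hmu p. Qed.

Let KL2 f : f \in L2 -> K f \in L2.
Proof. by case: hKbounded => h _ _; exact: h. Qed.

Lemma real0 : real_valued (0 : B).
Proof. by move=> z; rewrite evalCE ev0. Qed.

Lemma eigen_0 E : eigen lambda E 0.
Proof. by rewrite /eigen -[0 in LHS](mulr0 (cstC 0)) Lop_cstM -/(cstC 0) mulr0 (raddf0 (@cstC R)) mul0r oppr0. Qed.

(** P and Q share their eigenvalue, so their orthogonality comes from their opposite symmetries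
    under conjugation. *)
Lemma eigenbasis_facts n k : [/\ real_valued (P n k), real_valued (Q n k),
  eigen lambda (eigval lambda n k) (P n k) & eigen lambda (eigval lambda n k) (Q n k)] /\
  [/\ inner mu (evalR (P n k)) (evalR (P n k)) = 1,
      inner mu (evalR (P n k)) (evalR (Q n k)) = 0 &
      Q n k = 0 \/ inner mu (evalR (Q n k)) (evalR (Q n k)) = 1].
Proof.
have [[rP _ nP eP] sP QP0 QP1] := hPQ n k.
have norm1 p : norm2 mu (evalR p) = 1%E -> inner mu (evalR p) (evalR p) = 1.
  by move=> p1; rewrite inner_norm// -/(norm2 mu (evalR p)) p1 expr1n.
have [nk|/eqP nk] := eqVneq n k.
  rewrite (QP0 nk); do !split => //; [exact: real0 | exact: eigen_0 | exact: norm1 | | by left].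
  by rewrite innerC /inner; under eq_Rintegral do rewrite evalR0 mul0r; rewrite Rintegral_cst// mul0r.
have [[rQ _ nQ eQ] aQ] := QP1 nk.
do !split => //; [exact: norm1 | exact: (sym_antisym_orth hlambda hmu) | right; exact: norm1].
Qed.

Lemma K_zero : K (cst 0) = cst 0 %[ae mu].
Proof.
have [_ hK _] := hKbounded; have := hK (-1) _ _ (L2_cst mu 0) (L2_cst mu 0).
rewrite (_ : _ \+ _ = cst 0); last by apply/funext => z /=; rewrite addr0 scaler0.
by apply: filterS => z /[apply] /= ->; rewrite scaleN1r addNr.
Qed.

Lemma K_eigen E p : eigen lambda E p ->
  K (evalR (Lop lambda p)) = (- E) \*: K (evalR p) %[ae mu].
Proof.
move=> pE; rewrite (evalR_eigen pE); have [_ hK _] := hKbounded.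
have := hK (- E) _ _ (L2p p) (L2_cst mu 0); have := K_zero.
by apply: filterS2 => z h0 h1 _; rewrite h1// /= h0// addr0.
Qed.

Lemma L_graph_poly p : real_valued p -> L_graph mu lambda (evalR p) (evalR (Lop lambda p)).
Proof.
move=> rp; split => //; exists (fun=> p).
have N0 f : norm2 mu (f \- f) = 0%E.
  rewrite /norm2 (_ : EFin \o _ = cst 0%E) ?Lnorm0//.
  by apply/funext => z /=; rewrite subrr.
by rewrite !N0; split => //; exact: cvg_cst.
Qed.

(** The difference between K p and its projection on P and Q is orthogonal to the other eigenvalues
    by [L_graph_orth] and to this one by [eigenspace_spanned]; then [eigen_total] makes it
    vanish. *)
Lemma K_eigenspace n k p : eigenspace_spanned lambda P Q n k -> real_valued p ->
  eigen lambda (eigval lambda n k) p ->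
  K (evalR p) = inner mu (K (evalR p)) (evalR (P n k)) \*: evalR (P n k)
    \+ inner mu (K (evalR p)) (evalR (Q n k)) \*: evalR (Q n k) %[ae mu].
Proof.
move=> span rp pE; set f := K (evalR p); set a := inner mu f _; set b := inner mu f _.
have [[rP rQ eP eQ] [PP PQ QQ]] := eigenbasis_facts n k.
pose s := realC a * P n k + realC b * Q n k.
have sE : a \*: evalR (P n k) \+ b \*: evalR (Q n k) = evalR s.
  by apply/funext => z /=; rewrite evalRD !evalR_realCM.
have fL : f \in L2 by exact: KL2.
(* Commutation, applied next, yields both the eigenvalue equation of K p for the closure and
   polynomials converging to K p. *)
have sL := L2p s.
have gr := hKL (L_graph_poly rp).
have [_ gL [p_ [rp_ cp_ _]]] := gr.
have sub0 : f \- evalR s = cst 0 %[ae mu].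
  apply: (eigen_total hlambda hmu (p := fun j => p_ j - s)); first exact: L2_sub.
    rewrite (_ : (fun j => _) = fun j => norm2 mu (evalR (p_ j) \- f))//.
    apply/funext => j; congr norm2; apply/funext => z /=.
    by rewrite evalRB; ring.
  move=> F r rr rF.
  have [EF|EF] := eqVneq (eigval lambda n k) F; last first.
    rewrite inner_sub// (L_graph_orth hlambda hmu gr (K_eigen pE) rr rF EF) -sE.
    by rewrite inner_comb// !(eigen_orth hlambda hmu _ rr _ rF EF)// !mulr0 addr0 subr0.
  have [c [d ->]] : exists c d, r = realC c * P n k + realC d * Q n k.
    by apply: span => //; rewrite /eigenvector EF.
  have -> : evalR (realC c * P n k + realC d * Q n k) =
      c \*: evalR (P n k) \+ d \*: evalR (Q n k).
    by apply/funext => z /=; rewrite evalRD !evalR_realCM.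
  rewrite innerC inner_comb ?L2_sub//; move: PQ; rewrite innerC => QP.
  have -> : inner mu (evalR (P n k)) (f \- evalR s) = 0.
    rewrite innerC inner_sub// -sE inner_comb// PP QP -/a.
    by rewrite mulr1 mulr0 addr0 subrr.
  have -> : inner mu (evalR (Q n k)) (f \- evalR s) = 0.
    rewrite innerC inner_sub// -sE inner_comb// (innerC _ (evalR (P n k))) QP -/b.
    (* If Q = 0, its coefficient b is the integral of 0. *)
    case: QQ => [Q0|->]; last by rewrite mulr0 add0r mulr1 subrr.
    have b0 : b = 0.
      rewrite /b /inner Q0; under eq_Rintegral do rewrite evalR0 mulr0.
      by rewrite Rintegral_cst// mul0r.
    by rewrite b0 mulr0 mul0r addr0 subr0.
  by rewrite !mulr0 addr0.
rewrite sE; move: sub0; apply: filterS => z /[apply] /= /eqP.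
by rewrite subr_eq0 => /eqP.
Qed.

Lemma evalR_cusp p : evalR p (1, 0) = complex.Re (ev 1 1 p).
Proof. by rewrite /evalR evalCE /= oppr0. Qed.

Lemma evalR_cusp_swap p : evalR (swapXY p) (1, 0) = evalR p (1, 0).
Proof. by rewrite !evalR_cusp -!evE horner2_swapXY. Qed.

Lemma Q_cusp n k : evalR (Q n k) (1, 0) = 0.
Proof.
have [_ _ Q0 QP1] := hPQ n k.
have [/Q0 ->|/eqP/QP1[_ aQ]] := eqVneq n k; first exact: evalR0.
by have := evalR_cusp_swap (Q n k); rewrite aQ evalRN; lra.
Qed.

Lemma P_cusp n k : eigenspace_spanned lambda P Q n k -> evalR (P n k) (1, 0) != 0.
Proof.
move=> span; apply/eqP => P0.
have l1 : 1 <= lambda by move: hlambda; lra.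
have [e [eE]] := eigenvector_pos l1 n k; rewrite -evalR_cusp.
have [c [d h]] := span _ (real_conjXY e) (Lop_real_part eE).
have := evalRD e (conjXY e) (1, 0).
rewrite h evalRD !evalR_realCM P0 Q_cusp evalR_conjXY.
by lra.
Qed.

End OperatorOnEigenspaces.

(** * Representation of positive functionals by measures *)

(** Serves to choose levels at which the content of a half plane does not jump. A nondecreasing
    function has only countably many discontinuities, and an interval of positive length is not
    countable. *)
Lemma right_continuity_point (R : realType) (G : R -> R) (a b : R) :
  {homo G : x y / x <= y} -> a < b ->
  exists c, a < c < b /\ forall e, 0 < e -> exists d, 0 < d /\ G (c + d) - G c <= e.
Proof.
move=> ndG ab; apply: contrapT => nc.
have disc c : c \in `]a, b[ -> discontinuity G c.
  move=> cab.
  have cr : cvg (G x @[x --> c^'+]).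
    apply: nondecreasing_at_right_is_cvgr; apply: nearW => x.
      by move=> y z _ _; exact: ndG.
    exists (G c) => _ /= [y + <-]; rewrite in_itv/= => /andP[cy _].
    by apply: ndG; exact: ltW.
  have cl : cvg (G x @[x --> c^'-]).
    apply: nondecreasing_at_left_is_cvgr; apply: nearW => x.
      by move=> y z _ _; exact: ndG.
    exists (G c) => _ /= [y + <-]; rewrite in_itv/= => /andP[_ cy].
    by apply: ndG; exact: ltW.
  split => //; apply/eqP => lr; apply: nc; exists c; split; first by move: cab; rewrite in_itv.
  (* If the one-sided limits at c agreed, the right limit would be at most G c and c would be a
     point of the desired kind. *)
  have lGc : lim (G x @[x --> c^'+]) <= G c.
    rewrite -lr; apply: limr_le => //; near=> x; apply: ndG.
    by apply: ltW; near: x; exact: nbhs_left_lt.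
  move=> e e0.
  have near_e : \forall x \near c^'+, G x <= G c + e.
    by apply: cvgr_le; [exact: cr | rewrite (le_lt_trans lGc)// ltrDl].
  have [x [cx Gx]] : exists x, c < x /\ G x <= G c + e.
    have near_c : \forall x \near c^'+, c < x by exact: nbhs_right_gt.
    by have [x [? ?]] := filter_ex (filterI near_c near_e); exists x.
  by exists (x - c); rewrite subr_gt0 cx (addrC c) subrK lerBlDl.
have : countable `]a, b[%classic.
  have := @discontinuity_countable R a b G (fun x y _ _ => @ndG x y).
  apply: sub_countable; apply: subset_card_le => c /= cab.
  by split => //; exact: disc.
move=> /countable_lebesgue_measure0; rewrite lebesgue_measure_itv/= lte_fin ab.
by move/eqP; rewrite -EFinB eqe subr_eq0 gt_eqF.
Unshelve. all: by end_near. Qed.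

Section PositiveFunctional.
Context {R : realType}.
Local Notation T := (R * R)%type.
Variables (F : set T) (L : (T -> R) -> R).
Implicit Types (f g : T -> R) (A B U X : set T) (c e : R).

Definition bounded_on f := measurable_fun setT f /\
  exists M, forall z, F z -> `|f z| <= M.

Hypothesis L_linear : forall a f g, bounded_on f -> bounded_on g ->
  L (fun z => a * f z + g z) = a * L f + L g.
Hypothesis L_ge0 : forall f, bounded_on f -> (forall z, F z -> 0 <= f z) -> 0 <= L f.
Hypothesis L_cst1 : L (cst 1) = 1.
Hypothesis cF : compact F.

Definition content A : R := L \1_A.

Lemma bounded_on_cst c : bounded_on (cst c).
Proof. by split; [exact: measurable_cst | exists `|c|]. Qed.

Lemma bounded_on_indic A : measurable A -> bounded_on \1_A.
Proof.
move=> mA; split; first exact: measurable_indic.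
by exists 1 => z _; rewrite indicE; case: (_ \in _); rewrite ?normr1 ?normr0.
Qed.

Lemma bounded_on_linear a f g : bounded_on f -> bounded_on g ->
  bounded_on (fun z => a * f z + g z).
Proof.
move=> [mf [M hM]] [mg [N hN]]; split.
  by apply: measurable_funD => //; apply: measurable_funM.
exists (`|a| * M + N) => z Fz; rewrite (le_trans (ler_normD _ _))// normrM.
by rewrite lerD ?hN// ler_wpM2l// hM.
Qed.

Lemma bounded_on_sum n (f : nat -> T -> R) : (forall k, bounded_on (f k)) ->
  bounded_on (fun z => \sum_(k < n) f k z).
Proof.
move=> bf; elim: n => [|n IH].
  rewrite (_ : (fun z => _) = cst 0); first exact: bounded_on_cst.
  by apply/funext => z; rewrite big_ord0.
rewrite (_ : (fun z => _) = fun z => 1 * (\sum_(k < n) f k z) + f n z).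
  exact: bounded_on_linear.
by apply/funext => z; rewrite big_ord_recr mul1r.
Qed.

Lemma L_le f g : bounded_on f -> bounded_on g -> (forall z, F z -> f z <= g z) -> L f <= L g.
Proof.
move=> bf bg fg; rewrite -subr_ge0.
have -> : L g - L f = L (fun z => -1 * f z + g z) by rewrite L_linear//; ring.
apply: L_ge0; first exact: bounded_on_linear.
by move=> z Fz; rewrite mulN1r addrC subr_ge0 fg.
Qed.

Lemma L_cst c : L (cst c) = c.
Proof.
have := L_linear (c - 1) (bounded_on_cst 1) (bounded_on_cst 1).
rewrite L_cst1 (_ : (fun z => _) = cst c) ?mulr1 ?subrK//.
by apply/funext => z /=; rewrite mulr1 subrK.
Qed.

Lemma L_sum n (f : nat -> T -> R) : (forall k, bounded_on (f k)) ->
  L (fun z => \sum_(k < n) f k z) = \sum_(k < n) L (f k).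
Proof.
move=> bf; elim: n => [|n IH].
  rewrite big_ord0 -[RHS](L_cst 0); congr L.
  by apply/funext => z; rewrite big_ord0.
rewrite big_ord_recr /= -IH -[X in X + _]mul1r -L_linear//; last exact: bounded_on_sum.
by congr L; apply/funext => z; rewrite big_ord_recr mul1r.
Qed.

Lemma content_ge0 A : measurable A -> 0 <= content A.
Proof. by move=> mA; apply: L_ge0; [exact: bounded_on_indic | move=> z _; rewrite indicE]. Qed.

Lemma content0 : content set0 = 0.
Proof. by rewrite /content indic0 L_cst. Qed.

Lemma contentT : content setT = 1.
Proof. by rewrite /content indicT L_cst. Qed.

(** The infinite value on the other sets forces the infimum over countable covers in [mu_ext] to be
    taken over open covers. *)
Definition open_content A : \bar R :=
  if `[< open A /\ measurable A >] then (content A)%:E else +oo%E.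

Lemma open_contentE A : open A -> measurable A -> open_content A = (content A)%:E.
Proof. by move=> oA mA; rewrite /open_content ifT//; apply/asboolP. Qed.

Lemma open_content0 : open_content set0 = 0%E.
Proof. by rewrite open_contentE ?content0//; exact: open0. Qed.

Lemma open_content_ge0 A : (0 <= open_content A)%E.
Proof.
rewrite /open_content; case: ifPn => [/asboolP[_ mA]|_]; last exact: leey.
by rewrite lee_fin content_ge0.
Qed.

Definition open_outer : set T -> \bar R := mu_ext open_content.

HB.instance Definition _ := isOuterMeasure.Build R T open_outer
  (mu_ext0 open_content0 open_content_ge0) (mu_ext_ge0 open_content_ge0)
  (le_mu_ext open_content) (mu_ext_sigma_subadditive open_content_ge0).

Lemma open_outer_ub X (A : (set T)^nat) : (forall k, measurable (A k)) ->
  X `<=` \bigcup_k A k -> (open_outer X <= \sum_(k <oo) open_content (A k))%E.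
Proof. by move=> mA XA; apply: ereal_inf_lbound; exists A. Qed.

Lemma open_outer_open U : open U -> measurable U -> (open_outer U <= (content U)%:E)%E.
Proof.
move=> oU mU; pose A (n : nat) := if n is 0%N then U else set0.
have UA : U `<=` \bigcup_k A k by move=> z Uz; exists 0%N.
apply: le_trans (open_outer_ub _ UA) _; first by case => [//|k]; exact: measurable0.
have A0 k : true -> (0 <= open_content (A k))%E by rewrite open_content_ge0.
rewrite (nneseries_recl A0)// eseries0 => [|[]//=]; last by rewrite open_content0.
by rewrite adde0 open_contentE.
Qed.

(** A cover with a member that is not open has infinite total, so only open covers matter. *)
Lemma open_outer_lb X (b : \bar R) : (forall A : (set T)^nat,
    (forall k, open (A k)) -> (forall k, measurable (A k)) -> X `<=` \bigcup_k A k ->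
    (b <= \sum_(k <oo) (content (A k))%:E)%E) -> (b <= open_outer X)%E.
Proof.
move=> h; apply: le_ereal_inf_tmp => _ [A [mA XA] <-].
have [oA|/existsNP[k nAk]] := pselect (forall k, open (A k)).
  apply: le_trans (h A oA mA XA) _.
  by rewrite le_eqVlt; apply/orP; left; apply/eqP/eq_eseriesr => k _; rewrite open_contentE.
rewrite (nneseries_pinfty (k := k)) ?leey//.
  by move=> n _; exact: open_content_ge0.
by rewrite /open_content ifF//; apply/negbTE/asboolPn => -[].
Qed.

(** A countable open cover of the compact [F] has a finite subcover, and finite additivity suffices
    to give it total content at least 1. *)
Lemma open_outer_compact : (1 <= open_outer F)%E.
Proof.
apply: open_outer_lb => A oA mA FA.
have /compact_near_coveringP/(_ _ \oo (fun n z => exists2 i : nat, (i < n)%N & A i z)) := cF.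
have Ann x : F x -> \forall x' \near x & n \near \oo, exists2 i, (i < n)%N & A i x'.
  move=> /FA [k _ Akx]; exists (A k, [set n | (k < n)%N]); last first.
    by move=> [z n] /= [Akz kn]; exists k.
  by split; [exact: open_nbhs_nbhs (conj (oA k) Akx) | exists k.+1].
move=> /(_ _ Ann)[n _ /(_ n (leqnn n)) FD].
apply: (@le_trans _ _ (\sum_(0 <= i < n) (content (A i))%:E)%E); last first.
  by apply: nneseries_lim_ge => k _ _; rewrite lee_fin content_ge0.
rewrite big_mkord sumEFin lee_fin -(L_cst 1).
rewrite -(@L_sum n (fun k => \1_(A k))) => [|k]; last exact: bounded_on_indic.
apply: L_le; [exact: bounded_on_cst | |].
  by apply: (@bounded_on_sum n (fun k => \1_(A k))) => k; exact: bounded_on_indic.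
move=> z /FD [i ltin Aiz] /=.
by rewrite (bigD1 (Ordinal ltin))//= indicE mem_set// lerDl sumr_ge0.
Qed.

Section HalfPlane.
Variables (g : T -> R).
Hypotheses (cg : continuous g) (mg : measurable_fun setT g).

Let gtg c := [set z | c < g z].
Let ltg c := [set z | g z < c].

Let open_gtg c : open (gtg c).
Proof. by apply: (open_comp (D := [set r | c < r])); [move=> ? _; exact: cg | exact: open_gt]. Qed.

Let open_ltg c : open (ltg c).
Proof. by apply: (open_comp (D := [set r | r < c])); [move=> ? _; exact: cg | exact: open_lt]. Qed.

Let measurable_gtg c : measurable (gtg c).
Proof.
rewrite (_ : gtg c = setT `&` g @^-1` `]c, +oo[); first exact: mg.
by apply/seteqP; split => z /=; rewrite /gtg /= in_itv/= andbT; [|case].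
Qed.

Let measurable_ltg c : measurable (ltg c).
Proof.
rewrite (_ : ltg c = setT `&` g @^-1` `]-oo, c[); first exact: mg.
by apply/seteqP; split => z /=; rewrite /ltg /= in_itv/=; [|case].
Qed.

(** Each member A k of an open cover is cut into its parts where g > c and where g < c + d k. The
    second is slightly enlarged in order to be open; the overlaps have content at most e / 2^(k+1),
    with sum e. *)
Lemma caratheodory_regular c :
  (forall e, 0 < e -> exists d, 0 < d /\ content (gtg c `&` ltg (c + d)) <= e) ->
  open_outer.-caratheodory (gtg c).
Proof.
move=> reg; apply: le_caratheodory_measurable => X.
apply: open_outer_lb => A oA mA XA; apply/lee_addgt0Pr => e e0.
have en0 k : 0 < e / (2 ^ k.+1)%:R by rewrite divr_gt0// ltr0n expn_gt0.
have [d hd] := choice (fun k => reg _ (en0 k)).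
pose A1 k := A k `&` gtg c; pose A2 k := A k `&` ltg (c + d k).
have oA1 k : open (A1 k) by exact: openI.
have oA2 k : open (A2 k) by exact: openI.
have mA1 k : measurable (A1 k) by exact: measurableI.
have mA2 k : measurable (A2 k) by exact: measurableI.
have c1 : X `&` gtg c `<=` \bigcup_k A1 k.
  by move=> z [/XA[k _ Akz] gz]; exists k.
have c2 : X `&` ~` gtg c `<=` \bigcup_k A2 k.
  move=> z [/XA[k _ Akz] /negP]; rewrite -leNgt => gz; exists k => //; split => //.
  by rewrite /ltg /= (le_lt_trans gz)// ltrDl; case: (hd k).
apply: le_trans (leeD (open_outer_ub mA1 c1) (open_outer_ub mA2 c2)) _.
rewrite -nneseriesD => [|k _ _|k _ _]; do ?exact: open_content_ge0.
have cA0 k : (0 <= (content (A k))%:E)%E by rewrite lee_fin content_ge0.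
apply: le_trans (epsilon_trick xpredT cA0 (ltW e0)).
apply: lee_nneseries => [k _ _|k _]; first by rewrite adde_ge0// open_content_ge0.
rewrite !open_contentE// -!EFinD lee_fin.
case: (hd k) => _ hk; apply: le_trans (lerD (lexx _) hk).
have b A' : measurable A' -> bounded_on \1_A' by exact: bounded_on_indic.
have mS : measurable (gtg c `&` ltg (c + d k)) by exact: measurableI.
rewrite /content -[X in X + _]mul1r -[X in _ <= X + _]mul1r -!L_linear; do ?exact: b.
apply: L_le; [by apply: bounded_on_linear; exact: b | by apply: bounded_on_linear; exact: b |].
move=> z _; rewrite !mul1r /A1 /A2 !indicE !in_setI.
by case: (z \in A k); case: (z \in gtg c); case: (z \in ltg _) => //=; lra.
Qed.

(** The half plane is the union of those at levels s k, taken between c and c + 1/(k+1) among the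
    right continuity points of [G]. The minus sign makes [G] nondecreasing, and its increments bound
    the content of thin strips. *)
Lemma caratheodory_gt c : open_outer.-caratheodory (gtg c).
Proof.
pose G x := - content (gtg x).
have ndG : {homo G : x y / x <= y}.
  move=> x y xy; rewrite lerN2; apply: L_le; do ?exact: bounded_on_indic.
  move=> z _; rewrite !indicE ler_nat; have [/set_mem h|//] := boolP (z \in gtg y).
  by rewrite mem_set//; exact: le_lt_trans xy h.
have ltc k : c < c + k.+1%:R^-1 by rewrite ltrDl invr_gt0.
have [s hs] := choice (fun k => right_continuity_point ndG (ltc k)).
have -> : gtg c = \bigcup_k gtg (s k).
  apply/seteqP; split => z /=.
    rewrite /gtg /= -subr_gt0 => cz; have [k _ hk] := near_infty_natSinv_lt (PosNum cz).
    exists k => //=; case: (hs k) => /andP[_ sk] _; apply: lt_trans sk _.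
    by have := hk k (leqnn k); rewrite /= ltrBrDl.
  by move=> [k _ /=]; case: (hs k) => /andP[ck _] _; exact: lt_trans.
apply: caratheodory_measurable_bigcup => k.
apply: caratheodory_regular => e e0.
have [_ /(_ e e0)[d [d0 hd]]] := hs k; exists d; split => //.
apply: le_trans hd; rewrite /G opprK -mulN1r /content -L_linear; do ?exact: bounded_on_indic.
have mS : measurable (gtg (s k) `&` ltg (s k + d)) by exact: measurableI.
apply: L_le; [exact: bounded_on_indic | by apply: bounded_on_linear; exact: bounded_on_indic |].
move=> z _; rewrite mulN1r !indicE in_setI.
have : z \in ltg (s k + d) -> z \notin gtg (s k + d).
  move=> /set_mem h; rewrite notin_setE /gtg /=; apply/negP; rewrite -leNgt.
  exact: ltW h.
have : z \in gtg (s k + d) -> z \in gtg (s k).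
  move=> /set_mem h; apply: mem_set; apply: lt_trans h; by rewrite ltrDl.
case: (z \in gtg (s k)); case: (z \in ltg _); case: (z \in gtg (s k + d)) => //=.
all: by move=> h1 h2; try (by have := h1 isT); try (by have := h2 isT); lra.
Qed.

End HalfPlane.

Lemma measurable_caratheodory A : measurable A -> open_outer.-caratheodory A.
Proof.
have sa : sigma_algebra setT open_outer.-caratheodory.
  split; first exact: caratheodory_measurable_set0.
    by move=> B; rewrite setTD; exact: caratheodory_measurable_setC.
  exact: caratheodory_measurable_bigcup.
have ray (g : T -> R) : continuous g -> measurable_fun setT g ->
    forall B : set R, measurable B -> open_outer.-caratheodory (g @^-1` B).
  move=> cg mg B mB.
  have sag : sigma_algebra setT [set D | open_outer.-caratheodory (g @^-1` D)].
    split => /=; first exact: caratheodory_measurable_set0.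
      move=> D; rewrite setTD preimage_setC; exact: caratheodory_measurable_setC.
    by move=> D hD; rewrite preimage_bigcup; exact: caratheodory_measurable_bigcup.
  have : (@RGenOInfty.G R).-sigma.-measurable B by rewrite -RGenOInfty.measurableE.
  apply: (smallest_sub sag) => _ [c ->] /=.
  rewrite (_ : _ @^-1` _ = [set z | c < g z]); first exact: caratheodory_gt.
  by apply/seteqP; split => z /=; rewrite in_itv/= andbT.
apply: smallest_sub => // B [[D mD <-]|[D mD <-]]; rewrite setTI; apply: ray => //.
- by move=> z; exact: cvg_fst.
- by move=> z; exact: cvg_snd.
Qed.

Lemma open_outer_sigma_additive : semi_sigma_additive (open_outer : set T -> \bar R).
Proof.
move=> A mA tA mUA; apply: caratheodory_measure_sigma_additive => //.
  by move=> k; exact: measurable_caratheodory.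
exact: measurable_caratheodory.
Qed.

HB.instance Definition _ := isMeasure.Build _ T R open_outer
  (mu_ext0 open_content0 open_content_ge0) (mu_ext_ge0 open_content_ge0)
  open_outer_sigma_additive.

Lemma open_outerF : open_outer F = 1%E.
Proof.
apply/eqP; rewrite eq_le open_outer_compact andbT -contentT.
apply: le_trans (open_outer_open openT measurableT).
exact: le_mu_ext.
Qed.

Lemma open_outerT : open_outer setT = 1%E.
Proof.
apply/eqP; rewrite eq_le -{2}open_outerF le_mu_ext// andbT -contentT.
exact: open_outer_open openT measurableT.
Qed.

(** Only an inequality holds on open sets, since the content may see mass approaching the boundary
    from inside. With equal total masses it still determines the integrals of continuous
    functions. *)
Lemma representing_probability : exists nu : probability T R,
  nu F = 1%E /\ forall U, open U -> measurable U -> (nu U <= (content U)%:E)%E.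
Proof.
pose nu : probability T R := HB.pack open_outer
  (Measure_isProbability.Build _ _ _ open_outer open_outerT).
exists nu; split; [exact: open_outerF | exact: open_outer_open].
Qed.

End PositiveFunctional.

(** * Comparison of functionals by level sets *)

Section LayerCake.
Context {R : realType}.
Local Notation T := (R * R)%type.
Implicit Types (f g : T -> R) (U : set T).

(** Counting the integers from 1 to N strictly below t recovers t up to 1. Strictness makes the
    level sets of continuous functions open. *)
Lemma count_levels (N : nat) (t : R) : 0 <= t ->
  \sum_(k < N) (k.+1%:R < t)%R%:R <= t /\
  (t <= N.+1%:R -> t <= \sum_(k < N) (k.+1%:R < t)%R%:R + 1).
Proof.
move=> t0; elim: N => [|N [IH1 IH2]]; first by rewrite big_ord0 add0r.
rewrite big_ord_recr /=; have [Nt|tN] := ltP N.+1%:R t; last first.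
  by rewrite addr0; split => // _; exact: IH2.
have -> : \sum_(k < N) (k.+1%:R < t)%R%:R = N%:R :> R.
  rewrite -[N in RHS]card_ord -sumr_const; apply: eq_bigr => k _.
  by rewrite (lt_trans _ Nt)// ltr_nat ltnS.
by rewrite !natr1; split => //; exact: ltW.
Qed.

Variable F : set T.
Variables L1 L2 : (T -> R) -> R.
Hypothesis L1_linear : forall a f g, bounded_on F f -> bounded_on F g ->
  L1 (fun z => a * f z + g z) = a * L1 f + L1 g.
Hypothesis L1_ge0 : forall f, bounded_on F f -> (forall z, F z -> 0 <= f z) -> 0 <= L1 f.
Hypothesis L1_cst1 : L1 (cst 1) = 1.
Hypothesis L2_linear : forall a f g, bounded_on F f -> bounded_on F g ->
  L2 (fun z => a * f z + g z) = a * L2 f + L2 g.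
Hypothesis L2_ge0 : forall f, bounded_on F f -> (forall z, F z -> 0 <= f z) -> 0 <= L2 f.
Hypothesis L2_cst1 : L2 (cst 1) = 1.
Hypothesis L12 : forall U, open U -> measurable U -> L1 \1_U <= L2 \1_U.

(** With h the average of the level indicators plus 1/(N+1), f <= h <= f + 1/(N+1) on F, while [L12]
    compares the values of L1 and L2 at h. *)
Let le01 f : continuous f -> measurable_fun setT f -> (forall z, F z -> 0 <= f z <= 1) ->
  L1 f <= L2 f.
Proof.
move=> cf mf f01; apply/ler_addgt0Pr => e e0.
have bf : bounded_on F f.
  by split => //; exists 1 => z /f01/andP[f0 f1]; rewrite ger0_norm.
have [N N0] := near_infty_natSinv_lt (PosNum e0).
move=> /(_ N (leqnn N)) /= /ltW Ne.
pose U (k : nat) := [set z | k.+1%:R < N.+1%:R * f z].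
have cNf : continuous (fun z => N.+1%:R * f z).
  by move=> z; apply: cvgM; [exact: cvg_cst | exact: cf].
have oU k : open (U k).
  by apply: (open_comp (f := fun z => N.+1%:R * f z) (D := [set r | k.+1%:R < r])); [move=> ? _; exact: cNf | exact: open_gt].
have mU k : measurable (U k).
  have mNf : measurable_fun setT (fun z => N.+1%:R * f z) by exact: measurable_funM.
  rewrite (_ : U k = setT `&` (fun z => N.+1%:R * f z) @^-1` `]k.+1%:R, +oo[); first exact: mNf.
  by apply/seteqP; split => z /=; rewrite /U /= in_itv/= andbT; [|case].
have bU k : bounded_on F \1_(U k) by exact: bounded_on_indic.
pose S z := \sum_(k < N.+1) \1_(U k) z : R.
have bS : bounded_on F S by exact: (@bounded_on_sum R F N.+1 (fun k => \1_(U k))) bU.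
have SE z : S z = \sum_(k < N.+1) (k.+1%:R < N.+1%:R * f z)%R%:R.
  by apply: eq_bigr => k _; rewrite indicE mem_setE.
pose h z := N.+1%:R^-1 * S z + cst N.+1%:R^-1 z.
have bc : bounded_on F (cst N.+1%:R^-1) by exact: bounded_on_cst.
have bh : bounded_on F h by exact: bounded_on_linear.
have N1 : 0 < N.+1%:R :> R by rewrite ltr0n.
have fh z : F z -> f z <= h z.
  move=> /f01/andP[f0 f1]; have [_] := @count_levels N.+1 (N.+1%:R * f z) (mulr_ge0 (ltW N1) f0).
  have -> : h z = N.+1%:R^-1 * (S z + 1) by rewrite mulrDr mulr1.
  rewrite -SE ler_pdivlMl//; apply.
  by apply: (@le_trans _ _ N.+1%:R); rewrite ?ler_nat// ler_piMr// ltW.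
have hf z : F z -> h z <= N.+1%:R^-1 * cst 1 z + f z.
  move=> /f01/andP[f0 f1]; have [h1 _] := @count_levels N.+1 (N.+1%:R * f z) (mulr_ge0 (ltW N1) f0).
  by rewrite /h /= mulr1 addrC lerD2l ler_pdivrMl// SE.
have b1 := bounded_on_cst F 1.
apply: (@le_trans _ _ (L1 h)); first exact: (L_le L1_linear L1_ge0).
apply: (@le_trans _ _ (L2 h)).
  rewrite /h L1_linear// L2_linear// (L_cst L1_linear L1_cst1) (L_cst L2_linear L2_cst1).
  rewrite lerD2r ler_wpM2l ?invr_ge0 ?(ltW N1)//.
  rewrite /S (L_sum L1_linear L1_cst1 N.+1 bU) (L_sum L2_linear L2_cst1 N.+1 bU).
  by apply: ler_sum => k _; exact: L12.
apply: le_trans (L_le L2_linear L2_ge0 bh (bounded_on_linear _ b1 bf) hf) _.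
by rewrite L2_linear// L2_cst1 mulr1 addrC lerD2l.
Qed.

(** The reverse inequality is [le01] for 1 - f. *)
Let eq01 f : continuous f -> measurable_fun setT f -> (forall z, F z -> 0 <= f z <= 1) ->
  L1 f = L2 f.
Proof.
move=> cf mf f01; apply/eqP; rewrite eq_le le01//=.
have bf : bounded_on F f.
  by split => //; exists 1 => z /f01/andP[f0 f1]; rewrite ger0_norm.
have : L1 (fun z => -1 * f z + cst 1 z) <= L2 (fun z => -1 * f z + cst 1 z).
  apply: le01.
  - move=> z; apply: cvgD; last exact: cvg_cst.
    by apply: cvgM; [exact: cvg_cst | exact: cf].
  - by apply: measurable_funD => //; exact: measurable_funM.
  - by move=> z /f01/andP[f0 f1] /=; lra.
have b1 := bounded_on_cst F 1.
by rewrite L1_linear// L2_linear// L1_cst1 L2_cst1; lra.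
Qed.

Lemma functional_eq f : continuous f -> bounded_on F f -> L1 f = L2 f.
Proof.
move=> cf bf; have [mf [M0 hM0]] := bf.
pose M := `|M0| + 1; have M_gt0 : 0 < M by rewrite ltr_pwDr.
have hM z : F z -> `|f z| <= M.
  by move=> /hM0 h; rewrite (le_trans h)// (le_trans (ler_norm _))// lerDl.
(* The affine map t -> (t + M) / (2 M) sends [-M, M] into [0, 1]. *)
have : L1 (fun z => (2 * M)^-1 * f z + cst 2^-1 z) = L2 (fun z => (2 * M)^-1 * f z + cst 2^-1 z).
  apply: eq01.
  - move=> z; apply: cvgD; last exact: cvg_cst.
    by apply: cvgM; [exact: cvg_cst | exact: cf].
  - by apply: measurable_funD => //; exact: measurable_funM.
  - move=> z /hM; rewrite ler_norml => /andP[h1 h2] /=.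
    have -> : (2 * M)^-1 * f z + 2^-1 = (2 * M)^-1 * (f z + M) by field; rewrite gt_eqF.
    rewrite mulr_ge0 ?invr_ge0 ?mulr_ge0 ?(ltW M_gt0)//=; last by lra.
    by rewrite ler_pdivrMl ?mulr_gt0// mulr1; lra.
have bc := bounded_on_cst F 2^-1.
rewrite L1_linear// L2_linear// (L_cst L1_linear L1_cst1) (L_cst L2_linear L2_cst1).
by move/addIr/mulfI; apply; rewrite invr_eq0 mulf_neq0// gt_eqF.
Qed.

End LayerCake.

Lemma bounded_on_integrable (R : realType) (nu : probability (R * R)%type R)
    (F : set (R * R)) (f : R * R -> R) :
  measurable F -> bounded_on F f -> nu.-integrable F (EFin \o f).
Proof.
move=> mF [mf [M hM]]; apply: measurable_bounded_integrable => //.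
- by rewrite ltey_eq fin_num_measure.
- exact: measurable_funTS.
- exists M; split; first exact: num_real.
  by move=> x Mx z Fz /=; rewrite (le_trans (hM z Fz))// ltW.
Qed.

(** * Riesz representation on a compact set *)

Section RieszCompact.
Context {R : realType}.
Local Notation T := (R * R)%type.
Variables (F : set T) (L : (T -> R) -> R).
Hypothesis L_linear : forall a f g, bounded_on F f -> bounded_on F g ->
  L (fun z => a * f z + g z) = a * L f + L g.
Hypothesis L_ge0 : forall f, bounded_on F f -> (forall z, F z -> 0 <= f z) -> 0 <= L f.
Hypothesis L_cst1 : L (cst 1) = 1.
Hypotheses (cF : compact F) (mF : measurable F).

Lemma riesz_compact : exists nu : probability T R,
  nu F = 1%E /\ forall f, continuous f -> bounded_on F f ->
  \int[nu]_(z in F) f z = L f.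
Proof.
have [nu [nuF nuU]] := representing_probability L_linear L_ge0 L_cst1 cF.
exists nu; split => // f cf bf.
have intF g : bounded_on F g -> nu.-integrable F (EFin \o g) by exact: bounded_on_integrable.
apply: (functional_eq (F := F) (L1 := fun g => \int[nu]_(z in F) g z)) => //.
- move=> a g h bg bh; rewrite RintegralD ?RintegralZl//; do ?exact: intF.
  have := intF _ (bounded_on_linear a bg (bounded_on_cst F 0)).
  by congr (_.-integrable _ _); apply/funext => z /=; rewrite addr0.
- by move=> g _ g0; exact: Rintegral_ge0.
- by rewrite Rintegral_cst// mul1r; exact: (congr1 fine nuF).
- move=> U oU mU; rewrite /Rintegral integral_indic//.
  rewrite -lee_fin; apply: le_trans (nuU U oU mU).
  rewrite fineK ?fin_num_measure//; last exact: measurableI.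
  by apply: le_measure; rewrite ?inE//; exact: measurableI.
Qed.

End RieszCompact.

(** * Mass of the deltoid measure near the cusp *)

Section Cusp.
Context {R : realType}.
Variables (lambda : R) (mu : probability (R * R)%type R).
Hypothesis hmu : deltoid_measure lambda mu.
Local Notation leb := (@lebesgue_measure R).
Local Notation leb2 := (leb \x leb)%E.
Local Notation RR := (measurableTypeR R * measurableTypeR R)%type.

Let rect (x y e : R) : set (R * R) := `]x - e, x + e[ `*` `]y - e, y + e[.

Lemma mu_rectangle_gt0 (x y e : R) : 0 < e -> rect x y e `<=` @Omega R ->
  (0 < mu (rect x y e))%E.
Proof.
move=> e0 sub; set A := rect _ _ _.
have mA : measurable (A : set RR) by exact: measurableX.
have mA' : measurable A by exact: measurableX.
rewrite lt0e measure_ge0 andbT; apply/eqP => A0.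
have lebA : leb2 A = (2 * e * (2 * e))%:E.
  rewrite product_measure1E//= !lebesgue_measure_itv /= !lte_fin.
  have -> : forall t : R, t - e < t + e by move=> t; lra.
  have -> : forall t : R, t - e < t + e by move=> t; lra.
  by rewrite -!EFinB -EFinM; congr EFin; ring.
have [C [C0 hC]] := mu_weight hmu.
pose w (z : R * R) := weight (alpha lambda) (dP z.1 z.2).
have mw : measurable_fun (setT : set RR) (fun z : RR => C * w z * \1_A z).
  apply: measurable_funM; last exact: measurable_indic.
  by apply: measurable_funM => //; exact: measurable_weight.
have w0 z : 0 <= C * w z * \1_A z :> R.
  by rewrite !mulr_ge0 ?weight_ge0// ltW.
have int0 : (\int[leb2]_z `|(C * w z * \1_A z)%:E| = 0)%E.
  rewrite (eq_integral (fun z : RR => (C * w z * \1_A z)%:E)); last first.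
    by move=> z _; rewrite gee0_abs// lee_fin.
  have := hC (\1_A) (measurable_indic mA); rewrite /w => <-.
  by rewrite integral_indic// setIT; exact: A0.
have mEw : measurable_fun (setT : set RR) (fun z : RR => (C * w z * \1_A z)%:E).
  exact/measurable_EFinP.
have [N [mN N0 hN]] := (ae_eq_integral_abs leb2 (measurableT : measurable (setT : set RR)) mEw).1 int0.
have AN : A `<=` N.
  move=> z Az; apply: hN => /= /(_ I) [] /eqP; rewrite indicE mem_set// mulr1 mulf_eq0 gt_eqF//=.
  move/sub: Az; rewrite OmegaE /= => Pz.
  by rewrite /w /weight Pz gt_eqF// powR_gt0.
have : (leb2 A <= 0)%E by rewrite -N0; apply: le_measure; rewrite ?inE.
by rewrite lebA lee_fin leNgt !mulr_gt0.
Qed.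

(** The cusp is on the boundary, but each rectangle around it contains a smaller one inside Omega,
    where the density is positive. The averages below divide by this mass. *)
Lemma mu_cusp_gt0 e : 0 < e -> (0 < mu (rect 1 0 e))%E.
Proof.
move=> e0; have o : open (rect 1 0 e).
  rewrite (_ : rect 1 0 e = fst @^-1` `]1 - e, 1 + e[ `&` snd @^-1` `]0 - e, 0 + e[) //.
  apply: openI; apply: open_comp => [z _|]; do ?exact: interval_open.
    exact: cvg_fst.
  exact: cvg_snd.
have r10 : rect 1 0 e (1, 0) by split; rewrite /= in_itv /= ltrDl gtrBl e0.
have [[x y] [Oz rz]] := Omega_cusp (open_nbhs_nbhs (conj o r10)).
have : nbhs (x, y) (rect 1 0 e `&` @Omega R).
  by apply: open_nbhs_nbhs; split => //; apply: openI => //; exact: open_Omega.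
move=> /nbhs_ballP[d /= d0 hd].
have dsub : rect x y d `<=` rect 1 0 e `&` @Omega R.
  move=> z [/= z1 z2]; apply: hd; split => /=.
    by rewrite ball_itv.
  by rewrite ball_itv.
have mr u v r : measurable (rect u v r) by exact: measurableX.
have := mu_rectangle_gt0 d0 (subset_trans dsub (@subIsetr _ _ _)).
move=> /lt_le_trans; apply; apply: le_measure; rewrite ?inE//.
exact: subset_trans dsub (@subIsetl _ _ _).
Qed.

End Cusp.

(** * The functional given by K at the cusp *)

(** Compactness of the segment gives a cluster point, and an ultrafilter converges to its cluster
    points. *)
Lemma ultrafilter_bounded_cvg (R : realType) (U : set_system nat) (u : nat -> R) (M : R) :
  UltraFilter U -> (forall j, `|u j| <= M) -> cvg (u j @[j --> U]).
Proof.
move=> UU uM; have PU : ProperFilter U by exact: ultra_proper.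
have : (u j @[j --> U]) `[- M, M]%classic.
  by apply: (@filterS _ U _ setT) => [j _ /=|]; [rewrite in_itv /= -ler_norml | exact: filterT].
move=> /(@segment_compact R (- M) M _ _)[l [_ ul]]; apply/cvg_ex; exists l => V Vl.
have [//|UnV] := in_ultra_setVsetC (u @^-1` V) UU.
by have [x [/= nVx Vx]] := ul (~` V) V UnV Vl.
Qed.

Section MarkovFunctional.
Context {R : realType}.
Variables (lambda : R) (mu : probability (R * R)%type R).
Variable K : (R * R -> R) -> (R * R -> R).
Hypotheses (hmu : deltoid_measure lambda mu).
Hypotheses (hKbounded : bounded_linear_L2 mu K) (hKmarkov : is_markov mu K).
Local Notation L2 := (Lfun mu 2%:E).
Local Notation F := (closure (@Omega R)).
Implicit Types f g : R * R -> R.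

Let B (j : nat) : set (R * R) :=
  `]1 - j.+1%:R^-1, 1 + j.+1%:R^-1[ `*` `]0 - j.+1%:R^-1, 0 + j.+1%:R^-1[.

Let mB j : measurable (B j).
Proof. by apply: measurableX. Qed.

Let b j := fine (mu (B j)).

Let b_gt0 j : 0 < b j.
Proof.
have j0 : 0 < j.+1%:R^-1 :> R by rewrite invr_gt0.
apply: fine_gt0; apply/andP; split; first exact: mu_cusp_gt0 hmu _ j0.
by rewrite ltey_eq fin_num_measure.
Qed.

(** A substitute for the value of K f at the cusp, insensitive to the choice of a representative. *)
Definition cusp_average j f := inner mu (K f) \1_(B j) / b j.

Lemma L2_bounded_on f : bounded_on F f -> f \in L2.
Proof.
move=> [mf [M hM]]; apply: (L2_Omega_bounded hmu (M := M)) => // z Oz.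
by apply: hM; exact: subset_closure.
Qed.

Let L2B j : (\1_(B j) : R * R -> R) \in L2.
Proof. by apply: L2_bounded_on; exact: bounded_on_indic. Qed.

Let KL2 f : bounded_on F f -> K f \in L2.
Proof. by move=> bf; case: hKbounded => h _ _; apply: h; exact: L2_bounded_on. Qed.

Lemma cusp_average_linear j a f g : bounded_on F f -> bounded_on F g ->
  cusp_average j (fun z => a * f z + g z) = a * cusp_average j f + cusp_average j g.
Proof.
move=> bf bg; rewrite /cusp_average mulrA -mulrDl -inner_linear ?KL2//.
congr (_ / _); apply: ae_eq_inner => //.
- exact: KL2 (bounded_on_linear a bf bg).
- by apply: L2_linear; exact: KL2.
- by case: hKbounded => _ h _; apply: h; exact: L2_bounded_on.
Qed.

(** f is nonnegative only almost everywhere, so the integrand is replaced by its positive part. *)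
Lemma inner_indic_ge0 f A : measurable A -> f \in L2 -> {ae mu, forall z, 0 <= f z} ->
  0 <= inner mu f \1_A.
Proof.
move=> mA fL f0; have AL : (\1_A : R * R -> R) \in L2.
  by apply: L2_bounded_on; exact: bounded_on_indic.
rewrite (_ : inner mu f \1_A = \int[mu]_z Num.max (f z * \1_A z) 0); last first.
  have /integrableP[mfA _] := inner_integrable fL AL.
  congr fine; apply: ae_eq_integral => //.
    apply/measurable_EFinP; apply: measurable_maxr => //.
    exact/measurable_EFinP.
  by apply: filterS f0 => z f0 _; rewrite max_l// mulr_ge0.
by apply: Rintegral_ge0 => z _; rewrite le_max lexx orbT.
Qed.

Lemma cusp_average_ge0 j f : bounded_on F f -> (forall z, F z -> 0 <= f z) ->
  0 <= cusp_average j f.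
Proof.
move=> bf f0; rewrite divr_ge0 ?(ltW (b_gt0 j))//; apply: inner_indic_ge0 => //; first exact: KL2.
case: hKmarkov => _; apply; first exact: L2_bounded_on.
by apply: filterS (ae_Omega hmu) => z Oz; apply: f0; exact: subset_closure.
Qed.

Let inner_indic j : inner mu (cst 1) \1_(B j) = b j.
Proof.
rewrite /inner /Rintegral /b -[B j in RHS]setIT -integral_indic//.
by congr fine; apply: eq_integral => z _; rewrite mul1r.
Qed.

Lemma cusp_average1 j : cusp_average j (cst 1) = 1.
Proof.
rewrite /cusp_average (ae_eq_inner (g := cst 1)) ?inner_indic ?divff ?gt_eqF//.
- by apply: KL2; exact: bounded_on_cst.
- exact: L2_cst.
- by case: hKmarkov.
Qed.

(** K is bounded in L2 only; the uniform bound in the supremum norm comes from positivity and the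
    values at constants. It makes the averages converge along an ultrafilter. *)
Lemma cusp_average_bounded j f M : bounded_on F f -> (forall z, F z -> `|f z| <= M) ->
  `|cusp_average j f| <= M.
Proof.
move=> bf fM; have hl := @cusp_average_linear j; have h0 := @cusp_average_ge0 j.
have hc c : cusp_average j (cst c) = c by exact: (L_cst hl (cusp_average1 j)).
have fMM z : F z -> - M <= f z <= M by move=> /fM; rewrite ler_norml.
rewrite ler_norml; apply/andP; split.
  by rewrite -[leLHS]hc; apply: (L_le hl h0) => //; [exact: bounded_on_cst | move=> z /fMM/andP[]].
by rewrite -[leRHS]hc; apply: (L_le hl h0) => //; [exact: bounded_on_cst | move=> z /fMM/andP[]].
Qed.

Lemma cusp_average_cvg f p : bounded_on F f -> K f = p %[ae mu] -> continuous p ->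
  p \in L2 -> cusp_average j f @[j --> \oo] --> p (1, 0).
Proof.
move=> bf Kfp cp pL; apply/cvgrPdist_le => e e0.
have near_p : \forall j \near \oo, forall z, B j z -> `|p (1, 0) - p z| <= e.
  have := cp (1, 0); move=> /cvgrPdist_le/(_ e e0)/nbhs_ballP[d /= d0 hd].
  have [N _ hN] := near_infty_natSinv_lt (PosNum d0).
  exists N => // j /hN /= jd z [z1 z2]; apply: hd.
  split; rewrite -ball_normE /=.
    apply: lt_trans jd; move: z1; rewrite /= in_itv /= ltr_norml; move: (_^-1) => t /andP[h1 h2].
    by apply/andP; split; lra.
  apply: lt_trans jd; move: z2; rewrite /= in_itv /= ltr_norml; move: (_^-1) => t /andP[h1 h2].
    by apply/andP; split; lra.
near=> j.
have hj : forall z, B j z -> `|p (1, 0) - p z| <= e by near: j.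
rewrite /cusp_average (ae_eq_inner _ pL (L2B j) Kfp) ?KL2//.
have cB c : inner mu (cst c) \1_(B j) = c * b j.
  rewrite -inner_indic -inner_scale//; last exact: L2_cst.
  by congr inner; apply/funext => z /=; apply/esym; exact: mulr1.
have lo : (p (1, 0) - e) * b j <= inner mu p \1_(B j).
  rewrite -cB -subr_ge0 -inner_sub//; last exact: L2_cst.
  apply: Rintegral_ge0 => z _; rewrite indicE; have [/set_mem/hj h|_] := boolP (z \in B j).
    by move: h; rewrite mulr1 /= ler_norml; lra.
  by rewrite mulr0.
have hi : inner mu p \1_(B j) <= (p (1, 0) + e) * b j.
  rewrite -cB -subr_ge0 -inner_sub//; last exact: L2_cst.
  apply: Rintegral_ge0 => z _; rewrite indicE; have [/set_mem/hj h|_] := boolP (z \in B j).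
    by move: h; rewrite mulr1 /= ler_norml; lra.
  by rewrite mulr0.
by rewrite distrC ler_distl ler_pdivlMr// ler_pdivrMr// lo.
Unshelve. all: by end_near. Qed.

(** A single ultrafilter serves all f, which makes the limit linear in f. It refines the eventual
    filter, so when K f has a continuous version p the limit is the ordinary one, p(1, 0). *)
Lemma markov_measure : exists nu : probability (R * R)%type R, nu F = 1%E /\
  forall f p, continuous f -> bounded_on F f -> K f = p %[ae mu] -> continuous p ->
  p \in L2 -> \int[nu]_(z in F) f z = p (1, 0).
Proof.
have [U [UU sU]] := ultraFilterLemma (eventually_filter : ProperFilter \oo).
have PU : ProperFilter U by exact: ultra_proper.
have cvgU f : bounded_on F f -> cvg (cusp_average j f @[j --> U]).
  move=> bf; have [_ [M hM]] := bf.
  exact: (ultrafilter_bounded_cvg UU (fun j => cusp_average_bounded j bf hM)).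
pose L f := lim (cusp_average j f @[j --> U]).
have [nu [nuF nuL]] : exists nu : probability (R * R)%type R, nu F = 1%E /\
    forall f, continuous f -> bounded_on F f -> \int[nu]_(z in F) f z = L f.
  apply: riesz_compact.
  - move=> a f g bf bg; rewrite /L.
    under eq_fun do rewrite cusp_average_linear//.
    apply/cvg_lim => //; apply: cvgD; last exact: cvgU.
    by apply: cvgM; [exact: cvg_cst | exact: cvgU].
  - move=> f bf f0; apply: limr_ge; first exact: cvgU.
    by apply: nearW => j; exact: cusp_average_ge0.
  - by rewrite /L; under eq_fun do rewrite cusp_average1; exact: lim_cst.
  - exact: compact_closure_Omega.
  - exact: measurable_closure_Omega.
exists nu; split => // f p cf bf Kfp cp pL; rewrite nuL//.
apply/cvg_lim => //; apply: cvg_trans (cusp_average_cvg bf Kfp cp pL).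
by move=> A; exact: sU.
Qed.

End MarkovFunctional.

Lemma bounded_on_evalR (R : realType) (p : {poly {poly R[i]}}) :
  bounded_on (closure Omega) (evalR p).
Proof.
split; first exact: measurable_evalR.
have [M [_ hM]] := bounded_evalRI p; exists M => z /Omega_bounded[z1 z2].
by case: (hM z) => //; [apply: le_trans z1 _ | apply: le_trans z2 _]; rewrite ler1n.
Qed.

Theorem theorem6p3 (R : realType) (lambda : R)
  (mu : probability (R * R)%type R)
  (P Q : nat -> nat -> {poly {poly R[i]}})
  (K : (R * R -> R) -> (R * R -> R))
  (hlambda : 5 / 2 <= lambda)
  (hmu : deltoid_measure lambda mu)
  (hPQ : eigenbasis mu lambda P Q)
  (hKbounded : bounded_linear_L2 mu K)
  (hKsym : symmetric_L2 mu K)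
  (hKmarkov : is_markov mu K)
  (hKL : commutes_with_L mu lambda K) :
  exists a b c : nat -> nat -> R,
    (forall n k : nat, eigenspace_spanned lambda P Q n k ->
       K (evalR (P n k)) =
         a n k \*: evalR (P n k) \+ b n k \*: evalR (Q n k) %[ae mu] /\
       K (evalR (Q n k)) =
         b n k \*: evalR (P n k) \+ c n k \*: evalR (Q n k) %[ae mu]) /\
    (exists nu : probability (R * R)%type R,
       nu (closure Omega) = 1%E /\
       forall n k : nat, eigenspace_spanned lambda P Q n k ->
         a n k = \int[nu]_(z in closure Omega)
                   (evalR (P n k) z / evalR (P n k) (1, 0)) /\
         b n k = \int[nu]_(z in closure Omega)
                   (evalR (Q n k) z / evalR (P n k) (1, 0))).
Proof.
pose a n k := inner mu (K (evalR (P n k))) (evalR (P n k)).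
pose b n k := inner mu (K (evalR (P n k))) (evalR (Q n k)).
pose c n k := inner mu (K (evalR (Q n k))) (evalR (Q n k)).
have L2p p : evalR p \in Lfun mu 2%:E by exact: L2_evalR hmu p.
(* Symmetry of K identifies the two off-diagonal coefficients. *)
have bE n k : inner mu (K (evalR (Q n k))) (evalR (P n k)) = b n k.
  by rewrite /b innerC /inner -hKsym//; apply: eq_Rintegral => z _; rewrite mulrC.
have KPQ n k : eigenspace_spanned lambda P Q n k ->
    K (evalR (P n k)) = a n k \*: evalR (P n k) \+ b n k \*: evalR (Q n k) %[ae mu] /\
    K (evalR (Q n k)) = b n k \*: evalR (P n k) \+ c n k \*: evalR (Q n k) %[ae mu].
  move=> span; have [[rP rQ eP eQ] _] := eigenbasis_facts hlambda hmu hPQ n k.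
  split; first exact: (K_eigenspace hlambda hmu hPQ hKbounded hKL span rP eP).
  rewrite -bE; exact: (K_eigenspace hlambda hmu hPQ hKbounded hKL span rQ eQ).
exists a, b, c; split => //.
have [nu [nuF nuK]] := markov_measure hmu hKbounded hKmarkov.
exists nu; split => // n k span; have [KP KQ] := KPQ n k span.
have P1 := P_cusp hlambda hPQ span; have Q1 := Q_cusp hPQ n k.
have combE (s t : R) : s \*: evalR (P n k) \+ t \*: evalR (Q n k) =
    evalR (realC s * P n k + realC t * Q n k).
  by apply/funext => z /=; rewrite evalRD !evalR_realCM.
have intE p (s t : R) : K (evalR p) = s \*: evalR (P n k) \+ t \*: evalR (Q n k) %[ae mu] ->
    s = \int[nu]_(z in closure Omega) (evalR p z / evalR (P n k) (1, 0)).
  rewrite combE => Kp.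
  rewrite RintegralZr; last 2 first.
  - exact: measurable_closure_Omega.
  - by apply: bounded_on_integrable; [exact: measurable_closure_Omega | exact: bounded_on_evalR].
  rewrite (nuK _ _ (@continuous_evalR R p) (bounded_on_evalR p) Kp (@continuous_evalR R _) (L2p _)).
  by rewrite evalRD !evalR_realCM Q1 mulr0 addr0 mulfK.
by split; [exact: intE KP | exact: intE KQ].
Qed.
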